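(* Let $G$ be a finite $p$-solvable group and let $\chi\in\mathrm{Irr}(G)$ be such that $\chi^\circ\in\mathrm{IBr}(G)$. Let $(Q,\delta)$ be a Navarro vertex of $\chi$. Then $Q$ contains an anchor of $\chi$. Further, if $p$ is odd or $\delta$ is the trivial character, then $Q$ is an anchor of $\chi$.
   Context: $p$ is a prime, $\mathcal{O}$ is a complete discrete valuation ring with residue field $k=\mathcal{O}/J(\mathcal{O})$ of characteristic $p$ and field of fractions $K$ of characteristic $0$; $K$ and $k$ are assumed to be splitting fields for all finite groups under consideration. $\mathrm{Irr}(G)$ is the set of characters of simple $KG$-modules; $\mathrm{IBr}(G)$ is the set of Brauer characters of simple $kG$-modules; $\chi^\circ$ is the restriction of $\chi$ to the $p'$-elements of $G$. $e_\chi$ is the unique primitive idempotent in $Z(KG)$ with $\chi(e_\chi)\neq 0$. $G$ acts by conjugation on the $\mathcal{O}$-order $\mathcal{O}Ge_\chi\subseteq KGe_\chi$; $\mathrm{Tr}_P^G:(\mathcal{O}Ge_\chi)^P\to(\mathcal{O}Ge_\chi)^G$, $a\mapsto\sum_{x\in G/P}xax^{-1}$, is the relative trace map. An anchor of $\chi$ is a subgroup $P$ of $G$ minimal subject to $e_\chi\in \mathrm{Tr}_P^G((\mathcal{O}Ge_\chi)^P)$; the anchors form one $G$-conjugacy class of $p$-subgroups. Navarro vertices: let $G$ be $p$-solvable. A character $\alpha\in\mathrm{Irr}(G)$ is $p$-special (resp. $p'$-special) if $\alpha(1)$ is a power of $p$ (resp. prime to $p$) and, for every subnormal subgroup $S$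 of $G$ and every irreducible constituent $\theta$ of $\mathrm{Res}^G_S(\alpha)$, the order of the linear character $\det\theta$ is a power of $p$ (resp. prime to $p$). $\chi\in\mathrm{Irr}(G)$ is $p$-factorable if $\chi=\alpha\beta$ with $\alpha\in\mathrm{Irr}(G)$ $p'$-special and $\beta\in\mathrm{Irr}(G)$ $p$-special; such a factorization is then unique. A nucleus $(W,\gamma)$ of $\chi$ is defined recursively: if $\chi$ is $p$-factorable, the nucleus is $(G,\chi)$. Otherwise let $N$ be the unique largest normal subgroup of $G$ such that the irreducible constituents of $\mathrm{Res}^G_N(\chi)$ are $p$-factorable, let $\theta$ be one of these constituents; its stabiliser $T$ in $G$ is then a proper subgroup, and if $\psi\in\mathrm{Irr}(T)$ is the Clifford correspondent of $\chi$ over $\theta$ (so $\psi$ lies over $\theta$ and $\mathrm{Ind}_T^G(\psi)=\chi$), a nucleus of $\chi$ is a nucleus of $\psi$. Thus $\gamma\in\mathrm{Irr}(W)$ is $p$-factorable and $\mathrm{Ind}_W^G(\gamma)=\chi$; nuclei of $\chi$ are unique up to $G$-conjugacy. A Navarro vertex of $\chi$ is a pair $(Q,\delta)$ where, for some nucleus $(W,\gamma)$ of $\chi$ with $\gamma=\alpha\beta$, $\alpha$ $p'$-special and $\beta$ $p$-special, $Q$ is a Sylow $p$-subgroup of $W$ and $\delta=\mathrm{Res}^W_Q(\beta)$ (which is irreducible). *)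

(* Defs.v *)
From HB Require Import structures.
From mathcomp Require Import all_boot all_order all_fingroup all_algebra.
From mathcomp Require Import all_solvable mxrepresentation.

Set Implicit Arguments.
Unset Strict Implicit.
Unset Printing Implicit Defensive.

Import GRing.Theory.
Local Open Scope ring_scope.

(** * Complete discrete valuation rings and p-modular systems *)

Section ModularSystem.

Variables (O : idomainType) (K k : fieldType).

Definition rdvd (a b : O) : Prop := exists c, b = a * c.

Definition is_uniformizer (t : O) : Prop :=
  [/\ t != 0, t \isn't a GRing.unit
    & forall a, a != 0 ->
        exists n, exists2 u, u \is a GRing.unit & a = u * t ^+ n].

Definition adic_cauchy (t : O) (u : nat -> O) : Prop :=
  forall n, exists m, forall i j,
    (m <= i)%N -> (m <= j)%N -> rdvd (t ^+ n) (u i - u j).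

Definition adic_limit (t : O) (u : nat -> O) (l : O) : Prop :=
  forall n, exists m, forall i, (m <= i)%N -> rdvd (t ^+ n) (u i - l).

Definition complete_dvr : Prop :=
  exists2 t, is_uniformizer t
    & forall u, adic_cauchy t u -> exists l, adic_limit t u l.

(* K and k are given with their structure maps, which identify them with the
   fraction field of O and with O / J(O); since O is local, J(O) is the set of
   its non-units. *)
Record modular_system (p : nat)
    (iota : {rmorphism O -> K}) (red : {rmorphism O -> k}) : Prop := {
  ms_dvr : complete_dvr;
  ms_frac : forall x : K, exists a, exists2 b, b != 0 & x = iota a / iota b;
  ms_frac_inj : injective iota;
  ms_red_surj : forall y : k, exists a, red a = y;
  ms_red_ker : forall a, (red a == 0) = (a \isn't a GRing.unit);
  ms_pchar0 : [pchar K] =i pred0;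
  ms_pchar : p \in [pchar k]
}.

End ModularSystem.

Definition splitting_for_subgroups (F : fieldType) (gT : finGroupType)
    (G : {group gT}) : Prop :=
  forall H : {group gT}, H \subset G -> group_splitting_field F H.

(** * Ordinary characters with values in K *)

Section Characters.

Variables (K : fieldType) (gT : finGroupType).
Implicit Types (G H N S T W Q : {group gT}) (chi theta phi psi : {ffun gT -> K}).

(* As in classfun, characters of G are extended by 0 outside G. *)
Definition repr_char G n (rG : mx_representation K G n) : {ffun gT -> K} :=
  [ffun x => if x \in G then \tr (rG x) else 0].

Definition in_Irr G chi : Prop :=
  exists n, exists2 rG : mx_representation K G n,
    mx_irreducible rG & chi = repr_char rG.

Definition char_Res H chi : {ffun gT -> K} :=
  [ffun x => if x \in H then chi x else 0].

(* For psi supported on H. *)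
Definition char_Ind H G psi : {ffun gT -> K} :=
  [ffun x => if x \in G then #|H|%:R^-1 * \sum_(y in G) psi (x ^ y)%g else 0].

Definition char_mul phi psi : {ffun gT -> K} := [ffun x => phi x * psi x].

Definition char_triv H : {ffun gT -> K} := [ffun x => (x \in H)%:R].

Definition char_dot H phi psi : K :=
  #|H|%:R^-1 * \sum_(x in H) phi x * psi (x^-1)%g.

Definition is_constituent H theta phi : Prop :=
  in_Irr H theta /\ char_dot H phi theta != 0.

Definition char_stab G N theta : {set gT} :=
  [set y in G | [forall x in N, theta (x ^ y)%g == theta x]].

Lemma det_repr_order_ex H n (rH : mx_representation K H n) :
  exists m, (0 < m)%N && [forall x in H, \det (rH x) ^+ m == 1].
Proof.
exists #|H|; rewrite cardG_gt0; apply/forall_inP => x Hx; apply/eqP.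
suff <- : \det (rH (x ^+ #|H|)%g) = \det (rH x) ^+ #|H|.
  by rewrite expg_cardG // repr_mx1 det1.
elim: #|H| => [|m IHm]; first by rewrite expg0 repr_mx1 det1.
by rewrite expgS repr_mxM ?groupX // det_mulmx IHm exprS.
Qed.

(* The order of the linear character det of the representation rH. *)
Definition det_order H n (rH : mx_representation K H n) : nat :=
  ex_minn (det_repr_order_ex rH).

(** * Special characters, nuclei and Navarro vertices *)

(* For pi = p and pi = p^' these are the p-special and p'-special characters:
   p.-nat n says that n is a power of p, p^'.-nat n that p does not divide
   n > 0. *)
Definition special (pi : nat_pred) G alpha : Prop :=
  [/\ in_Irr G alpha,
      exists2 n : nat, pi.-nat n & alpha 1%g = n%:R
    & forall S, (S <|<| G)%g ->
      forall n (rS : mx_representation K S n), mx_irreducible rS ->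
        is_constituent S (repr_char rS) (char_Res S alpha) ->
        pi.-nat (det_order rS)].

Definition factorization (p : nat) G chi alpha beta : Prop :=
  [/\ special p^' G alpha, special p G beta & chi = char_mul alpha beta].

Definition factorable (p : nat) G chi : Prop :=
  in_Irr G chi /\ exists alpha beta, factorization p G chi alpha beta.

Definition factorable_below (p : nat) N chi : Prop :=
  forall theta, is_constituent N theta (char_Res N chi) ->
    factorable p N theta.

Definition max_factorable_normal (p : nat) G chi N : Prop :=
  [/\ (N <| G)%g, factorable_below p N chi
    & forall M : {group gT}, (M <| G)%g -> factorable_below p M chi -> M \subset N].

Definition clifford_correspondent G N T chi theta psi : Prop :=
  [/\ T :=: char_stab G N theta, in_Irr T psi,
      is_constituent N theta (char_Res N psi) & char_Ind T G psi = chi].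

Inductive nucleus (p : nat) :
    {group gT} -> {ffun gT -> K} -> {group gT} -> {ffun gT -> K} -> Prop :=
| nucleus_factorable G chi :
    factorable p G chi -> nucleus p G chi G chi
| nucleus_clifford G chi N theta T psi W gamma :
    ~ factorable p G chi ->
    max_factorable_normal p G chi N ->
    is_constituent N theta (char_Res N chi) ->
    clifford_correspondent G N T chi theta psi ->
    nucleus p T psi W gamma ->
    nucleus p G chi W gamma.

Definition navarro_vertex (p : nat) G chi Q (delta : {ffun gT -> K}) : Prop :=
  exists W gamma alpha beta,
    [/\ nucleus p G chi W gamma, factorization p W gamma alpha beta,
        (p.-Sylow(W) Q)%g & delta = char_Res Q beta].

End Characters.

Definition p_solvable (p : nat) (gT : finGroupType) (G : {group gT}) : Prop :=
  exists2 s : seq {group gT},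
    path (fun A B : {group gT} =>
            (A <| B)%g && (p.-group (B / A) || p^'.-group (B / A))%g) 1%G s
    & last 1%G s = G.

(** * Brauer characters *)

Section Brauer.

Variables (p : nat) (O : idomainType) (K k : fieldType).
Variables (iota : {rmorphism O -> K}) (red : {rmorphism O -> k}).
Variables (gT : finGroupType) (G : {group gT}).

(* The list s consists of the lifts to O, as roots of unity of p'-order, of the
   eigenvalues of x with multiplicity; it exists and is unique up to order for
   x a p'-element, since O is complete and k is a splitting field for <[x]>. *)
Definition brauer_value n (rG : mx_representation k G n) (x : gT) (v : K) :
    Prop :=
  exists s : seq O,
    [/\ all (fun z => z ^+ #[x]%g == 1) s,
        char_poly (rG x) = \prod_(z <- s) ('X - (red z)%:P)
      & v = \sum_(z <- s) iota z].

(* The restriction of chi to the p'-elements of G lies in IBr(G). *)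
Definition restriction_in_IBr (chi : {ffun gT -> K}) : Prop :=
  exists n, exists2 rG : mx_representation k G n,
    mx_irreducible rG
    & forall x, x \in G -> (p^'.-elt x)%g -> brauer_value rG x (chi x).

End Brauer.

(** * Group algebras and anchors *)

(* Elements of KG are the matrices in group_ring K G, that is, KG is identified
   with its image in the (faithful) regular representation. *)

Section Anchors.

Variables (O : idomainType) (K : fieldType) (iota : {rmorphism O -> K}).
Variables (gT : finGroupType) (G : {group gT}).
Implicit Types (A B e : 'M[K]_(gcard G)) (P R : {group gT}).

Local Notation aG := (regular_repr K G).
Local Notation KG := (group_ring K G).

Definition gring_coef A (x : gT) : K := gring_row A 0 (gring_index G x).

Definition in_OG A : Prop :=
  (A \in KG)%MS /\ forall x, x \in G -> exists a, gring_coef A x = iota a.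

Definition char_eval (chi : {ffun gT -> K}) A : K :=
  \sum_(x in G) gring_coef A x * chi x.

Definition central_idempotent e : Prop := (e \in 'Z(KG))%MS /\ e *m e = e.

Definition primitive_central_idempotent e : Prop :=
  [/\ central_idempotent e, e != 0
    & forall A B, central_idempotent A -> central_idempotent B ->
        A *m B = 0 -> e = A + B -> A = 0 \/ B = 0].

Definition char_idempotent (chi : {ffun gT -> K}) e : Prop :=
  primitive_central_idempotent e /\ char_eval chi e != 0.

Definition in_OGe e A : Prop := exists2 B, in_OG B & A = B *m e.

Definition gring_conj (x : gT) A : 'M[K]_(gcard G) :=
  aG x *m A *m aG (x^-1)%g.

Definition in_OGe_fixed e P A : Prop :=
  in_OGe e A /\ forall x, x \in P -> gring_conj x A = A.

Definition rel_trace P A : 'M[K]_(gcard G) :=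
  \sum_(C in lcosets P G) gring_conj (repr C) A.

Definition trace_condition (chi : {ffun gT -> K}) P : Prop :=
  P \subset G /\
  exists2 e, char_idempotent chi e
    & exists2 A, in_OGe_fixed e P A & rel_trace P A = e.

Definition is_anchor (chi : {ffun gT -> K}) P : Prop :=
  trace_condition chi P /\
  forall R, R \subset P -> trace_condition chi R -> R :=: P.

End Anchors.

(* Main.v *)
Require Import Defs.
From mathcomp Require Import all_boot all_order all_fingroup all_algebra.
From mathcomp Require Import all_solvable mxrepresentation mxabelem.
From mathcomp Require Import ring.
From Stdlib Require Import Classical.

(* Let X be an O-lattice affording chi. As chi restricts to an irreducible
   Brauer character, X / J(O) X is absolutely irreducible, so G spans End_O(X),
   the order OG e_chi is End_O(X), and e_chi is a trace from P if and only if
   id_X is. This irreducibility passes from Ind_W^G(gamma) to gamma and from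
   alpha beta to beta.

   If X is induced from a lattice Y of W affording gamma, the projection E of X
   onto Y satisfies Tr_W^G(E) = id_X, and |W : Q| is a unit of O, so id_X is a
   trace from Q. Conversely, if id_X = Tr_R^G(A) with R < Q, then gamma(1) is
   the sum over Rx in R\G of tr(E x^-1Ax). The summand is constant on the
   orbits of Q, and Q, of larger order than R, fixes no coset; so p divides
   gamma(1). When beta(1) = 1 this is excluded, as p does not divide alpha(1).

   It remains to see that beta(1) = 1 when p is odd. First, beta is monomial: a
   primitive character psi of T of p-power degree > 1 would yield a section E/Z
   of T, with Z acting by scalars, on which the commutator is a nondegenerate
   alternating form. The operator inducing inversion on this Heisenberg section
   is defined over O and its reduction commutes with T up to scalars equal to 1,
   so it is scalar; as p is odd, this forces E to act by scalars.
   Secondly, a p-special beta = Ind_S^T(l) with l linear has S = T: let C be the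
   core of S and D/C a nontrivial normal p- or p'-subgroup of T/C. If it is a
   p'-group, then |D : D n S|, a power of p, is 1. If it is a p-group, then the
   p'-elements of C act trivially, so D acts as a p-group, hence trivially, on
   the irreducible reduction, whereas elements outside S permute its blocks. *)

Set Implicit Arguments.
Unset Strict Implicit.
Unset Printing Implicit Defensive.

Import GRing.Theory.
Local Open Scope ring_scope.

(** * Representations that span the full matrix ring *)

(** The argument for odd p rests on p-power roots of unity of K becoming 1 in k. Dividing the action
    of x in E by a suitable root of unity gives an operator w(x) with w(x)^p = 1. The w(x) commute,
    and T permutes them by conjugation, up to p-th roots of unity. Modulo J(O) they are therefore
    commuting unipotent operators that T permutes, and irreducibility makes them all 1. So E becomes
    invisible modulo J(O), and what is carried back to K is a property of the inversion operator tau
    alone: after scaling it reduces to a nonzero scalar. Oddness of p provides square roots modulo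
    Z, whence tau has nonzero trace, and it makes 2 invertible in k, which excludes that tau
    anticommutes with a nonzero operator. For p = 2 inversion on the elementary abelian group E/Z is
    trivial, and tau would carry no information. *)

Lemma pchar0_natr_inj (F : fieldType) :
  [pchar F] =i pred0 -> injective (fun n : nat => n%:R : F).
Proof.
move=> char0 m n /eqP eq_mn; apply/eqP; rewrite eqn_leq.
wlog suff: m n eq_mn / (m <= n)%N.
  by move=> W; rewrite !W // eq_sym.
rewrite leqNgt; apply/negP=> lt_nm.
have : (m - n)%:R != 0 :> F by rewrite (pcharf0P F).1 // subn_eq0 -ltnNge.
by rewrite natrB ?(ltnW lt_nm) // subr_eq0 eq_mn.
Qed.

Section Spanning.

Variables (R : comUnitRingType) (gT : finGroupType) (G : {group gT}) (n : nat).
Variable rG : mx_representation R G n.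

(* Absolute irreducibility (for n > 0), in a form that also makes sense over O. *)
Definition rspan : Prop :=
  forall X : 'M[R]_n, exists a : gT -> R, X = \sum_(x in G) a x *: rG x.

Lemma matrix_central_scalar (M : 'M[R]_n) :
  (forall X, M *m X = X *m M) -> exists c, M = c%:M.
Proof.
case: n M => [|n'] M cM; first by exists 0; rewrite [M]flatmx0 [RHS]flatmx0.
exists (M 0 0); apply/matrixP=> i j; rewrite !mxE.
have := congr1 (fun A : 'M__ => A 0 j) (cM (delta_mx 0 i)).
rewrite mxE (bigD1 0) //= mxE !eqxx big1 /=; last first.
  by move=> k /negPf k0; rewrite mxE k0 mulr0.
rewrite addr0 mxE (bigD1 i) //= mxE !eqxx big1 /=; last first.
  by move=> k /negPf ki; rewrite mxE ki andbF mul0r.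
by rewrite mul1r addr0 eq_sym => <-; case: eqP => _; rewrite ?mulr1 ?mulr0 ?mulr1n ?mulr0n.
Qed.

Lemma rspan_cent_scalar (M : 'M[R]_n) :
  rspan -> (forall x, x \in G -> M *m rG x = rG x *m M) -> exists c, M = c%:M.
Proof.
move=> spG cM; apply: matrix_central_scalar => X; have [a ->] := spG X.
rewrite mulmx_sumr mulmx_suml; apply: eq_bigr => x Gx.
by rewrite -scalemxAr -scalemxAl cM.
Qed.

End Spanning.

Lemma abs_irr_rspan (F : fieldType) (gT : finGroupType) (G : {group gT}) n
    (rG : mx_representation F G n) :
  mx_absolutely_irreducible rG -> rspan rG.
Proof.
case/andP=> _ full X.
have /envelop_mxP[a ->] : (X \in enveloping_algebra_mx rG)%MS.
  exact: submx_full.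
by exists a.
Qed.

Lemma rspan_abs_irr (F : fieldType) (gT : finGroupType) (G : {group gT}) n
    (rG : mx_representation F G n) :
  (0 < n)%N -> rspan rG -> mx_absolutely_irreducible rG.
Proof.
move=> n0 sp; rewrite /mx_absolutely_irreducible n0 -sub1mx.
apply/row_subP=> i; rewrite -[row i _]vec_mxK; apply/envelop_mxP.
exact: sp.
Qed.

(* M |-> m / |N| * sum_x tr (M tau(x^-1)) sigma x is a section, compatible with
   both multiplications by N, of the map sending sigma x to tau x; at 1 it is
   the image under sigma of the central idempotent attached to tau. *)
Section Lift.

Variables (F : fieldType) (gT : finGroupType) (N : {group gT}) (m n : nat).
Variables (tau : mx_representation F N m) (sigma : mx_representation F N n).
Hypothesis char0 : [pchar F] =i pred0.

Let nat_neq0 k : (0 < k)%N -> k%:R != 0 :> F.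
Proof. by move=> k0; rewrite (pcharf0P F).1 // -lt0n. Qed.

Definition rlift (M : 'M[F]_m) : 'M[F]_n :=
  \sum_(x in N) (m%:R / #|N|%:R * \tr (M *m tau x^-1%g)) *: sigma x.

Lemma rliftD M M' : rlift (M + M') = rlift M + rlift M'.
Proof.
rewrite /rlift -big_split; apply: eq_bigr => x _ /=.
by rewrite mulmxDl mxtraceD mulrDr scalerDl.
Qed.

Lemma rliftZ c M : rlift (c *: M) = c *: rlift M.
Proof.
rewrite /rlift scaler_sumr; apply: eq_bigr => x _.
by rewrite -scalemxAl mxtraceZ mulrCA scalerA.
Qed.

Lemma rlift0 : rlift 0 = 0.
Proof. by rewrite -[0 in LHS](scale0r 0) rliftZ scale0r. Qed.

Lemma rlift_sum I (r : seq I) (P : pred I) (E : I -> 'M[F]_m) :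
  rlift (\sum_(i <- r | P i) E i) = \sum_(i <- r | P i) rlift (E i).
Proof. exact: (big_morph rlift rliftD rlift0). Qed.

Lemma rliftMl y M : y \in N -> rlift (tau y *m M) = sigma y *m rlift M.
Proof.
move=> Ny; rewrite /rlift mulmx_sumr (reindex_inj (mulgI y)) /=.
apply: eq_big => [x | x Nx]; first by rewrite groupMl.
have {}Nx : x \in N by rewrite -(groupMl x Ny).
rewrite -scalemxAr -repr_mxM //; congr (_ *: _); congr (_ * _).
rewrite mxtrace_mulC mulmxA -repr_mxM ?groupV ?groupM //.
by rewrite invMg mulgKV mxtrace_mulC.
Qed.

Lemma rliftMr y M : y \in N -> rlift (M *m tau y) = rlift M *m sigma y.
Proof.
move=> Ny; rewrite /rlift mulmx_suml (reindex_inj (mulIg y)) /=.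
apply: eq_big => [x | x Nx]; first by rewrite groupMr.
have {}Nx : x \in N by rewrite -(groupMr x Ny).
rewrite -scalemxAl -repr_mxM //; congr (_ *: _); congr (_ * _).
by rewrite -mulmxA -repr_mxM ?groupV ?groupM // invMg mulKVg.
Qed.

End Lift.

Section DeltaMx.

Variable R : comNzRingType.

Lemma mxtrace_delta_mul m n (i : 'I_m) (j : 'I_n) (A : 'M[R]_(n, m)) :
  \tr (delta_mx i j *m A) = A j i.
Proof.
rewrite /mxtrace (bigD1 i) //= big1 ?addr0 => [|u /negPf ui].
  rewrite mxE (bigD1 j) //= big1 ?addr0 => [|v /negPf vj].
    by rewrite mxE !eqxx mul1r.
  by rewrite mxE vj andbF mul0r.
by rewrite mxE big1 // => v _; rewrite mxE ui mul0r.
Qed.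

Lemma mxtrace_delta n (i j : 'I_n) : \tr (delta_mx i j : 'M[R]_n) = (i == j)%:R.
Proof. by rewrite -[delta_mx i j]mulmx1 mxtrace_delta_mul mxE eq_sym. Qed.

Lemma mul_delta_mxE m n k l (A : 'M[R]_(k, m)) (i : 'I_m) (j : 'I_n)
    (B : 'M[R]_(n, l)) u v :
  (A *m delta_mx i j *m B) u v = A u i * B j v.
Proof.
rewrite mxE (bigD1 j) //= [X in _ + X]big1 ?addr0 => [|w /negPf wj].
  rewrite mxE (bigD1 i) //= big1 ?addr0 => [|w /negPf wi].
    by rewrite mxE !eqxx mulr1.
  by rewrite mxE wi mulr0.
by rewrite mxE big1 ?mul0r // => x _; rewrite mxE wj andbF mulr0.
Qed.

End DeltaMx.

Section LiftSpan.

Variables (F : fieldType) (gT : finGroupType) (N : {group gT}) (m : nat).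
Variables (tau : mx_representation F N m).
Hypotheses (char0 : [pchar F] =i pred0) (spN : rspan tau) (m_gt0 : (0 < m)%N).

Let nat_neq0 k : (0 < k)%N -> k%:R != 0 :> F.
Proof. by move=> k0; rewrite (pcharf0P F).1 // -lt0n. Qed.

(** The sum commutes with [tau], hence is a scalar, and its trace is |N| tr M. *)
Lemma rspan_Schur (M : 'M[F]_m) :
  \sum_(x in N) tau x *m M *m tau x^-1%g = (#|N|%:R / m%:R * \tr M)%:M.
Proof.
have [|c def_c] := rspan_cent_scalar (M := \sum_(x in N) tau x *m M *m tau x^-1%g) spN.
  move=> y Ny; rewrite mulmx_suml mulmx_sumr (reindex_inj (mulgI y)) /=.
  apply: eq_big => [x | x Nx]; first by rewrite groupMl.
  have {}Nx : x \in N by rewrite -(groupMl x Ny).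
  rewrite invMg !repr_mxM ?groupV // !mulmxA.
  by rewrite repr_mxKV.
rewrite def_c; congr _%:M.
have: \tr (c%:M : 'M_m) = #|N|%:R * \tr M.
  rewrite -def_c raddf_sum /= (eq_bigr (fun=> \tr M)) ?sumr_const ?mulr_natl //.
  by move=> x Nx; rewrite mxtrace_mulC mulmxA -repr_mxM ?groupV // mulVg repr_mx1 mul1mx.
rewrite mxtrace_scalar => trc; apply: (mulIf (nat_neq0 m_gt0)).
by rewrite mulr_natr trc mulrAC mulfVK ?nat_neq0.
Qed.

Lemma rlift_id (M : 'M[F]_m) : rlift tau tau M = M.
Proof.
have Nn0 : #|N|%:R != 0 :> F by rewrite nat_neq0.
rewrite [M in RHS]matrix_sum_delta [M in LHS]matrix_sum_delta rlift_sum.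
apply: eq_bigr => i _; rewrite rlift_sum; apply: eq_bigr => j _.
rewrite rliftZ; congr (_ *: _); apply/matrixP=> k l.
(* Coefficient (k, l) of the lift of [delta_mx i j] is m/|N| times entry (k, i) of the Schur sum of
   [delta_mx l j]: both add up products of an entry of [tau x] and an entry of [tau x^-1]. *)
have := congr1 (fun A : 'M__ => A k i) (rspan_Schur (delta_mx l j)).
rewrite /rlift !summxE => eq_ki.
transitivity (m%:R / #|N|%:R * \sum_(x in N) (tau x *m delta_mx l j *m tau x^-1%g) k i).
  rewrite mulr_sumr; apply: eq_bigr => x Nx.
  by rewrite mxE mxtrace_delta_mul mul_delta_mxE -mulrA [X in _ * X]mulrC.
rewrite eq_ki !mxE; move: (\tr _) (mxtrace_delta F l j) => t ->.
case: (k == i); rewrite ?mulr0n ?mulr0 //= mulr1n mulrA mulrA mulfVK //.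
by rewrite mulfV ?nat_neq0 // mul1r.
Qed.

Variables (n : nat) (sigma : mx_representation F N n).

Lemma rlift_comb (a : gT -> F) (M : 'M[F]_m) :
  rlift tau sigma ((\sum_(x in N) a x *: tau x) *m M)
    = (\sum_(x in N) a x *: sigma x) *m rlift tau sigma M.
Proof.
rewrite mulmx_suml rlift_sum mulmx_suml; apply: eq_bigr => x Nx.
by rewrite -!scalemxAl rliftZ rliftMl.
Qed.

Lemma rliftM M M' :
  rlift tau sigma (M *m M') = rlift tau sigma M *m rlift tau sigma M'.
Proof. by rewrite -[X in rlift tau sigma (X *m _)]rlift_id rlift_comb. Qed.

Lemma rlift1_cent x : x \in N ->
  rlift tau sigma 1%:M *m sigma x = sigma x *m rlift tau sigma 1%:M.
Proof. by move=> Nx; rewrite -rliftMl // -rliftMr // mul1mx mulmx1. Qed.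

Lemma rlift_rep x : x \in N ->
  rlift tau sigma (tau x) = sigma x *m rlift tau sigma 1%:M.
Proof. by move=> Nx; rewrite -rliftMl // mulmx1. Qed.

(** Applied to the inclusion of a submodule, it says that the lift of M acts there as M; for M = 1
    this shows that the idempotent does not vanish. *)
Lemma rlift_intertwine (U : 'M[F]_(m, n)) M :
  (forall x, x \in N -> tau x *m U = U *m sigma x) ->
  M *m U = U *m rlift tau sigma M.
Proof.
move=> hU; rewrite -[M in LHS]rlift_id mulmx_suml mulmx_sumr.
by apply: eq_bigr => x Nx; rewrite -scalemxAl -scalemxAr hU.
Qed.

End LiftSpan.

(** Write X = C D with C and D of full rank; cancelling C on the left and D on the right in C D C D
    = C D leaves D C = 1. The factors give coordinates on the image of X. *)
Lemma idempotent_factor (F : fieldType) n (X : 'M[F]_n) :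
  X *m X = X -> row_base X *m col_base X = 1%:M.
Proof.
move=> idX; have /row_fullP[L LK] := col_base_full X.
have /row_freeP[R KR] := row_base_free X.
have eqX := mulmx_base X.
have : L *m (col_base X *m row_base X *m (col_base X *m row_base X)) *m R
     = L *m (col_base X *m row_base X) *m R by rewrite !eqX idX.
move: (col_base X) (row_base X) LK KR => C D LK KR.
by rewrite !mulmxA LK mul1mx -!mulmxA KR mulmx1.
Qed.

Lemma mxtrace_idempotent (F : fieldType) n (X : 'M[F]_n) :
  X *m X = X -> \tr X = (\rank X)%:R.
Proof.
by move=> idX; rewrite -{1}[X]mulmx_base mxtrace_mulC idempotent_factor // mxtrace1.
Qed.

(** * Lattices over a discrete valuation ring *)

(** Used with divisibility: it finds an entry, or a determinant, of least valuation without
    introducing the valuation itself. *)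
Lemma total_preorder_min (I : eqType) (R : I -> I -> Prop) (s : seq I) :
  (forall i, R i i) -> (forall i j, R i j \/ R j i) ->
  (forall i j l, R i j -> R j l -> R i l) ->
  s != [::] -> exists2 i, i \in s & forall j, j \in s -> R i j.
Proof.
move=> Rxx Rtot Rtr; elim: s => [//|i s IHs] _.
have [->|s_n0] := eqVneq s [::].
  by exists i; rewrite ?mem_head // => j; rewrite inE => /eqP->.
have [i1 s_i1 min_i1] := IHs s_n0.
have [Rii1|Ri1i] := Rtot i i1.
  exists i; rewrite ?mem_head // => j; rewrite inE => /predU1P[->//|/min_i1].
  exact: Rtr.
by exists i1; rewrite ?inE ?s_i1 ?orbT // => j /predU1P[->//|/min_i1].
Qed.

Section ModSystem.

Variables (p : nat) (O : idomainType) (K k : fieldType).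
Variables (iota : {rmorphism O -> K}) (red : {rmorphism O -> k}).
Hypothesis Omod : modular_system p iota red.

Let iotaI := ms_frac_inj Omod.
Let char0 := ms_pchar0 Omod.

Definition integral_elt (x : K) : Prop := exists a, x = iota a.

Lemma iota_eq0 a : (iota a == 0) = (a == 0).
Proof. by rewrite -(inj_eq iotaI) rmorph0. Qed.

Lemma natK_neq0 n : (0 < n)%N -> n%:R != 0 :> K.
Proof. by move=> n0; rewrite (pcharf0P K).1 // -lt0n. Qed.

Lemma natK_inj : injective (fun n : nat => n%:R : K).
Proof. exact: pchar0_natr_inj char0. Qed.

Lemma unit_red a : (a \is a GRing.unit) = (red a != 0).
Proof. by rewrite (ms_red_ker Omod) negbK. Qed.

Lemma natO_unit n : ~~ (p %| n)%N -> (n%:R : O) \is a GRing.unit.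
Proof. by move=> pn; rewrite unit_red rmorph_nat -(dvdn_pcharf (ms_pchar Omod)). Qed.

Lemma rdvd_total (a b : O) : rdvd a b \/ rdvd b a.
Proof.
have [t [tn0 tnU uniq_t] _] := ms_dvr Omod.
have [->|a0] := eqVneq a 0; first by right; exists 0; rewrite mulr0.
have [->|b0] := eqVneq b 0; first by left; exists 0; rewrite mulr0.
have [m [u Uu ->]] := uniq_t a a0; have [n [v Uv ->]] := uniq_t b b0.
wlog le_mn: m n u v Uu Uv / (m <= n)%N.
  move=> W; have [le_mn|/ltnW le_nm] := leqP m n; first exact: W.
  by have [] := W n m v u Uv Uu le_nm; [right | left].
left; exists (u^-1 * v * t ^+ (n - m)).
rewrite -[X in t ^+ X](subnKC le_mn) exprD mulrACA mulVKr //.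
Qed.

Lemma frac_total (x y : K) :
  (exists c, y = iota c * x) \/ (exists c, x = iota c * y).
Proof.
have [a [b b0 ->]] := ms_frac Omod x; have [a' [b' b'0 ->]] := ms_frac Omod y.
have ib: iota b != 0 by rewrite iota_eq0.
have ib': iota b' != 0 by rewrite iota_eq0.
have [[c eqc]|[c eqc]] := rdvd_total (a * b') (a' * b); [left|right]; exists c.
  by apply/eqP; rewrite mulrA eqr_div // -!rmorphM eqc; apply/eqP; congr (iota _); rewrite mulrC mulrA.
by apply/eqP; rewrite mulrA eqr_div // -!rmorphM eqc; apply/eqP; congr (iota _); rewrite mulrC mulrA.
Qed.

Lemma matrix_lift m n (M : 'M[K]_(m, n)) :
  (forall i j, integral_elt (M i j)) -> exists M0, map_mx iota M0 = M.
Proof.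
move=> intM.
have ex i j : exists a, M i j == iota a by have [a ->] := intM i j; exists a.
exists (\matrix_(i, j) xchoose (ex i j)); apply/matrixP=> i j.
by rewrite !mxE -(eqP (xchooseP (ex i j))).
Qed.

Lemma map_iota_inj m n : injective (map_mx iota : 'M[O]_(m, n) -> 'M[K]_(m, n)).
Proof.
move=> A B /matrixP eqAB; apply/matrixP=> i j; apply: iotaI.
by have := eqAB i j; rewrite !mxE.
Qed.

(** Divide by an entry of least valuation: that entry becomes 1, so the reduction cannot vanish. *)
Lemma matrix_normalize m n (D : 'M[K]_(m, n)) : D != 0 ->
  exists2 c, c != 0 & exists2 D0, map_mx iota D0 = c *: D & map_mx red D0 != 0.
Proof.
move=> D0; pose s := [seq ij <- enum {: 'I_m * 'I_n} | D ij.1 ij.2 != 0].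
have s_n0 : s != [::].
  apply: contraNneq D0 => s0; apply/eqP/matrixP=> i j; rewrite mxE; apply/eqP.
  apply: contraFT (in_nil (i, j)) => Dij.
  by rewrite -s0 mem_filter Dij mem_enum.
pose R (a b : 'I_m * 'I_n) := exists c, D b.1 b.2 = iota c * D a.1 a.2.
have [|||[i j]] := @total_preorder_min _ R s _ _ _ s_n0.
- by move=> a; exists 1; rewrite rmorph1 mul1r.
- by move=> a b; apply: frac_total.
- move=> a b l [c eqc] [d eqd]; exists (d * c).
  by rewrite eqd eqc rmorphM mulrA.
rewrite mem_filter /= => /andP[Dij _] min_ij.
exists (D i j)^-1; first by rewrite invr_eq0.
have [u v|D1 eqD1] := matrix_lift (M := (D i j)^-1 *: D).
  rewrite mxE; have [->|Duv] := eqVneq (D u v) 0.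
    by exists 0; rewrite mulr0 rmorph0.
  have [|c ->] := min_ij (u, v); first by rewrite mem_filter mem_enum Duv.
  by exists c; rewrite mulrC mulfK.
exists D1 => //; apply/eqP=> /matrixP/(_ i j); rewrite !mxE => /eqP.
have -> : D1 i j = 1.
  by apply: iotaI; have /matrixP/(_ i j) := eqD1; rewrite !mxE mulVf // rmorph1.
by rewrite rmorph1 oner_eq0.
Qed.

Lemma integral_unity x n : (0 < n)%N -> x ^+ n = 1 -> integral_elt x.
Proof.
move=> n0 xn1; have [[c eqc]|[c eqc]] := frac_total 1 x.
  by exists c; rewrite eqc mulr1.
(* Here c = x^-1, and x^n = 1 gives x = c^(n-1). *)
exists (c ^+ n.-1); rewrite rmorphXn.
have x0 : x != 0 by apply/eqP=> x0; move/eqP: eqc; rewrite x0 mulr0 oner_eq0.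
have -> : iota c = x^-1 by apply: (mulIf x0); rewrite -eqc mulVf.
apply: (mulfI (expf_neq0 n.-1 x0)).
by rewrite exprVn mulfV ?expf_neq0 // -exprSr prednK.
Qed.

(** In characteristic p, z^p - 1 = (z - 1)^p. *)
Lemma red_unity (z : k) m : z ^+ (p ^ m) = 1 -> z = 1.
Proof.
elim: m z => [|m IHm] z; first by rewrite expn0 expr1.
rewrite expnSr exprM => zpm; apply: IHm; apply/eqP; rewrite -subr_eq0.
have := pFrobenius_autB_comm (ms_pchar Omod) (commr1 (z ^+ (p ^ m))).
rewrite pFrobenius_aut1 [X in _ = X - _]pFrobenius_autE zpm subrr pFrobenius_autE.
by move/eqP; rewrite expf_eq0 => /andP[].
Qed.

Section Form.

Variables (gT : finGroupType) (H : {group gT}) (n : nat).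
Variable rH : mx_representation K H n.

(* Among the bases extracted from the rows of the rH x, one whose determinant
   divides all the others spans, by Cramer's rule, an H-stable O-lattice. *)
Lemma integral_form : exists (rO : mx_representation O H n) (B : 'M[K]_n),
  B \in unitmx /\
  forall x, x \in H -> map_mx iota (rO x) = B *m rH x *m invmx B.
Proof.
pose J := {ffun 'I_n -> gT * 'I_n}.
pose Bs (f : J) : 'M[K]_n := \matrix_i row (f i).2 (rH (f i).1).
pose P (f : J) := [forall i, (f i).1 \in H] && (\det (Bs f) != 0).
pose R (f f' : J) := exists c, \det (Bs f') = iota c * \det (Bs f).
have s_n0 : enum P != [::].
  pose f1 : J := [ffun i => (1%g, i)].
  suff: f1 \in enum P by case: (enum P).
  rewrite mem_enum; apply/andP; split; first by apply/forallP=> i; rewrite /f1 ffunE /=.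
  have -> : Bs f1 = 1%:M by apply/row_matrixP=> i; rewrite rowK ffunE /= repr_mx1.
  by rewrite det1 oner_eq0.
have [|||f] := @total_preorder_min _ R (enum P) _ _ _ s_n0.
- by move=> a; exists 1; rewrite rmorph1 mul1r.
- by move=> a b; apply: frac_total.
- move=> a b l [c eqc] [d eqd]; exists (d * c).
  by rewrite eqd eqc rmorphM mulrA.
rewrite mem_enum => /andP[/forallP Hf detf] min_f.
pose B := Bs f; have uB : B \in unitmx by rewrite unitmxE unitfE.
have intB x i l : x \in H -> forall j, integral_elt ((row l (rH x) *m invmx B) i j).
  move=> Hx j; pose f' : J := [ffun u => if u == j then (x, l) else f u].
  have det_f' : \det (Bs f') = \det B * (row l (rH x) *m invmx B) i j.
    rewrite [i]ord1 (expand_det_row _ j) mxE mulr_sumr; apply: eq_bigr => u _.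
    rewrite /invmx uB !mxE ffunE eqxx /= [RHS]mulrCA (mulrA (\det B)) mulfV ?mul1r //.
    congr (_ * (_ * \det _)); apply/matrixP=> a b; rewrite !mxE ffunE.
    by rewrite eq_sym (negPf (neq_lift _ _)).
  have [f'0|f'0] := eqVneq (\det (Bs f')) 0.
    exists 0; rewrite rmorph0; apply/eqP; move: f'0; rewrite det_f' => /eqP.
    by rewrite mulf_eq0 (negPf detf).
  have [|c eqc] := min_f f'.
    rewrite mem_enum; apply/andP; split=> //; apply/forallP=> u; rewrite ffunE.
    by case: ifP.
  exists c; apply: (mulfI detf); rewrite -/B -det_f' eqc mulrC //.
have ex x : exists A, (x \in H) ==> (map_mx iota A == B *m rH x *m invmx B).
  case Hx: (x \in H); last by exists 0.
  have [i j|A eqA] := matrix_lift (M := B *m rH x *m invmx B); last by exists A; rewrite eqA eqxx.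
  (* Row i of B is a row of [rH (f i).1], so row i of its product with [rH x] is a row of
     [rH ((f i).1 * x)], to which [intB] applies. *)
  have -> : (B *m rH x *m invmx B) i j
    = (row (f i).2 (rH ((f i).1 * x)%g) *m invmx B) 0 j.
    transitivity (row i (B *m rH x *m invmx B) 0 j); first by rewrite [RHS]mxE.
    by rewrite repr_mxM // !row_mul rowK.
  by apply: intB; rewrite groupM.
pose r x := xchoose (ex x).
have rE x : x \in H -> map_mx iota (r x) = B *m rH x *m invmx B.
  by move=> Hx; apply/eqP; have /implyP := xchooseP (ex x); apply.
have r_repr : mx_repr H r.
  split=> [|x y Hx Hy]; apply: map_iota_inj.
    by rewrite rE // repr_mx1 mulmx1 mulmxV // map_mx1.
  by rewrite map_mxM !rE ?groupM // repr_mxM // !mulmxA mulmxKV.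
by exists (MxRepresentation r_repr), B.
Qed.

End Form.

End ModSystem.

(** * Induced representations and tensor products *)

Section FinMatrix.

Variables (R : comUnitRingType) (I : finType).
Implicit Types (F : I -> I -> R) (A : 'M[R]_#|I|).

Definition fmx F : 'M[R]_#|I| := \matrix_(a, b) F (enum_val a) (enum_val b).
Definition fmxE A (i j : I) : R := A (enum_rank i) (enum_rank j).

Lemma fmxK F i j : fmxE (fmx F) i j = F i j.
Proof. by rewrite /fmxE mxE !enum_rankK. Qed.

Lemma eq_fmx F F' : F =2 F' -> fmx F = fmx F'.
Proof. by move=> eqF; apply/matrixP=> a b; rewrite !mxE. Qed.

Lemma sum_enum_val (V : nmodType) (f : I -> V) :
  \sum_(a < #|I|) f (enum_val a) = \sum_i f i.
Proof.
by rewrite [RHS](reindex (@enum_val _ I)) //; apply: onW_bij; apply: enum_val_bij.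
Qed.

Lemma fmxM F F' : fmx F *m fmx F' = fmx (fun i j => \sum_l F i l * F' l j).
Proof.
apply/matrixP=> a b; rewrite !mxE -sum_enum_val.
by apply: eq_bigr => c _; rewrite !mxE.
Qed.

Lemma fmx1 : fmx (fun i j => (i == j)%:R) = 1%:M.
Proof. by apply/matrixP=> a b; rewrite !mxE (inj_eq enum_val_inj). Qed.

Lemma fmx_tr F : \tr (fmx F) = \sum_i F i i.
Proof. by rewrite -sum_enum_val; apply: eq_bigr => a _; rewrite mxE. Qed.

Lemma fmxE_sum J (r : seq J) (P : pred J) (a : J -> R) (A : J -> 'M[R]_#|I|) i j :
  fmxE (\sum_(x <- r | P x) a x *: A x) i j = \sum_(x <- r | P x) a x * fmxE (A x) i j.
Proof. by rewrite /fmxE summxE; apply: eq_bigr => x _; rewrite mxE. Qed.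

End FinMatrix.

Lemma sum_pair (V : nmodType) (I J : finType) (f : I * J -> V) :
  \sum_ij f ij = \sum_i \sum_j f (i, j).
Proof. by rewrite (pair_bigA _ (fun i j => f (i, j))); apply: eq_bigr => -[]. Qed.

Lemma map_fmx (R S : comUnitRingType) (f : {rmorphism R -> S}) (I : finType)
    (F : I -> I -> R) :
  map_mx f (fmx F) = fmx (fun i j => f (F i j)).
Proof. by apply/matrixP=> a b; rewrite !mxE. Qed.

Lemma eq_rspan (R : comUnitRingType) (gT : finGroupType) (G : {group gT}) n
    (r r' : mx_representation R G n) :
  (forall x, x \in G -> r x = r' x) -> rspan r -> rspan r'.
Proof.
move=> eqr sp X; have [a ->] := sp X; exists a.
by apply: eq_bigr => x Gx; rewrite eqr.
Qed.

Section Induced.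

Variables (R : comUnitRingType) (gT : finGroupType) (T G : {group gT}).
Variables (m : nat) (rT : mx_representation R T m).
Hypothesis sTG : T \subset G.

Definition ext0_repr (x : gT) : 'M[R]_m := if x \in T then rT x else 0.

Definition rcoset_index : finType := {C : {set gT} | C \in rcosets T G}.
Implicit Types C D : rcoset_index.
Definition crep C : gT := repr (val C).

Lemma crepG C : crep C \in G.
Proof.
have /rcosetsP[x Gx eqC] := valP C; rewrite /crep eqC.
have /rcosetP[t Tt ->] := mem_repr_rcoset T x.
by rewrite groupM // (subsetP sTG).
Qed.

Lemma val_crep C : val C = (T :* crep C)%g.
Proof.
have /rcosetsP[x Gx eqC] := valP C; rewrite /crep eqC.
by apply/esym/rcoset_eqP; apply: mem_repr_rcoset.
Qed.

Lemma crep_mem x C : (x * (crep C)^-1 \in T)%g = (val C == (T :* x)%g).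
Proof.
rewrite -mem_rcoset val_crep rcoset_sym.
by apply/rcoset_eqP/eqP.
Qed.

Lemma rcoset_index_ex x : x \in G -> {C : rcoset_index | val C = (T :* x)%g}.
Proof.
move=> Gx; have TxG : (T :* x)%g \in rcosets T G by apply/rcosetsP; exists x.
by exists (exist (fun A => A \in rcosets T G) _ TxG).
Qed.

Definition coset1 : rcoset_index := sval (rcoset_index_ex (group1 G)).

Lemma crep1 : crep coset1 = 1%g.
Proof. by rewrite /crep (svalP (rcoset_index_ex _)) rcoset1 repr_group. Qed.

Lemma sum_rcoset_index (V : nmodType) (f : gT -> V) :
  (forall t x, t \in T -> x \in G -> f (t * x)%g = f x) ->
  \sum_(x in G) f x = (\sum_(C : rcoset_index) f (crep C)) *+ #|T|.
Proof.
move=> fT; rewrite (set_partition_big _ (rcosets_partition sTG)) /= -sumrMnl.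
rewrite big_sub /=; apply: eq_bigr => C _; rewrite (val_crep C).
rewrite (eq_bigr (fun=> f (crep C))) ?sumr_const ?card_rcoset // => _ /rcosetP[t Tt ->].
by rewrite fT ?crepG.
Qed.

Lemma card_rcoset_index : #|rcoset_index| = #|G : T|%g.
Proof. by rewrite card_sig; apply: eq_card. Qed.

Definition ind_index : finType := (rcoset_index * 'I_m)%type.

(** Block (C, D) is supported on the x with C x = D; right cosets suit the action of matrices on row
    vectors. *)
Definition ind_mx (x : gT) : 'M[R]_#|ind_index| :=
  fmx (fun a b : ind_index =>
         ext0_repr (crep a.1 * x * (crep b.1)^-1)%g a.2 b.2).

Lemma ind_mx_repr : mx_repr G ind_mx.
Proof.
split=> [|x y Gx Gy].
  rewrite /ind_mx -fmx1; apply: eq_fmx => -[C s] [D t] /=.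
  rewrite /ext0_repr mulg1 crep_mem -val_crep (inj_eq val_inj) eq_sym xpair_eqE.
  have [->|] := eqVneq C D; last by rewrite mxE.
  by rewrite mulgV repr_mx1 mxE.
rewrite /ind_mx fmxM; apply: eq_fmx => -[C s] [D t] /=.
apply: esym; have [E defE] := rcoset_index_ex (groupM (crepG C) Gx).
have TE : (crep C * x * (crep E)^-1 \in T)%g by rewrite crep_mem defE.
transitivity (\sum_i ext0_repr (crep C * x * (crep E)^-1)%g s i
                     * ext0_repr (crep E * y * (crep D)^-1)%g i t).
  rewrite sum_pair /= (bigD1 E) //= [X in _ + X]big1 ?addr0 // => D' neqD'.
  apply: big1 => i _; rewrite {1}/ext0_repr crep_mem -defE (inj_eq val_inj).
  by rewrite (negPf neqD') mxE mul0r.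
have -> : (crep C * (x * y) * (crep D)^-1 = (crep C * x * (crep E)^-1) *
   (crep E * y * (crep D)^-1))%g by rewrite !mulgA mulgKV.
rewrite /ext0_repr TE (groupMl _ TE); case: ifP => Ty; first by rewrite (repr_mxM rT TE Ty) mxE.
by rewrite mxE big1 // => i _; rewrite mxE mulr0.
Qed.

Canonical ind_repr := MxRepresentation ind_mx_repr.

Lemma ind_repr_tr x :
  \tr (ind_repr x) = \sum_(C : rcoset_index) \tr (ext0_repr (crep C * x * (crep C)^-1)%g).
Proof. by rewrite fmx_tr sum_pair. Qed.

Definition ind_block (M : 'M[R]_#|ind_index|) : 'M[R]_m :=
  \matrix_(s, t) fmxE M (coset1, s) (coset1, t).

(* The block matrix of X extended by 0 on the other summands: for X = 1, the
   projection onto the summand of the trivial coset. *)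
Definition ind_embed (X : 'M[R]_m) : 'M[R]_#|ind_index| :=
  fmx (fun a b : ind_index =>
    if (a.1 == coset1) && (b.1 == coset1) then X a.2 b.2 else 0).

Lemma ind_embedK X : ind_block (ind_embed X) = X.
Proof. by apply/matrixP=> s t; rewrite mxE fmxK /= eqxx. Qed.

Lemma ind_block_repr x : ind_block (ind_repr x) = ext0_repr x.
Proof. by apply/matrixP=> s t; rewrite mxE fmxK /= crep1 mul1g invg1 mulg1. Qed.

Lemma ind_block_sum (P : pred gT) a (A : gT -> 'M[R]_#|ind_index|) :
  ind_block (\sum_(x | P x) a x *: A x) = \sum_(x | P x) a x *: ind_block (A x).
Proof.
apply/matrixP=> s t; rewrite mxE fmxE_sum summxE.
by apply: eq_bigr => x _; rewrite !mxE.
Qed.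

(** The block at the trivial coset is [rT x] for x in T and 0 for all other x, so an expression of
    the embedded X in elements of G leaves one of X in elements of T. *)
Lemma rspan_ind : rspan ind_repr -> rspan rT.
Proof.
move=> sp X; have [a eqX] := sp (ind_embed X); exists a.
rewrite -[LHS]ind_embedK eqX ind_block_sum (big_setID T) /=.
rewrite (setIidPr sTG) addrC big1 ?add0r => [|x /setDP[_ /negPf nTx]].
  by apply: eq_bigr => x Tx; rewrite ind_block_repr /ext0_repr Tx.
by rewrite ind_block_repr /ext0_repr nTx scaler0.
Qed.

Lemma ind_embed1_tr : \tr (ind_embed 1%:M) = m%:R.
Proof.
rewrite fmx_tr sum_pair /= (bigD1 coset1) //=.
rewrite [X in _ + X]big1 ?addr0 => [|C /negPf neqC].
  by rewrite eqxx -mxtrace1.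
by apply: big1 => i _; rewrite neqC.
Qed.

(** T fixes the trivial coset and permutes the others among themselves. *)
Lemma ind_embed1_cent t : t \in T ->
  ind_embed 1%:M *m ind_repr t = ind_repr t *m ind_embed 1%:M.
Proof.
move=> Tt; rewrite !fmxM; apply: eq_fmx => -[C s] [D u] /=.
rewrite (bigD1 (coset1, s)) //= [RHS](bigD1 (coset1, u)) //= !eqxx /= !andbT.
rewrite [X in _ + X = _]big1 => [|[C' s'] /= neq]; last first.
  case: ifP => [/andP[_ /eqP eqC']|]; rewrite ?mul0r //.
  by move: neq; rewrite eqC' xpair_eqE eqxx mxE eq_sym => /= /negPf->; rewrite mul0r.
rewrite [X in _ = _ + X]big1 => [|[C' s'] /= neq]; last first.
  case: ifP => [/andP[/eqP eqC' _]|]; rewrite ?mulr0 //.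
  by move: neq; rewrite eqC' xpair_eqE eqxx mxE => /= /negPf->; rewrite mulr0.
rewrite !addr0 crep1 mul1g invg1 mulg1 !mxE !eqxx.
have eqT x C' : (x \in T) -> (x * (crep C')^-1 \in T)%g = (C' == coset1).
  move=> Tx; rewrite groupMl // groupV -[crep C']mulg1 -{1}invg1 -crep1 crep_mem.
  by rewrite -val_crep (inj_eq val_inj) eq_sym.
have [->|neqC] := eqVneq C coset1; have [->|neqD] := eqVneq D coset1.
- by rewrite crep1 mul1g invg1 mulg1 mul1r mulr1.
- by rewrite mul1r mulr0 /ext0_repr eqT // (negPf neqD) mxE.
- rewrite mul0r mulr1 /ext0_repr groupMr // -groupV -[_^-1%g]mul1g eqT //.
  by rewrite (negPf neqC) mxE.
by rewrite mul0r mulr0.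
Qed.

End Induced.

Lemma map_ind_repr (R S : comUnitRingType) (f : {rmorphism R -> S})
    (gT : finGroupType) (T G : {group gT}) m (rT : mx_representation R T m)
    (sTG : T \subset G) x :
  map_repr f (ind_repr rT sTG) x = ind_repr (map_repr f rT) sTG x.
Proof.
rewrite /= /map_repr_mx map_fmx; apply: eq_fmx => a b.
by rewrite /ext0_repr; case: ifP => _; rewrite ?mxE // rmorph0.
Qed.

Section Tensor.

Variables (R : comUnitRingType) (gT : finGroupType) (G : {group gT}) (a b : nat).
Variables (rA : mx_representation R G a) (rB : mx_representation R G b).

Definition tens_mx (A : 'M[R]_a) (B : 'M[R]_b) : 'M[R]_#|{: 'I_a * 'I_b}| :=
  fmx (fun i j : 'I_a * 'I_b => A i.1 j.1 * B i.2 j.2).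

Lemma tens_mxM A A' B B' :
  tens_mx A B *m tens_mx A' B' = tens_mx (A *m A') (B *m B').
Proof.
rewrite fmxM; apply: eq_fmx => -[i s] [j t] /=.
rewrite !mxE big_distrlr sum_pair /=.
by apply: eq_bigr => l _; apply: eq_bigr => u _; rewrite mulrACA.
Qed.

Lemma tens_mx_repr : mx_repr G (fun x => tens_mx (rA x) (rB x)).
Proof.
split=> [|x y Gx Gy]; last by rewrite !repr_mxM // tens_mxM.
rewrite !repr_mx1 -fmx1; apply: eq_fmx => -[i s] [j t] /=.
by rewrite !mxE xpair_eqE -natrM mulnb.
Qed.

Definition tens_repr := MxRepresentation tens_mx_repr.

Lemma tens_mx_tr A B : \tr (tens_mx A B) = \tr A * \tr B.
Proof.
by rewrite fmx_tr /mxtrace big_distrlr sum_pair.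
Qed.

Definition ptrace (M : 'M[R]_#|{: 'I_a * 'I_b}|) : 'M[R]_b :=
  \matrix_(s, t) \sum_i fmxE M (i, s) (i, t).

Lemma ptrace_tens A B : ptrace (tens_mx A B) = \tr A *: B.
Proof.
apply/matrixP=> s t; rewrite !mxE mulr_suml; apply: eq_bigr => i _.
by rewrite fmxK.
Qed.

(** Partial trace over the first factor sends A tensor B to tr(A) B. Applied to the tensor product
    of X with a matrix unit of trace 1, it recovers X without a division by a. *)
Lemma rspan_tens : (0 < a)%N -> rspan tens_repr -> rspan rB.
Proof.
case/prednK=> a0 sp X; pose i0 : 'I_a := cast_ord a0 ord0.
have [c eqX] := sp (tens_mx (delta_mx i0 i0) X).
exists (fun x => c x * \tr (rA x)).
have := congr1 ptrace eqX; rewrite ptrace_tens mxtrace_delta eqxx scale1r => ->.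
apply/matrixP=> s t; rewrite mxE summxE.
under eq_bigr do rewrite fmxE_sum.
rewrite exchange_big; apply: eq_bigr => x _ /=; rewrite !mxE -mulrA mulr_suml mulr_sumr.
by apply: eq_bigr => i _; rewrite fmxK.
Qed.

End Tensor.

Lemma map_tens_repr (R S : comUnitRingType) (f : {rmorphism R -> S})
    (gT : finGroupType) (G : {group gT}) a b (rA : mx_representation R G a)
    (rB : mx_representation R G b) x :
  map_repr f (tens_repr rA rB) x = tens_repr (map_repr f rA) (map_repr f rB) x.
Proof.
rewrite /= /map_repr_mx map_fmx; apply: eq_fmx => i j.
by rewrite rmorphM !mxE.
Qed.

(** * Characters and reductions modulo the maximal ideal *)

(** With t the variable, t^q = t^q - N^q is a multiple of t - N. Taking determinants, the
    characteristic polynomial divides a power of t, hence is itself a power of t. *)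
Lemma nilpotent_trace (F : fieldType) n (N : 'M[F]_n.+1) q :
  N ^+ q = 0 -> \tr N = 0.
Proof.
move=> Nq; pose NX : 'M[{poly F}]_n.+1 := map_mx polyC N.
have comX : GRing.comm ('X%:M : 'M[{poly F}]_n.+1) NX.
  by apply: esym; apply: scalar_mxC.
have NXq : NX ^+ q = 0 by rewrite -rmorphXn Nq rmorph0.
have dvdX : char_poly N %| ('X - 0%:P) ^+ (q * n.+1).
  rewrite polyC0 subr0 exprM -det_scalar.
  have -> : ('X^q)%:M = ('X%:M : 'M[{poly F}]_n.+1) ^+ q - NX ^+ q.
    by rewrite NXq subr0 -rmorphXn.
  by rewrite subrXX_comm // det_mulmx dvdp_mulIl.
have [d _] := dvdp_exp_XsubCP dvdX.
rewrite polyC0 subr0 eqp_monic ?char_poly_monic ?monicXn // => /eqP char_N.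
have := char_poly_trace N (ltn0Sn n); have := size_char_poly N.
rewrite char_N size_polyXn coefXn => -[->] /=.
by rewrite (ltn_eqF (ltnSn n)) => /esym/eqP; rewrite oppr_eq0 => /eqP.
Qed.

(** The p-part of x acts unipotently in characteristic p and commutes with the action of the
    p'-part, so the two operators differ by a nilpotent one. *)
Lemma mxtrace_constt (F : fieldType) p (gT : finGroupType) (G : {group gT}) n
    (rG : mx_representation F G n) x :
  p \in [pchar F] -> x \in G -> \tr (rG x) = \tr (rG (x.`_p^')%g).
Proof.
case: n rG => [|n] rG pF Gx; first by rewrite [rG x]flatmx0 [rG _]flatmx0.
have Gxp : (x.`_p)%g \in G by rewrite groupX.
have Gxp' : (x.`_p^')%g \in G by rewrite groupX.
apply/eqP; rewrite -subr_eq0 -raddfB /=; apply/eqP.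
set A := rG (x.`_p)%g; set B := rG (x.`_p^')%g.
have cAB : GRing.comm A B.
  rewrite /GRing.comm /A /B -!repr_mxMr //; congr (rG _).
  by apply: (centsP (cycle_abelian x)); rewrite mem_cycle.
have -> : rG x - B = (A - 1) * B.
  by rewrite mulrBl mul1r -repr_mxMr // consttC.
have pM : p \in [pchar 'M[F]_n.+1].
  by rewrite (pchar_lalg 'M[F]_n.+1).
have frob e : (A - 1) ^+ (p ^ e) = A ^+ (p ^ e) - 1.
  elim: e => [|e IHe]; first by rewrite expn0 !expr1.
  rewrite expnSr exprM IHe -pFrobenius_autE pFrobenius_autB_comm ?pFrobenius_aut1.
    by rewrite pFrobenius_autE -exprM.
  exact: commr1.
have c1B : GRing.comm (A - 1) B.
  by apply: commr_sym; apply: commrB; [apply: commr_sym | apply: commr1].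
apply: (@nilpotent_trace _ _ _ (p ^ logn p #[x]%g)).
rewrite exprMn_comm // frob /A -repr_mxX // -p_part -order_constt expg_order.
by rewrite repr_mx1 subrr mul0r.
Qed.

Definition affords (F : fieldType) (gT : finGroupType) (H : {group gT}) n
    (rH : mx_representation F H n) (theta : {ffun gT -> F}) : Prop :=
  (forall x, x \in H -> \tr (rH x) = theta x)
  /\ (forall x, x \notin H -> theta x = 0).

Lemma affordsJ (F : fieldType) (gT : finGroupType) (H : {group gT}) n
    (rH : mx_representation F H n) (theta : {ffun gT -> F}) x y :
  affords rH theta -> y \in H -> theta (x ^ y)%g = theta x.
Proof.
case=> trH out Hy; have [Hx|nHx] := boolP (x \in H); last first.
  by rewrite !out // memJ_norm // (subsetP (normG H)).
rewrite -!trH ?groupJ // conjgE !repr_mxM ?groupM ?groupV // mxtrace_mulC.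
by rewrite repr_mxK.
Qed.

Lemma char_Ind_rcoset (F : fieldType) (gT : finGroupType) (T G : {group gT}) n
    (rT : mx_representation F T n) (psi : {ffun gT -> F}) x :
  [pchar F] =i pred0 -> T \subset G -> affords rT psi -> x \in G ->
  char_Ind T G psi x
    = \sum_(C : rcoset_index T G) psi (crep C * x * (crep C)^-1)%g.
Proof.
move=> char0 sTG rT_psi Gx; rewrite ffunE Gx (reindex_inj invg_inj) /=.
have -> : \sum_(y | (y^-1)%g \in G) psi (x ^ y^-1)%g
    = \sum_(y in G) psi (y * x * y^-1)%g.
  by apply: eq_big => y; [rewrite groupV | rewrite conjgE invgK mulgA].
rewrite (sum_rcoset_index sTG (f := fun y => psi (y * x * y^-1)%g)) => [|t y Tt Gy].
  by rewrite -[X in _ * X]mulr_natl mulKf // (pcharf0P F).1 // -lt0n.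
rewrite -[in RHS](affordsJ _ rT_psi (groupVr Tt)) conjgE invgK.
by rewrite invMg !mulgA.
Qed.

Lemma ind_affords (F : fieldType) (gT : finGroupType) (T G : {group gT}) n
    (rT : mx_representation F T n) (psi : {ffun gT -> F}) (sTG : T \subset G) :
  [pchar F] =i pred0 -> affords rT psi ->
  affords (ind_repr rT sTG) (char_Ind T G psi).
Proof.
move=> char0 rT_psi; split=> x Gx; last by rewrite ffunE (negPf Gx).
rewrite (char_Ind_rcoset char0 sTG rT_psi Gx) ind_repr_tr; apply: eq_bigr => C _.
rewrite /ext0_repr; case: ifP => Tx; first by case: rT_psi => ->.
by case: rT_psi => _ ->; rewrite ?Tx // mxtrace0.
Qed.

Section ModSystem.

Variables (p : nat) (O : idomainType) (K k : fieldType).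
Variables (iota : {rmorphism O -> K}) (red : {rmorphism O -> k}).
Hypothesis Omod : modular_system p iota red.

Let iotaI := ms_frac_inj Omod.
Let char0 := ms_pchar0 Omod.

Section OneGroup.

Variables (gT : finGroupType).
Implicit Types (G H T : {group gT}) (theta : {ffun gT -> K}).

(* All O-forms are required to have this property; affords_lattice gives one. *)
Definition modular_irr H theta : Prop :=
  forall n (rO : mx_representation O H n),
    affords (map_repr iota rO) theta -> rspan (map_repr red rO).

(** Nakayama's argument in coordinates: rows of the enveloping algebra that form a basis modulo J(O)
    have a determinant outside J(O), which is a unit. *)
Lemma rspan_lift H n (rO : mx_representation O H n) :
  rspan (map_repr red rO) -> rspan rO.
Proof.
move=> sp X; have [n0|n0] := posnP n.
  exists (fun=> 0); apply/matrixP=> -[i lt_i]; exfalso.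
  by move: lt_i; rewrite n0.
have /andP[_ full]: mx_absolutely_irreducible (map_repr red rO) by apply: rspan_abs_irr.
pose f := fullrankfun full.
pose S := rowsub f (enveloping_algebra_mx rO).
have uS : S \in unitmx.
  rewrite unitmxE (unit_red Omod) -det_map_mx -unitfE -unitmxE /S map_mxsub.
  by rewrite map_enveloping_algebra_mx fullrowsub_unit.
have eqX : mxvec X = mxvec X *m invmx S *m rowsub f 1%:M *m enveloping_algebra_mx rO.
  by rewrite -[_ *m _ *m enveloping_algebra_mx rO]mulmxA -rowsubE mulmxKV.
set u := _ *m rowsub f 1%:M in eqX.
exists (fun x => u 0 (gring_index H x)).
apply: (can_inj mxvecK); rewrite eqX mulmx_sum_row linear_sum [RHS]big_enum_val.
by apply: eq_bigr => i _; rewrite linearZ gring_valK rowK.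
Qed.

Lemma rspan_liftK H n (rO : mx_representation O H n) :
  rspan rO -> rspan (map_repr iota rO).
Proof.
move=> sp X; have [->|X0] := eqVneq X 0.
  by exists (fun=> 0); rewrite big1 // => x _; rewrite scale0r.
have [c c0 [X0' eqX _]] := matrix_normalize Omod X0.
have [a eqX'] := sp X0'; exists (fun x => c^-1 * iota (a x)).
apply: (scalerI c0); rewrite -eqX eqX' raddf_sum scaler_sumr /=.
by apply: eq_bigr => x _; rewrite map_mxZ !scalerA mulVKf.
Qed.

Lemma rspan_conj (F : fieldType) H n (r r' : mx_representation F H n) B :
  B \in unitmx -> (forall x, x \in H -> r' x = B *m r x *m invmx B) ->
  rspan r' -> rspan r.
Proof.
move=> uB r'E sp X; have [a eqX] := sp (B *m X *m invmx B); exists a.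
have -> : X = invmx B *m (B *m X *m invmx B) *m B.
  by rewrite !mulmxA mulVmx // mul1mx mulmxKV.
rewrite eqX mulmx_sumr mulmx_suml; apply: eq_bigr => x Hx.
by rewrite r'E // -scalemxAr -scalemxAl !mulmxA mulVmx // mul1mx mulmxKV.
Qed.

Lemma affords_lattice H n (rH : mx_representation K H n) theta :
  affords rH theta -> exists rO : mx_representation O H n,
    affords (map_repr iota rO) theta
    /\ (exists2 B, B \in unitmx
       & forall x, x \in H -> map_repr iota rO x = B *m rH x *m invmx B).
Proof.
case=> trH out; have [rO [B [uB rOE]]] := integral_form Omod rH.
exists rO; split; last by exists B => // x Hx; rewrite -rOE.
by split=> // x Hx; rewrite /= /map_repr_mx rOE // mxtrace_mulC mulmxA mulVmx // mul1mx trH.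
Qed.

Lemma modular_irr_Ind T G psi :
  T \subset G -> modular_irr G (char_Ind T G psi) -> modular_irr T psi.
Proof.
move=> sTG modG n rO rO_psi; apply: (@rspan_ind _ _ _ _ _ _ sTG).
apply: (eq_rspan (r := map_repr red (ind_repr rO sTG))) => [x Gx|].
  by rewrite map_ind_repr.
apply: modG; have [indE out] := ind_affords sTG char0 rO_psi.
by split=> // x Gx; rewrite map_ind_repr indE.
Qed.

Lemma modular_irr_mul H a (rA : mx_representation O H a) alpha beta :
  (0 < a)%N -> affords (map_repr iota rA) alpha ->
  modular_irr H (char_mul alpha beta) -> modular_irr H beta.
Proof.
move=> a0 [trA outA] modH b rB [trB outB].
apply: (rspan_tens (rA := map_repr red rA)) => //.
apply: (eq_rspan (r := map_repr red (tens_repr rA rB))) => [x Hx|].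
  by rewrite map_tens_repr.
apply: modH; split=> x Hx; rewrite ffunE.
  by rewrite map_tens_repr tens_mx_tr trA ?trB.
by rewrite outA ?mul0r.
Qed.

(* The two reductions have the same trace; since the trace form of M_n(k) is
   nondegenerate, the kernel of the first one on kG lies in that of the second. *)
Lemma restriction_modular_irr G chi :
  splitting_for_subgroups k G -> restriction_in_IBr p iota red G chi -> modular_irr G chi.
Proof.
move=> splitk [d [rS irrS brS]] n' rO [trO outO].
have absS : mx_absolutely_irreducible rS by apply: splitk.
have chi1 : chi 1%g = n'%:R by rewrite -trO ?group1 // repr_mx1 mxtrace1.
(* The trace of [rS x] is read off the next-to-leading coefficient of its characteristic polynomial,
   as the reduction of the sum of the lifted eigenvalues. *)
have trS x : x \in G -> (p^'.-elt x)%g ->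
    exists2 a, chi x = iota a & \tr (rS x) = red a.
  move=> Gx p'x; have [s [_ eqs ->]] := brS x Gx p'x.
  exists (\sum_(z <- s) z); first by rewrite raddf_sum.
  have d0 : (0 < d)%N by case/andP: absS.
  have sz_s : size s = d.
    by have := size_char_poly (rS x); rewrite eqs size_prod_XsubC => -[].
  apply: oppr_inj; rewrite -(char_poly_trace _ d0) eqs raddf_sum /=.
  have s0 : size [seq red z | z <- s] != 0%N by rewrite size_map sz_s -lt0n.
  have := coefPn_prod_XsubC s0; rewrite size_map sz_s !big_map => ->.
  by [].
(* At x = 1 the lifted eigenvalues satisfy z^1 = 1, so chi(1) = d; characteristic 0 turns this into
   an equality of degrees. *)
have eq_nd : n' = d.
  apply: (natK_inj Omod); rewrite -chi1.
  have [s [/allP s1 eqs ->]] := brS 1%g (group1 G) (p_elt1 _ _).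
  have sz_s : size s = d.
    by have := size_char_poly (rS 1%g); rewrite eqs size_prod_XsubC => -[].
  rewrite big_seq (eq_bigr (fun=> 1)) => [|z /s1]; last first.
    by rewrite order1 expr1 => /eqP->; rewrite rmorph1.
  by rewrite -big_seq big_const_seq count_predT iter_addr_0 sz_s.
rewrite {}eq_nd in rO trO outO *.
pose rk := map_repr red rO.
have trk x : x \in G -> \tr (rk x) = \tr (rS x).
  move=> Gx; rewrite (mxtrace_constt rk (ms_pchar Omod) Gx).
  rewrite (mxtrace_constt rS (ms_pchar Omod) Gx).
  have Gx' : (x.`_p^')%g \in G by rewrite groupX.
  have [|a chi_a ->] := trS _ Gx'; first exact: p_elt_constt.
  rewrite /rk /= /map_repr_mx trace_map_mx; congr (red _); apply: iotaI.
  by rewrite -chi_a -trO // /= /map_repr_mx trace_map_mx.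
have spS := abs_irr_rspan absS.
have ker_sub (a : gT -> k) :
    \sum_(x in G) a x *: rk x = 0 -> \sum_(x in G) a x *: rS x = 0.
  move=> a0; apply/matrixP=> i j.
  have [b eq_b] := spS (delta_mx j i).
  have := mxtrace_delta_mul j i (\sum_(x in G) a x *: rS x).
  rewrite eq_b => <-; rewrite mxE.
  transitivity (\tr ((\sum_(x in G) b x *: rk x) *m (\sum_(x in G) a x *: rk x))).
    rewrite !mulmx_suml !raddf_sum; apply: eq_bigr => x Gx.
    rewrite !mulmx_sumr !raddf_sum; apply: eq_bigr => y Gy /=.
    by rewrite -!scalemxAl -!scalemxAr !mxtraceZ -!repr_mxM // trk ?groupM.
  by rewrite a0 mulmx0 mxtrace0.
suff: mx_absolutely_irreducible rk by apply: abs_irr_rspan.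
case/andP: absS => d0 fullS; rewrite /mx_absolutely_irreducible d0.
have sub_ker : (kermx (enveloping_algebra_mx rk) <= kermx (enveloping_algebra_mx rS))%MS.
  apply/row_subP=> i; apply/sub_kermxP.
  have /sub_kermxP := row_sub i (kermx (enveloping_algebra_mx rk)).
  move: (row i _) => u; have sum_u d' (r : mx_representation k G d') :
      u *m enveloping_algebra_mx r
        = mxvec (\sum_(x in G) u 0 (gring_index G x) *: r x).
    rewrite mulmx_sum_row linear_sum [RHS]big_enum_val.
    by apply: eq_bigr => j _; rewrite linearZ gring_valK rowK.
  rewrite !sum_u => /eqP; rewrite mxvec_eq0 => /eqP/ker_sub->.
  by rewrite linear0.
have := mxrankS sub_ker; rewrite !mxrank_ker => le_rank.
rewrite /row_full eqn_leq rank_leq_col /=.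
by rewrite -[X in (X <= _)%N](eqP fullS) -(leq_sub2lE _ (rank_leq_row (enveloping_algebra_mx rS))).
Qed.

End OneGroup.
End ModSystem.

(** * Anchors and relative traces of lattices *)

Lemma sum_lcosets (gT : finGroupType) (P G : {group gT}) (V : nmodType)
    (f : gT -> V) :
  P \subset G -> (forall x t, x \in G -> t \in P -> f (x * t)%g = f x) ->
  \sum_(x in G) f x = (\sum_(C in lcosets P G) f (repr C)) *+ #|P|.
Proof.
move=> sPG fP; rewrite (partition_big_imset (lcoset P)) /= -sumrMnl.
apply: eq_bigr => _ /imsetP[y Gy ->]; rewrite !lcosetE.
have /lcosetP[t Pt def_r] : repr (y *: P)%g \in (y *: P)%g.
  by apply: (mem_repr y); apply: lcoset_refl.
rewrite def_r fP // -(card_lcoset P y) -sumr_const.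
apply: eq_big => [x | x /andP[Gx /eqP]]; rewrite lcosetE; last move=> eqx.
  apply/andP/idP => [[_ /eqP <-]|/lcosetP[u Pu ->]]; first exact: lcoset_refl.
  by rewrite (groupM Gy (subsetP sPG u Pu)) lcosetM lcoset_id.
have /lcosetP[u Pu ->] : x \in (y *: P)%g by rewrite -eqx lcoset_refl.
by rewrite fP.
Qed.

Section ModSystem.

Variables (p : nat) (O : idomainType) (K k : fieldType).
Variables (iota : {rmorphism O -> K}) (red : {rmorphism O -> k}).
Hypothesis Omod : modular_system p iota red.

Let char0 := ms_pchar0 Omod.

Section TraceCondition.

Variables (gT : finGroupType) (G : {group gT}) (n : nat) (chi : {ffun gT -> K}).
Variable rO : mx_representation O G n.
Hypotheses (rO_chi : affords (map_repr iota rO) chi)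
  (spk : rspan (map_repr red rO)) (n_gt0 : (0 < n)%N).

Local Notation rK := (map_repr iota rO).
Local Notation aG := (regular_repr K G).

Let spO : rspan rO. Proof. exact: rspan_lift Omod _ _ _ _ spk. Qed.
Let spK : rspan rK. Proof. exact: rspan_liftK Omod _ _ _ _ spO. Qed.

Lemma gring_op_sum A : gring_op rK A = \sum_(x in G) gring_coef A x *: rK x.
Proof.
rewrite gring_opE /gring_mx /= mulmx_sum_row linear_sum [RHS]big_enum_val.
by apply: eq_bigr => i _; rewrite linearZ /= rowK mxvecK /gring_coef gring_valK.
Qed.

Lemma char_eval_op A : char_eval chi A = \tr (gring_op rK A).
Proof.
rewrite gring_op_sum raddf_sum; apply: eq_bigr => x Gx /=.
by rewrite mxtraceZ; case: rO_chi => ->.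
Qed.

Local Notation lift := (rlift rK aG).
Local Notation op := (gring_op rK).

Lemma rlift_gring M : (lift M \in group_ring K G)%MS.
Proof. by apply/envelop_mxP; exists (fun x => n%:R / #|G|%:R * \tr (M *m rK x^-1%g)). Qed.

Lemma gring_op_lift M : op (lift M) = M.
Proof.
rewrite -[RHS](rlift_id char0 spK n_gt0) /rlift linear_sum.
by apply: eq_bigr => x Gx; rewrite linearZ /= gring_opG.
Qed.

Lemma gring_mul_lift A M : (A \in group_ring K G)%MS -> A *m lift M = lift (op A *m M).
Proof.
case/envelop_mxP=> a ->; rewrite -rlift_comb.
by rewrite linear_sum; congr (rlift _ _ (_ *m _)); apply: eq_bigr => x Gx;
  rewrite linearZ /= gring_opG.
Qed.

Lemma op_central e : central_idempotent e -> exists2 c, op e = c%:M & c * c = c.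
Proof.
case=> /center_mxP[eG ce] idem.
have idop : op e *m op e = op e by rewrite -gring_opM // idem.
have [|c def_c] := rspan_cent_scalar (M := op e) spK.
  move=> x Gx; rewrite -(gring_opG rK Gx) -!gring_opM ?envelop_mx_id //.
  by rewrite ce ?envelop_mx_id.
exists c => //; move: idop; rewrite def_c -scalar_mxM => /matrixP/(_ (Ordinal n_gt0) (Ordinal n_gt0)).
by rewrite !mxE eqxx !mulr1n.
Qed.

Lemma lift1_central : central_idempotent (lift 1%:M).
Proof.
split; last by rewrite -(rliftM char0 spK n_gt0) mulmx1.
apply/center_mxP; split; first exact: rlift_gring.
move=> B /envelop_mxP[a ->]; rewrite mulmx_suml mulmx_sumr; apply: eq_bigr => x Gx.
by rewrite -scalemxAl -scalemxAr (rlift1_cent rK aG Gx).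
Qed.

Lemma lift1_neq0 : lift 1%:M != 0.
Proof.
apply/eqP=> l0; have := gring_op_lift 1%:M; rewrite l0 linear0 => /esym.
move/matrixP/(_ (Ordinal n_gt0) (Ordinal n_gt0)); rewrite !mxE eqxx => /eqP.
by rewrite oner_eq0.
Qed.

(** The representation sends a central idempotent to a scalar c with c^2 = c. If chi(e) is nonzero
    then c = 1, so e absorbs [lift 1%:M], and primitivity of e makes the two equal. Conversely, if
    [lift 1%:M] is a sum of two orthogonal central idempotents, one of them goes to 0; being the
    lift of its image, it vanishes. *)
Lemma char_idempotent_lift e : char_idempotent chi e <-> e = lift 1%:M.
Proof.
have idem01 (c : K) : c * c = c -> c = 0 \/ c = 1.
  have [->|c0] := eqVneq c 0; [by left | move=> cc; right].
  by apply: (mulfI c0); rewrite cc mulr1.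
split=> [[[ce e0 prim]] | ->].
  have [c op_e cc] := op_central ce; rewrite char_eval_op op_e.
  have [->|c1 _] := idem01 c cc; first by rewrite raddf0 mxtrace0 eqxx.
  have [/center_mxP[eG cGe] idem] := ce.
  have el : e *m lift 1%:M = lift 1%:M.
    by rewrite gring_mul_lift // op_e c1 mulmx1.
  have [/center_mxP[lG cl] idl] := lift1_central.
  have le : lift 1%:M *m e = lift 1%:M by rewrite -{2}el cl.
  case: (prim (lift 1%:M) (e - lift 1%:M)) => //.
  - exact: lift1_central.
  - split; last first.
      by rewrite mulmxBl !mulmxBr idem el le idl subrr subr0.
    by rewrite linearB addmx_sub ?eqmx_opp; [| case: ce | case: lift1_central].
  - by rewrite mulmxBr le idl subrr.
  - by rewrite addrC subrK.
  - by move/eqP; rewrite (negPf lift1_neq0).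
  - by move/eqP; rewrite subr_eq0 => /eqP.
split; last first.
  by rewrite char_eval_op gring_op_lift mxtrace1 (natK_neq0 Omod).
split=> [||A B cA cB AB0 sumAB]; [exact: lift1_central | exact: lift1_neq0 |].
have [a op_a aa] := op_central cA; have [b op_b bb] := op_central cB.
have kill C (c : K) : central_idempotent C -> op C = c%:M -> c = 0 ->
    C *m lift 1%:M = C -> C = 0.
  move=> [/center_mxP[CG _] _] opC c0; rewrite gring_mul_lift // opC c0.
  by rewrite raddf0 mul0mx rlift0.
have [/center_mxP[AG cAG] idA] := cA; have [/center_mxP[BG _] idB] := cB.
have BA0 : B *m A = 0 by rewrite cAG.
have abz : a * b = 0.
  have := gring_opM rK A BG; rewrite AB0 linear0 op_a op_b -scalar_mxM => /esym.
  move/matrixP/(_ (Ordinal n_gt0) (Ordinal n_gt0)).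
  by rewrite !mxE eqxx mulr1n.
have [a0|a1] := idem01 a aa.
  by left; apply: (kill A a) => //; rewrite sumAB mulmxDr idA AB0 addr0.
right; apply: (kill B b) => //; first by rewrite -[b]mul1r -a1.
by rewrite sumAB mulmxDr BA0 idB add0r.
Qed.

Lemma gring_conj_lift x M : x \in G ->
  gring_conj x (lift M) = lift (rK x *m M *m rK x^-1%g).
Proof. by move=> Gx; rewrite /gring_conj rliftMr ?groupV // rliftMl. Qed.

Lemma op_conj x A : x \in G -> (A \in group_ring K G)%MS ->
  op (gring_conj x A) = rK x *m op A *m rK x^-1%g.
Proof.
move=> Gx AG; rewrite /gring_conj !gring_opM ?envelop_mx_id ?groupV //.
by rewrite !gring_opG ?groupV.
Qed.

Lemma repr_lcosetG (P : {group gT}) C : P \subset G -> C \in lcosets P G -> repr C \in G.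
Proof.
move=> sPG /lcosetsP[y Gy ->].
have /lcosetP[t Pt ->] : repr (y *: P)%g \in (y *: P)%g.
  by apply: (mem_repr y); apply: lcoset_refl.
by rewrite groupM // (subsetP sPG).
Qed.

(* OG e_chi is M_n(O), and e_chi is its identity matrix. *)
Lemma trace_conditionE (P : {group gT}) :
  trace_condition iota G chi P <->
  P \subset G /\ exists2 A : 'M[O]_n,
    forall x, x \in P -> rO x *m A = A *m rO x
    & \sum_(x in G) rO x *m A *m rO x^-1%g = (#|P|%:R)%:M.
Proof.
(* The sum over all of G is |P| times the relative trace: it involves no coset representatives, and
   |P| can be cancelled in K. *)
have sumE (A : 'M[K]_n) : P \subset G -> (forall x, x \in P -> rK x *m A = A *m rK x) ->
    \sum_(x in G) rK x *m A *m rK x^-1%g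
      = (\sum_(C in lcosets P G) rK (repr C) *m A *m rK (repr C)^-1%g) *+ #|P|.
  move=> sPG cA.
  apply: (sum_lcosets (f := fun x => rK x *m A *m rK x^-1%g)) => // x t Gx Pt.
  have Gt := subsetP sPG t Pt.
  rewrite invMg !repr_mxM ?groupV // -[rK x *m rK t *m A]mulmxA cA // !mulmxA.
  by rewrite repr_mxK.
have Pn0 : #|P|%:R != 0 :> K by rewrite (natK_neq0 Omod).
split=> [[sPG [e /char_idempotent_lift-> [A [[B [BG intB] ->] fixA] trA]]] | [sPG [A cA trA]]].
  split=> //; have op1 : op (lift 1%:M) = 1%:M by apply: gring_op_lift.
  have lG := rlift_gring 1%:M.
  have BlG : (B *m lift 1%:M \in group_ring K G)%MS by rewrite gring_mul_lift ?rlift_gring.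
  have opB : op (B *m lift 1%:M) = op B by rewrite gring_opM // op1 mulmx1.
  have ex x : exists b, (x \in G) ==> (gring_coef B x == iota b).
    case Gx: (x \in G); last by exists 0.
    by have [b ->] := intB x Gx; exists b; rewrite eqxx.
  pose b x := xchoose (ex x).
  pose A0 := \sum_(x in G) b x *: rO x.
  have A0E : map_mx iota A0 = op B.
    rewrite gring_op_sum raddf_sum; apply: eq_bigr => x Gx /=.
    by rewrite map_mxZ; have /implyP/(_ Gx)/eqP-> := xchooseP (ex x).
  have cA0 x : x \in P -> rO x *m A0 = A0 *m rO x.
    move=> Px; have Gx := subsetP sPG x Px.
    have cop : rK x *m op B = op B *m rK x.
      by rewrite -[in RHS]opB -(fixA x Px) op_conj // opB repr_mxKV.
    by apply: (map_iota_inj Omod); rewrite !map_mxM A0E.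
  exists A0 => //; apply: (map_iota_inj Omod); rewrite map_scalar_mx /= rmorph_nat.
  transitivity (\sum_(x in G) rK x *m map_mx iota A0 *m rK x^-1%g).
    by rewrite raddf_sum; apply: eq_bigr => x Gx; rewrite /= !map_mxM.
  rewrite sumE // => [|x Px]; last first.
    by have := congr1 (map_mx iota) (cA0 x Px); rewrite !map_mxM.
  have := congr1 op trA; rewrite op1 /rel_trace linear_sum /=.
  rewrite (eq_bigr (fun C => rK (repr C) *m map_mx iota A0 *m rK (repr C)^-1%g)).
    by move->; rewrite -scaler_nat scalemx1.
  by move=> C lC; rewrite op_conj ?(repr_lcosetG sPG lC) // opB A0E.
split=> //; exists (lift 1%:M); first exact/char_idempotent_lift.
have cA' x : x \in P -> rK x *m map_mx iota A = map_mx iota A *m rK x.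
  by move=> Px; have := congr1 (map_mx iota) (cA x Px); rewrite !map_mxM.
exists (lift (map_mx iota A)); first split.
(* As G spans M_n(O), A is the image of an element of OG, whose product with e_chi is the lift of
   A. *)
- have [a eqA] := spO A.
  exists (\sum_(x in G) iota (a x) *: aG x); first split.
  + by apply/envelop_mxP; exists (fun x => iota (a x)).
  + move=> x Gx; exists (a x).
    have coefE A' : gring_coef A' x = gring_proj x A' 0 0.
      by rewrite /gring_coef /gring_proj /= !mxE.
    rewrite coefE linear_sum summxE (bigD1 x) // big1 ?addr0 => [|y /andP[Gy yx]].
      by rewrite linearZ /= (gring_projE K) // eqxx !mxE ?eqxx ?mulr1n mulr1 addr0.
    by rewrite linearZ /= (gring_projE K) // eq_sym (negPf yx) !mxE mulr0.
  + rewrite -rlift_comb mulmx1 eqA raddf_sum.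
    by congr (lift _); apply: eq_bigr => x Gx; rewrite /= map_mxZ.
- move=> x Px; have Gx := subsetP sPG x Px.
  by rewrite gring_conj_lift // cA' // repr_mxK.
rewrite /rel_trace.
rewrite (eq_bigr (fun C => lift (rK (repr C) *m map_mx iota A *m rK (repr C)^-1%g))).
  rewrite -rlift_sum; congr (lift _); have := congr1 (map_mx iota) trA.
  rewrite map_scalar_mx /= rmorph_nat raddf_sum /=.
  rewrite (eq_bigr (fun x => rK x *m map_mx iota A *m rK x^-1%g)) => [|x Gx]; last first.
    by rewrite !map_mxM.
  rewrite sumE // -scaler_nat -[RHS]scalemx1.
  by move/(scalerI Pn0).
by move=> C lC; rewrite gring_conj_lift ?(repr_lcosetG sPG lC).
Qed.

End TraceCondition.
End ModSystem.

Lemma pgroup_sum_orbits (V : nmodType) p (aT : finGroupType) (sT : finType)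
    (A : {group aT}) (to : {action aT &-> sT}) (S : {set sT}) (f : sT -> V) :
  prime p -> (p.-group A)%g -> [acts A, on S | to] ->
  (forall x a, x \in S -> a \in A -> f (to x a) = f x) ->
  (forall x, x \in S -> ~~ (A \subset 'C[x | to])%g) ->
  exists c, \sum_(x in S) f x = c *+ p.
Proof.
move=> p_pr pA actS fA nofix; rewrite (set_partition_big _ (orbit_partition actS)) /=.
apply: (big_ind (fun s => exists c, s = c *+ p)) => [|_ _ [c ->] [d ->]|].
- by exists 0; rewrite mul0rn.
- by exists (c + d); rewrite mulrnDl.
move=> _ /imsetP[x Sx ->].
have eqf y : y \in orbit to A x -> f y = f x by case/orbitP=> a Aa <-; apply: fA.
rewrite (eq_bigr _ eqf) sumr_const card_orbit_in ?subsetT //.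
have /dvdnP[q ->] : (p %| #|A : 'C_A[x | to]|%g)%N.
  have pI : p.-nat #|A : 'C_A[x | to]|%g%N by apply: (pnat_dvd (dvdn_indexg _ _)).
  have [/eqP I1|] := eqVneq #|A : 'C_A[x | to]|%g 1%N.
    by rewrite indexg_eq1 subsetI subxx (negPf (nofix x Sx)) in I1.
  move=> I1; have [e eqI] := p_natP pI; move: I1; rewrite eqI.
  by case: e {eqI} => // e _; rewrite expnS dvdn_mulr.
by exists (f x *+ q); rewrite mulrnA.
Qed.

Section ModSystem.

Variables (p : nat) (O : idomainType) (K k : fieldType).
Variables (iota : {rmorphism O -> K}) (red : {rmorphism O -> k}).
Hypotheses (p_pr : prime p) (Omod : modular_system p iota red).

Let char0 := ms_pchar0 Omod.

Section InducedTrace.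

Variables (gT : finGroupType) (G W Q : {group gT}) (m : nat) (gamma : {ffun gT -> K}).
Variable gO : mx_representation O W m.
Hypotheses (sWG : W \subset G) (gO_gamma : affords (map_repr iota gO) gamma)
  (m_gt0 : (0 < m)%N)
  (modG : modular_irr iota red G (char_Ind W G gamma)) (sylQ : (p.-Sylow(W) Q)%g).

Local Notation chi := (char_Ind W G gamma).
Local Notation rO := (ind_repr gO sWG).
Local Notation E := (ind_embed W G (1%:M : 'M[O]_m)).

Let rO_chi : affords (map_repr iota rO) chi.
Proof.
have [indE out] := ind_affords sWG char0 gO_gamma.
by split=> // x Gx; rewrite map_ind_repr indE.
Qed.

Let spk : rspan (map_repr red rO). Proof. exact: modG rO_chi. Qed.
Let spK : rspan (map_repr iota rO).
Proof. exact: (rspan_liftK Omod (rspan_lift Omod spk)). Qed.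

Let card_ind : #|ind_index W G m| = (#|G : W|%g * m)%N.
Proof. by rewrite card_prod card_rcoset_index card_ord. Qed.

Let ind_gt0 : (0 < #|ind_index W G m|)%N.
Proof. by rewrite card_ind muln_gt0 m_gt0 indexg_gt0. Qed.

(** Schur's relation evaluates the sum over K: [E] has trace m, and the degree is |G : W| m. *)
Lemma ind_embed_trace :
  \sum_(x in G) rO x *m E *m rO x^-1%g = (#|W|%:R)%:M.
Proof.
apply: (map_iota_inj Omod); rewrite map_scalar_mx /= rmorph_nat raddf_sum /=.
have := rspan_Schur char0 spK ind_gt0 (map_mx iota E).
rewrite trace_map_mx ind_embed1_tr rmorph_nat.
have -> : #|G|%:R / #|ind_index W G m|%:R * m%:R = #|W|%:R :> K.
  rewrite card_ind natrM -mulrA invfM -mulrA mulVf ?(natK_neq0 Omod) // mulr1 -(Lagrange sWG) natrM.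
  by rewrite mulfK // (natK_neq0 Omod).
by move<-; apply: eq_bigr => x Gx; rewrite !map_mxM.
Qed.

Lemma sylow_trace_condition : trace_condition iota G chi Q.
Proof.
have sQW := pHall_sub sylQ.
apply/(trace_conditionE Omod rO_chi spk ind_gt0); split; first exact: subset_trans sWG.
have u : (#|W : Q|%g%:R : O) \is a GRing.unit.
  apply: (natO_unit Omod).
  by have [_ _] := and3P sylQ; rewrite p'natE.
exists (#|W : Q|%g%:R^-1 *: E) => [x Qx|].
  by rewrite -scalemxAl -scalemxAr ind_embed1_cent // (subsetP sQW).
transitivity (#|W : Q|%g%:R^-1 *: (\sum_(x in G) rO x *m E *m rO x^-1%g)).
  by rewrite scaler_sumr; apply: eq_bigr => x Gx; rewrite -scalemxAr -scalemxAl.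
rewrite ind_embed_trace scale_scalar_mx; congr _%:M.
by rewrite -(Lagrange sQW) natrM mulrC mulrK.
Qed.

Lemma sylow_trace_minimal (R : {group gT}) :
  ~~ (p %| m)%N -> R \subset Q -> trace_condition iota G chi R -> R :=: Q.
Proof.
move=> p'm sRQ /(trace_conditionE Omod rO_chi spk ind_gt0)[sRG [A cA trA]].
apply/eqP; rewrite eqEcard sRQ leqNgt; apply/negP=> ltRQ.
have sQW := pHall_sub sylQ; have sQG := subset_trans sQW sWG.
(* As A commutes with R, f is constant on the cosets Rx; as [E] commutes with W, it is constant on
   the cosets xQ. *)
pose f x := \tr (E *m (rO x^-1%g *m A *m rO x)).
have fR t x : t \in R -> x \in G -> f (t * x)%g = f x.
  move=> Rt Gx; have Gt := subsetP sRG t Rt.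
  rewrite /f invMg !repr_mxM ?groupV // -(mulmxA (rO x^-1%g)) cA ?groupV //.
  by rewrite !mulmxA repr_mxKV.
have fQ t x : t \in Q -> x \in G -> f (x * t)%g = f x.
  move=> Qt Gx; have Wt := subsetP sQW t Qt; have Gt := subsetP sWG t Wt.
  rewrite /f invMg !repr_mxM ?groupV // !mulmxA ind_embed1_cent ?groupV //.
  by rewrite mxtrace_mulC !mulmxA -repr_mxM ?groupV // mulgV repr_mx1 mul1mx.
have trE : (#|R|%:R * m%:R : O) = \sum_(x in G) f x.
  have := congr1 (fun M => \tr (E *m M)) trA; rewrite mul_mx_scalar mxtraceZ ind_embed1_tr => <-.
  rewrite mulmx_sumr raddf_sum (reindex_inj invg_inj) /=.
  by apply: eq_big => x; rewrite ?groupV // /f invgK.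
have [c eqc] : exists c, \sum_(C in rcosets R G) f (repr C) = c *+ p.
  apply: (pgroup_sum_orbits (to := 'Rs%act) (A := Q)) => //.
  - exact: pHall_pgroup sylQ.
  - exact: subset_trans sQG (actsRs_rcosets _ _).
  - move=> _ a /rcosetsP[x Gx ->] Qa /=.
    rewrite rcosetE -rcosetM.
    have repE y : y \in G -> f (repr (R :* y)%g) = f y.
      by move=> Gy; have /rcosetP[t Rt ->] := mem_repr_rcoset R y; rewrite fR.
    by have Ga := subsetP sQG a Qa; rewrite !repE ?fQ ?groupM.
  - move=> _ /rcosetsP[x Gx ->]; apply/negP=> /subsetP fixQ.
    have: Q \subset (R :^ x)%g.
      apply/subsetP=> y Qy; have /astab1P := fixQ y Qy.
      rewrite /= rcosetE -rcosetM => /rcoset_eqP.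
      by rewrite mem_rcoset mem_conjg conjgE invgK !mulgA.
    by move/subset_leq_card; rewrite cardJg leqNgt ltRQ.
(* |R| need not be a unit, but it is nonzero in the domain O and can be cancelled. *)
have R0 : (#|R|%:R : O) != 0 by rewrite -(iota_eq0 Omod) rmorph_nat (natK_neq0 Omod).
have : (m%:R : O) = c *+ p.
  apply: (mulfI R0); rewrite trE (sum_rcoset_index sRG fR) -eqc mulr_natl.
  by rewrite [in RHS]big_sub.
move/(congr1 red); rewrite rmorph_nat raddfMn /= -[red c *+ p]mulr_natr.
rewrite (pcharf0 (ms_pchar Omod)) mulr0 => /eqP.
by rewrite -(dvdn_pcharf (ms_pchar Omod)) (negPf p'm).
Qed.

End InducedTrace.
End ModSystem.

(** * Imprimitivity *)

Lemma repr_char_affords (F : fieldType) (gT : finGroupType) (H : {group gT}) n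
    (rH : mx_representation F H n) : affords rH (repr_char rH).
Proof. by split=> x Hx; rewrite ffunE ?Hx // (negPf Hx). Qed.

Lemma affords_eq (F : fieldType) (gT : finGroupType) (H : {group gT}) n
    (rH : mx_representation F H n) theta :
  affords rH theta -> theta = repr_char rH.
Proof.
case=> trH out; apply/ffunP=> x; rewrite ffunE.
by case: ifPn => Hx; [rewrite trH | rewrite out].
Qed.

Lemma idempotent01 (F : fieldType) (c : F) : c * c = c -> c = 0 \/ c = 1.
Proof.
have [->|c0] := eqVneq c 0; [by left | move=> cc; right].
by apply: (mulfI c0); rewrite cc mulr1.
Qed.

Lemma scalar_mx_inj (R : nzRingType) n (a b : R) :
  (0 < n)%N -> a%:M = b%:M :> 'M[R]_n -> a = b.
Proof.
by move=> n0 /matrixP/(_ (Ordinal n0) (Ordinal n0)); rewrite !mxE eqxx !mulr1n.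
Qed.

Definition imprimitive (F : fieldType) (gT : finGroupType) (T : {group gT})
    (psi : {ffun gT -> F}) : Prop :=
  exists (T1 : {group gT}) m (r1 : mx_representation F T1 m),
    T1 \proper T /\ psi = char_Ind T1 T (repr_char r1).

Section Imprimitivity.

Variables (F : fieldType) (gT : finGroupType) (T : {group gT}) (n : nat).
Variables (sigma : mx_representation F T n) (psi : {ffun gT -> F}).
Hypotheses (char0 : [pchar F] =i pred0) (spT : rspan sigma) (n_gt0 : (0 < n)%N).
Hypothesis sigma_psi : affords sigma psi.

Let nat_neq0 k : (0 < k)%N -> k%:R != 0 :> F.
Proof. by move=> k0; rewrite (pcharf0P F).1 // -lt0n. Qed.

Section Block.

Variables (X : 'M[F]_n) (r : nat) (C0 : 'M[F]_(n, r)) (D0 : 'M[F]_(r, n)).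
Hypotheses (facX : C0 *m D0 = X) (D0C0 : D0 *m C0 = 1%:M).

Local Notation T1 := (rcent_group sigma X).

(** The rows of [D0] form a basis of the image of X, which the centralizer [T1] of X in T leaves
    stable; this is the matrix of g in that basis. *)
Definition block_mx1 (g : gT) : 'M[F]_r := D0 *m sigma g *m C0.

Let sT1 : T1 \subset T. Proof. exact: rcent_sub. Qed.

Let D0X : D0 *m X = D0. Proof. by rewrite -facX mulmxA D0C0 mul1mx. Qed.

Let idX : X *m X = X. Proof. by rewrite -{1}facX -mulmxA D0X. Qed.

Lemma block_mx1_repr : mx_repr T1 block_mx1.
Proof.
split=> [|g h T1g T1h]; first by rewrite /block_mx1 repr_mx1 mulmx1.
have [Tg /eqP cg] := setIdP T1g; have Th := subsetP sT1 h T1h.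
rewrite /block_mx1 repr_mxM // -!mulmxA (mulmxA C0) facX.
by rewrite (mulmxA (sigma g) X) -cg -(mulmxA X) (mulmxA D0 X) D0X.
Qed.

Canonical block_repr1 := MxRepresentation block_mx1_repr.

Definition conj_mx (g : gT) : 'M[F]_n := sigma g *m X *m sigma g^-1%g.

Hypotheses (X_neq0 : X != 0)
  (blockX : forall g, g \in T -> conj_mx g = X \/ X *m conj_mx g = 0).

Let stabX g : g \in T -> conj_mx g = X -> g \in T1.
Proof.
move=> Tg eqX; apply/setIdP; split=> //.
by rewrite -{1}eqX /conj_mx repr_mxKV.
Qed.

Let offX g : g \in T -> g \notin T1 -> \tr (X *m sigma g) = 0.
Proof.
move=> Tg nT1g; have [/stabX-/(_ Tg)|X0] := blockX Tg; first by rewrite (negPf nT1g).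
rewrite -idX -mulmxA mxtrace_mulC -[X *m sigma g *m X]mulmxA.
have -> : sigma g *m X = conj_mx g *m sigma g by rewrite /conj_mx repr_mxKV.
by rewrite mulmxA X0 mul0mx mxtrace0.
Qed.

(** The sum is a scalar s by Schur's relation. Conjugates other than X are orthogonal to X, so
    multiplying by X leaves s X = X. *)
Lemma sum_blocks :
  \sum_(C : rcoset_index T1 T) conj_mx (crep C)^-1%g = 1%:M.
Proof.
have sumE : (\sum_(C : rcoset_index T1 T) conj_mx (crep C)^-1%g) *+ #|T1|
    = (#|T|%:R / n%:R * \tr X)%:M.
  rewrite -(rspan_Schur char0 spT n_gt0) (reindex_inj invg_inj) /=.
  have -> : \sum_(x | (x^-1)%g \in T) sigma x^-1%g *m X *m sigma (x^-1)^-1%g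
      = \sum_(x in T) conj_mx x^-1%g by apply: eq_bigl => x; rewrite groupV.
  rewrite (sum_rcoset_index sT1 (f := fun x => conj_mx x^-1%g)) // => t x T1t Tx.
  have [Tt /eqP ct] := setIdP T1t.
  rewrite /conj_mx !invgK invMg !repr_mxM ?groupV // -!mulmxA (mulmxA X) ct.
  by rewrite -!mulmxA (mulmxA (sigma t^-1%g)) -repr_mxM ?groupV // mulVg repr_mx1 mul1mx.
have [s def_s] : exists s, \sum_(C : rcoset_index T1 T) conj_mx (crep C)^-1%g = s%:M.
  exists (#|T1|%:R^-1 * (#|T|%:R / n%:R * \tr X)).
  apply: (scalerI (nat_neq0 (cardG_gt0 T1))).
  by rewrite scaler_nat sumE scale_scalar_mx mulVKf // nat_neq0.
have: X *m s%:M = X.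
  rewrite -def_s mulmx_sumr (bigD1 (coset1 T1 T)) //= big1 ?addr0 => [|C neqC].
    by rewrite crep1 /conj_mx !invg1 repr_mx1 mul1mx mulmx1 idX.
  have Tc := crepG sT1 C.
  have [/stabX|//] := blockX (groupVr Tc); rewrite groupV => /(_ Tc) T1c.
  case/eqP: neqC; apply: val_inj; rewrite !val_crep crep1 rcoset1.
  by rewrite rcoset_id // -groupV.
rewrite mul_mx_scalar -[X in _ = X]scale1r => /eqP; rewrite -subr_eq0 -scalerBl.
by rewrite scaler_eq0 (negPf X_neq0) orbF subr_eq0 def_s => /eqP->.
Qed.

(** Inserting [sum_blocks] writes the trace of g as the sum of tr(X cgc^-1) over coset
    representatives c; a term vanishes for h = cgc^-1 outside [T1], since then X h X = 0. *)
Lemma block_induced : psi = char_Ind T1 T (repr_char block_repr1).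
Proof.
apply/ffunP=> g; have [Tg|nTg] := boolP (g \in T); last first.
  by rewrite ffunE (negPf nTg); case: sigma_psi => _ ->.
rewrite (char_Ind_rcoset char0 sT1 (repr_char_affords _)) //.
case: sigma_psi => <- // _; rewrite -[sigma g]mul1mx -sum_blocks mulmx_suml raddf_sum.
apply: eq_bigr => C _; have Tc := crepG sT1 C; rewrite ffunE /=.
transitivity (\tr (X *m sigma (crep C * g * (crep C)^-1)%g)).
  rewrite /conj_mx invgK -!mulmxA mxtrace_mulC !repr_mxM ?groupM ?groupV //.
  by rewrite -!mulmxA.
case: ifPn => [T1c|nT1c]; last by apply: offX => //; rewrite !groupM ?groupV.
by rewrite /block_mx1 [RHS]mxtrace_mulC mulmxA facX.
Qed.

Lemma block_imprimitive : X != 1%:M -> imprimitive T psi.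
Proof.
move=> X1; exists (rcent_group sigma X), r, block_repr1; split.
  rewrite properE sT1; apply/negP=> sTT1.
  have [|c def_c] := rspan_cent_scalar (M := X) spT.
    by move=> x Tx; have /setIdP[_ /eqP] := subsetP sTT1 x Tx.
  have [|c0|c1] := @idempotent01 _ c.
  - by apply: (scalar_mx_inj n_gt0); rewrite scalar_mxM -def_c.
  - by move: X_neq0; rewrite def_c c0 raddf0 eqxx.
  - by move: X1; rewrite def_c c1 eqxx.
exact: block_induced.
Qed.

End Block.

Section Clifford.

Variables (N : {group gT}) (m : nat) (tau : mx_representation F N m).
Hypotheses (nNT : (N <| T)%g) (spN : rspan tau) (m_gt0 : (0 < m)%N).

Let sNT := normal_sub nNT.
Local Notation sigmaN := (subg_repr sigma sNT).
Local Notation X := (rlift tau sigmaN 1%:M).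

Definition conj_rep_mx (g x : gT) := tau (x ^ g)%g.

Lemma conj_rep_repr g : g \in T -> mx_repr N (conj_rep_mx g).
Proof.
move=> Tg; split=> [|x y Nx Ny]; first by rewrite /conj_rep_mx conj1g repr_mx1.
by rewrite /conj_rep_mx conjMg repr_mxM // memJ_norm // (subsetP (normal_norm nNT)).
Qed.

(** X and its conjugate X' are images of central idempotents of KN, attached to [tau] and to a
    conjugate of [tau]. Each idempotent acts on the irreducible module of the other as 0 or 1, so X
    X' is 0 or X', and X' X is 0 or X. As X and X' commute, they are orthogonal or equal. *)
Lemma clifford_idempotent_block g : X != 0 -> g \in T ->
  conj_mx X g = X \/ X *m conj_mx X g = 0.
Proof.
move=> X0 Tg; pose tau' := MxRepresentation (conj_rep_repr Tg).
have gN h y : h \in T -> (y ^ h \in N)%g = (y \in N).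
  by move=> Th; rewrite memJ_norm // (subsetP (normal_norm nNT)).
have spN' : rspan tau'.
  move=> Y; have [a ->] := spN Y; exists (fun x => a (x ^ g)%g).
  rewrite (reindex_inj (conjg_inj g)) /=.
  by apply: eq_bigl => x; rewrite gN.
have defX' : conj_mx X g = rlift tau' sigmaN 1%:M.
  rewrite /conj_mx /rlift mulmx_sumr mulmx_suml [RHS](reindex_inj (conjg_inj (g^-1)%g)) /=.
  apply: eq_big => [x | x Nx]; first by rewrite gN // groupV.
  rewrite !mul1mx /= /conj_rep_mx conjVg conjgKV -scalemxAr -scalemxAl.
  have Tx := subsetP sNT x Nx.
  by rewrite conjgE invgK !repr_mxM ?groupM ?groupV // mulmxA.
rewrite defX'; set X' := rlift tau' _ _.
have mulX : exists2 c, X *m X' = c *: X' & c = 0 \/ c = 1.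
  have [|c def_c] := rspan_cent_scalar (M := rlift tau tau' 1%:M) spN'.
    by move=> x Nx; apply: rlift1_cent.
  exists c; last first.
    apply: idempotent01; apply: (scalar_mx_inj m_gt0).
    by rewrite scalar_mxM -def_c -(rliftM char0 spN m_gt0) mulmx1.
  by rewrite -rlift_comb -/(rlift tau tau' 1%:M) def_c mulmx1 -(scalemx1 _ c) rliftZ.
have mulX' : exists2 c, X' *m X = c *: X & c = 0 \/ c = 1.
  have [|c def_c] := rspan_cent_scalar (M := rlift tau' tau 1%:M) spN.
    by move=> x Nx; apply: rlift1_cent.
  exists c; last first.
    apply: idempotent01; apply: (scalar_mx_inj m_gt0).
    by rewrite scalar_mxM -def_c -(rliftM char0 spN' m_gt0) mulmx1.
  by rewrite -rlift_comb -/(rlift tau' tau 1%:M) def_c mulmx1 -(scalemx1 _ c) rliftZ.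
have cXX' : X *m X' = X' *m X.
  rewrite [X in X *m _]/rlift mulmx_suml mulmx_sumr; apply: eq_bigr => x Nx.
  by rewrite -scalemxAl -scalemxAr rlift1_cent.
have X'0 : X' != 0.
  apply: contraNneq X0 => X'0.
  have : sigma g^-1%g *m conj_mx X g *m sigma g = X.
    by rewrite /conj_mx !mulmxA repr_mxKV // -repr_mxM ?groupV // mulVg repr_mx1 mul1mx.
  by rewrite defX' -/X' X'0 mulmx0 mul0mx => <-.
have [c XX' [c0|c1]] := mulX; first by right; rewrite XX' c0 scale0r.
have eqX' : X' = X' *m X by rewrite -cXX' XX' c1 scale1r.
left; have [d X'X [d0|d1]] := mulX'.
  by case/eqP: X'0; rewrite eqX' X'X d0 scale0r.
by rewrite eqX' X'X d1 scale1r.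
Qed.

Lemma clifford_imprimitive : X != 0 -> X != 1%:M -> imprimitive T psi.
Proof.
move=> X0 X1; have idX : X *m X = X by rewrite -(rliftM char0 spN m_gt0) mulmx1.
apply: (block_imprimitive (mulmx_base X) (idempotent_factor idX) X0) => // g Tg.
exact: clifford_idempotent_block.
Qed.

End Clifford.

(** Let [tau] be the action on a simple submodule of the restriction to N. Its idempotent X is
    nonzero; X = 1 says that the restriction is a multiple of [tau], and otherwise the conjugates of
    X are blocks of imprimitivity. *)
Lemma clifford_dichotomy (N : {group gT}) (nNT : (N <| T)%g) :
  group_splitting_field F N -> imprimitive T psi \/
  exists m (tau : mx_representation F N m),
    [/\ rspan tau, (0 < m)%N
      & rlift tau (subg_repr sigma (normal_sub nNT)) 1%:M = 1%:M].
Proof.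
move=> splitN; set sigmaN := subg_repr _ _.
(* [mxsimple_exists] only yields a doubly negated existence; excluded middle extracts a witness. *)
have [U simU] : exists U : 'M[F]_n, mxsimple sigmaN U.
  apply: NNPP => noU.
  have := mxsimple_exists (mxmodule1 sigmaN).
  rewrite -mxrank_eq0 mxrank1 -lt0n n_gt0 => /(_ isT) exU.
  by suff: false by []; apply: exU => -[U simU _]; case: noU; exists U.
have modU := mxsimple_module simU.
pose tau := submod_repr modU.
have absU : mx_absolutely_irreducible tau by apply/splitN/submod_mx_irr.
have spN := abs_irr_rspan absU; have /andP[m0 _] := absU.
pose V := val_submod (1%:M : 'M_(\rank U)).
have V0 : V != 0 by rewrite val_submod_eq0 -mxrank_eq0 mxrank1 -lt0n.
have tauV x : x \in N -> tau x *m V = V *m sigmaN x.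
  by move=> Nx; rewrite -val_submodJ // mul1mx -val_submodE.
have VX := rlift_intertwine char0 spN m0 1%:M tauV.
have X0 : rlift tau sigmaN 1%:M != 0.
  by apply: contraNneq V0 => X0; move: VX; rewrite X0 mul1mx mulmx0 => <-.
have [X1|X1] := eqVneq (rlift tau sigmaN 1%:M) 1%:M.
  by right; exists (\rank U), tau.
by left; apply: (clifford_imprimitive (nNT := nNT)) X1.
Qed.
End Imprimitivity.

(** * Heisenberg sections in odd characteristic *)

Lemma scale1_expr (F : fieldType) n (A B : 'M[F]_n.+1) d q :
  A = d *: B -> A ^+ q = 1 -> B ^+ q = 1 -> d ^+ q = 1.
Proof.
move=> ->; rewrite exprZn => AE BE; rewrite BE scalemx1 in AE.
by apply: (@scalar_mx_inj _ n.+1) => //; rewrite AE.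
Qed.

Lemma common_null_vector (F : fieldType) n (I : eqType) (N : I -> 'M[F]_n.+1) q (s : seq I) :
  (forall i, i \in s -> N i ^+ q = 0) ->
  {in s &, forall i j, N i * N j = N j * N i} ->
  exists2 v : 'rV[F]_n.+1, v != 0 & forall i, i \in s -> v *m N i = 0.
Proof.
elim: s => [|i s IHs] nil_s com_s.
  by exists (const_mx 1) => //; apply/eqP => /rowP/(_ 0)/eqP; rewrite !mxE oner_eq0.
have [||v v0 vs] := IHs.
- by move=> j sj; apply: nil_s; rewrite inE sj orbT.
- by move=> j l sj sl; apply: com_s; rewrite inE ?sj ?sl orbT.
have ex_e : exists e, v *m N i ^+ e == 0.
  by exists q; rewrite nil_s ?mem_head // mulmx0.
case: (ex_minnP ex_e) => -[|e] /eqP ve min_e.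
  by case/eqP: v0; rewrite -ve expr0 mulmx1.
(* The last nonzero image of v under powers of [N i] is still killed by the other operators, which
   commute with [N i]. *)
exists (v *m N i ^+ e) => [|j]; first by apply/negP=> /min_e; rewrite ltnn.
rewrite inE => /predU1P[->|sj]; first by rewrite -mulmxA -[_ *m N i]exprSr.
have cij : GRing.comm (N j) (N i) by apply: com_s; rewrite inE ?sj ?eqxx ?orbT.
by rewrite -mulmxA -[_ *m N j](commrX e cij) mulmxA vs // mul0mx.
Qed.

Lemma sum_shift (V : zmodType) p (h : nat -> V) :
  h p = h 0%N -> \sum_(i < p) h i.+1 = \sum_(i < p) h i.
Proof.
case: p => [|p hp]; first by rewrite !big_ord0.
by rewrite big_ord_recr big_ord_recl /= hp addrC.
Qed.

Section CommonEigenvector.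

Variables (F : fieldType) (V : lmodType F) (p : nat) (omega : F).
Hypotheses (p_pr : prime p) (pF : p%:R != 0 :> F)
  (omega_p : omega ^+ p = 1) (omega1 : omega != 1).

(* Discrete Fourier transform along the orbit of v under an operator f of order p. *)
Lemma order_p_eigenvector (f : {linear V -> V}) v :
  v != 0 -> iter p f v = v ->
  exists c (a : 'I_p -> F), let u := \sum_(i < p) a i *: iter i f v in
    u != 0 /\ f u = c *: u.
Proof.
move=> v0 fpv; pose u j := \sum_(i < p) omega ^+ (j * i) *: iter i f v.
have p0 := prime_gt0 p_pr.
have geom i : (0 < i < p)%N -> \sum_(j < p) omega ^+ (j * i) = 0.
  case/andP=> i0 ip; have z1 : omega ^+ i - 1 != 0.
    rewrite subr_eq0; apply: contra omega1 => /eqP oi1.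
    have [m m_prim m_p] := prim_order_exists p0 omega_p.
    have m1 : m != 1%N.
      by apply: contraNneq omega1 => m1; have := prim_expr_order m_prim; rewrite m1 expr1 => ->.
    have /eqP mp : m == p by apply/eqP/(prime_nt_dvdP p_pr m1).
    have : (p %| i)%N by rewrite -mp (prim_order_dvd m_prim) oi1.
    by move/(dvdn_leq i0); rewrite leqNgt ip.
  apply: (mulfI z1); rewrite mulr0.
  have -> : \sum_(j < p) omega ^+ (j * i) = \sum_(j < p) (omega ^+ i) ^+ j.
    by apply: eq_bigr => j _; rewrite -exprM mulnC.
  by rewrite -subrX1 -exprM mulnC exprM omega_p expr1n subrr.
have sum_u : \sum_(j < p) u j = p%:R *: v.
  rewrite exchange_big /= (bigD1 (Ordinal p0)) //= [X in _ + X]big1 ?addr0 => [|i i0].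
    rewrite (eq_bigr (fun=> v)) ?sumr_const ?card_ord ?scaler_nat //.
    by move=> j _; rewrite muln0 expr0 scale1r.
  rewrite -scaler_suml geom ?scale0r // ltn_ord andbT lt0n.
  by apply: contraNneq i0 => i0; apply/eqP/val_inj.
have [j uj] : exists j : 'I_p, u j != 0.
  apply/existsP; apply: contraNT v0 => /existsPn u0.
  have : p%:R *: v = 0.
    by rewrite -sum_u big1 // => j _; apply/eqP; rewrite -[_ == _]negbK u0.
  by move/eqP; rewrite scaler_eq0 (negPf pF).
exists (omega ^+ j)^-1, (fun i => omega ^+ (j * i)); split=> //.
have oj0 : omega ^+ j != 0.
  apply: expf_neq0; apply: contra_eq_neq omega_p => ->.
  by rewrite expr0n (gtn_eqF p0) eq_sym oner_neq0.
apply: (scalerI oj0); rewrite scalerA mulfV // scale1r /u linear_sum scaler_sumr /=.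
pose h i := omega ^+ (j * i) *: iter i f v.
rewrite (eq_bigr (fun i : 'I_p => h i.+1)) => [|i _]; last first.
  by rewrite linearZ scalerA -exprD /h iterS mulnS.
by rewrite sum_shift // /h fpv muln0 expr0 mulnC exprM omega_p expr1n.
Qed.

End CommonEigenvector.

Section ModSystem.

Variables (p : nat) (O : idomainType) (K k : fieldType).
Variables (iota : {rmorphism O -> K}) (red : {rmorphism O -> k}).
Hypotheses (p_pr : prime p) (Omod : modular_system p iota red).

Let iotaI := ms_frac_inj Omod.

(** The scalar by which A and B fail to commute occurs once on each side, so the maps M -> A M A and
    M -> B M B commute exactly. *)
Lemma quasi_comm_sandwich (F : fieldType) m (A B M : 'M[F]_m.+1) e :
  A * B = e *: (B * A) -> A * (B * M * B) * A = B * (A * M * A) * B.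
Proof.
move=> eq_e; transitivity ((A * B) * M * (B * A)); first by rewrite !mulrA.
transitivity ((B * A) * M * (A * B)); last by rewrite !mulrA.
by rewrite eq_e -!scalerAl -!scalerAr.
Qed.

Section Heisenberg.

Variables (gT : finGroupType) (T E Z : {group gT}) (n : nat).
Variable rO : mx_representation O T n.+1.
Hypotheses (p_odd : odd p) (spk : rspan (map_repr red rO)).

Local Notation sigma := (map_repr iota rO).
Local Notation sigmak := (map_repr red rO).

Hypotheses (sET : E \subset T) (nET : (T \subset 'N(E))%g) (sZE : Z \subset E)
  (scalZ : forall x, x \in E -> (x \in Z) = is_scalar_mx (sigma x))
  (commE : forall x y, x \in E -> y \in E -> [~ x, y]%g \in Z)
  (powE : forall x, x \in E -> (x ^+ p)%g \in Z)
  (nondegE : forall u, u \in E -> u \notin Z ->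
     exists2 x, x \in E & sigma x * sigma u != sigma u * sigma x)
  (eigE : forall x, x \in E ->
     exists2 c : K, c ^+ #|T| = 1 & sigma x ^+ p = (c ^+ p)%:M).

Let TE x : x \in E -> x \in T. Proof. exact: (subsetP sET). Qed.
Let EZ x : x \in Z -> x \in E. Proof. exact: (subsetP sZE). Qed.

Let p_gt0 := prime_gt0 p_pr.

Let scAl (c : K) (A B : 'M[K]_n.+1) : c *: (A * B) = (c *: A) * B.
Proof. exact: scalerAl. Qed.
Let scAr (c : K) (A B : 'M[K]_n.+1) : c *: (A * B) = A * (c *: B).
Proof. exact: scalerAr. Qed.

Let trZ (c : K) (A : 'M[K]_n.+1) : \tr (c *: A) = c * \tr A.
Proof. exact: mxtraceZ. Qed.

Let scal x : x \in Z -> exists2 c, sigma x = c%:M & c != 0.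
Proof.
move=> Zx; have := Zx; rewrite scalZ ?EZ // => /is_scalar_mxP[c def_c]; exists c => //.
apply/eqP=> c0; have := repr_mxK sigma (TE (EZ Zx)) 1%:M.
rewrite def_c c0 raddf0 mulmx0 mul0mx => /eqP.
by rewrite eq_sym -/(GRing.one _) oner_eq0.
Qed.

Let sM x y : x \in T -> y \in T -> sigma (x * y)%g = sigma x * sigma y.
Proof. exact: repr_mxM. Qed.

Let sV x : x \in T -> sigma x * sigma x^-1%g = 1.
Proof. by move=> Tx; rewrite -sM ?groupV // mulgV; exact: repr_mx1. Qed.
Let sVl x : x \in T -> sigma x^-1%g * sigma x = 1.
Proof. by move=> Tx; rewrite -sM ?groupV // mulVg; exact: repr_mx1. Qed.
Let sX x m : x \in T -> sigma (x ^+ m)%g = sigma x ^+ m.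
Proof. by move=> Tx; rewrite repr_mxX. Qed.

Let scaleI (c : K) (A : 'M[K]_n.+1) : c *: A = A -> A != 0 -> c = 1.
Proof.
move=> cA A0; apply/eqP; rewrite -subr_eq0.
have /eqP : (c - 1) *: A = 0 by rewrite scalerBl cA scale1r subrr.
by rewrite scaler_eq0 (negPf A0) orbF.
Qed.

Let s_neq0 x : x \in T -> sigma x != 0.
Proof.
move=> Tx; apply/eqP=> x0; have := sV Tx.
by rewrite x0 mul0r => /esym/eqP; rewrite oner_eq0.
Qed.

Let comm_scal x y : x \in E -> y \in E ->
  exists2 c, sigma x * sigma y = c *: (sigma y * sigma x) & c ^+ p = 1.
Proof.
move=> Ex Ey; have [Tx Ty] := (TE Ex, TE Ey).
have [c def_c c0] := scal (commE (groupVr Ex) (groupVr Ey)).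
have xy : sigma x * sigma y = c *: (sigma y * sigma x).
  have -> : sigma x * sigma y = sigma ([~ x^-1, y^-1] * (y * x))%g.
    by rewrite -sM // commgEl conjgE !invgK !mulgA mulgKV mulgKV.
  by rewrite sM ?groupM ?groupR ?groupV // def_c sM // -mul_scalar_mx.
exists c => //; have [d def_d d0] := scal (powE Ex).
have xmy m : sigma x ^+ m * sigma y = c ^+ m *: (sigma y * sigma x ^+ m).
  elim: m => [|m IHm]; first by rewrite !expr0 scale1r mul1r mulr1.
  rewrite exprSr -[LHS]mulrA xy -scAr [in LHS]mulrA IHm -scAl scalerA.
  by rewrite -exprS mulrA.
have := xmy p; rewrite -sX // def_d.
have -> : d%:M * sigma y = sigma y * d%:M by apply/esym/scalar_mxC.
move/esym/scaleI; apply; rewrite [_ * _]mul_mx_scalar scaler_eq0 negb_or d0.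
exact: s_neq0.
Qed.

Let ex_eps x : exists c : K,
  (x \in E) ==> (c ^+ #|T| == 1) && (sigma x ^+ p == (c ^+ p)%:M).
Proof.
case Ex: (x \in E); last by exists 0.
by have [c c1 xp] := eigE Ex; exists c; rewrite c1 xp !eqxx.
Qed.

(** [eps x] plays the role of an eigenvalue of x. Dividing by it normalizes x to an operator [w x]
    with p-th power 1; as it is a root of unity, [w x] stays defined over O. *)
Let eps x := xchoose (ex_eps x).
Let w x : 'M[K]_n.+1 := locked ((eps x)^-1 *: sigma x).

Let wE x : w x = (eps x)^-1 *: sigma x.
Proof. by rewrite /w -lock. Qed.

Let eps_unity x : x \in E -> eps x ^+ #|T| = 1.
Proof. by move=> Ex; have /implyP/(_ Ex)/andP[/eqP] := xchooseP (ex_eps x). Qed.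

Let eps_p x : x \in E -> sigma x ^+ p = (eps x ^+ p)%:M.
Proof. by move=> Ex; have /implyP/(_ Ex)/andP[_ /eqP] := xchooseP (ex_eps x). Qed.

Let eps_neq0 x : x \in E -> eps x != 0.
Proof.
move=> Ex; apply/eqP=> e0; have /eqP := eps_unity Ex.
by rewrite e0 expr0n (gtn_eqF (cardG_gt0 T)) eq_sym oner_eq0.
Qed.

Let sw x : x \in E -> sigma x = eps x *: w x.
Proof. by move=> Ex; rewrite wE scalerA mulfV ?scale1r ?eps_neq0. Qed.

Let wp x : x \in E -> w x ^+ p = 1.
Proof.
move=> Ex; rewrite wE exprZn eps_p // exprVn -[_%:M]scalemx1 scalerA mulVf ?scale1r //.
by rewrite expf_neq0 // eps_neq0.
Qed.

Let wC x y : x \in E -> y \in E -> exists2 c, w x * w y = c *: (w y * w x) & c ^+ p = 1.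
Proof.
move=> Ex Ey; have [c xy cp] := comm_scal Ex Ey; exists c => //.
rewrite !wE -!scAl -!scAr xy !scalerA; congr (_ *: _).
by ring.
Qed.

Let wJ g x : g \in T -> x \in E ->
  exists2 c, w x * sigma g = c *: (sigma g * w (x ^ g)%g) & c ^+ p = 1.
Proof.
move=> Tg Ex; have Exg : (x ^ g)%g \in E by rewrite memJ_norm // (subsetP nET).
have eq1 : w x * sigma g = (eps (x ^ g)%g / eps x) *: (sigma g * w (x ^ g)%g).
  rewrite !wE -scAl -scAr scalerA mulrAC mulfV ?eps_neq0 // mul1r.
  by rewrite -!sM ?(TE Ex) ?(TE Exg) // conjgC.
exists (eps (x ^ g)%g / eps x) => //.
apply: (@scale1_expr _ _ (sigma g^-1%g * w x * sigma g) (w (x ^ g)%g)); rewrite ?wp //.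
  by rewrite -mulrA eq1 -scAr mulrA sVl // mul1r.
have conjX m : (sigma g^-1%g * w x * sigma g) ^+ m = sigma g^-1%g * w x ^+ m * sigma g.
  elim: m => [|m IHm]; first by rewrite !expr0 mulr1 sVl.
  rewrite exprSr IHm exprSr !mulrA; congr (_ * _); congr (_ * _).
  by rewrite -!mulrA sV // mulr1.
by rewrite conjX wp // mulr1 sVl.
Qed.

Let wV x := w x ^+ p.-1.
Let wVr x : x \in E -> w x * wV x = 1.
Proof. by move=> Ex; rewrite -exprS prednK // wp. Qed.
Let wVl x : x \in E -> wV x * w x = 1.
Proof. by move=> Ex; rewrite -exprSr prednK // wp. Qed.

Let unity_lift (c : K) : c ^+ p = 1 -> exists2 c0, iota c0 = c & red c0 = 1.
Proof.
move=> cp; have [c0 def_c] := integral_unity Omod p_gt0 cp.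
exists c0 => //; apply: (red_unity Omod (m := 1)); rewrite expn1 -rmorphXn.
have -> : c0 ^+ p = 1 by apply: iotaI; rewrite rmorphXn -def_c cp rmorph1.
by rewrite rmorph1.
Qed.

Let ex_epsO x : exists e, (x \in E) ==> ((eps x)^-1 == iota e).
Proof.
case Ex: (x \in E); last by exists 0.
have [|e ->] := integral_unity Omod (cardG_gt0 T) (x := (eps x)^-1).
  by rewrite exprVn eps_unity // invr1.
by exists e; rewrite eqxx.
Qed.

Let wO x : 'M[O]_n.+1 := xchoose (ex_epsO x) *: rO x.

Let wOE x : x \in E -> map_mx iota (wO x) = w x.
Proof.
by move=> Ex; have /implyP/(_ Ex)/eqP epsE := xchooseP (ex_epsO x); rewrite wE epsE map_mxZ.
Qed.

Let map_inj := @map_iota_inj _ _ _ _ _ _ Omod n.+1 n.+1.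

Let wk_p x : x \in E -> map_mx red (wO x) ^+ p = 1.
Proof.
move=> Ex; rewrite -rmorphXn; have -> : wO x ^+ p = 1.
  by apply: map_inj; rewrite rmorphXn /= wOE // wp // rmorph1.
by rewrite rmorph1.
Qed.

(** The reductions are commuting unipotent matrices and so have a common fixed vector v. The
    elements of T permute them, because p-th roots of unity reduce to 1; hence v g is fixed too for
    g in T, and as T spans the matrix ring every vector is fixed. *)
Lemma heis_reduction x : x \in E -> map_mx red (wO x) = 1.
Proof.
have pM : p \in [pchar 'M[k]_n.+1] by rewrite (pchar_lalg 'M[k]_n.+1) (ms_pchar Omod).
have nilE y : y \in enum E -> (map_mx red (wO y) - 1) ^+ p = 0.
  rewrite mem_enum => Ey; rewrite -(pFrobenius_autE pM).
  rewrite (pFrobenius_autB_comm pM (commr1 _)) pFrobenius_aut1 pFrobenius_autE.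
  by rewrite wk_p // subrr.
have comE : {in enum E &, forall y z, (map_mx red (wO y) - 1) * (map_mx red (wO z) - 1)
    = (map_mx red (wO z) - 1) * (map_mx red (wO y) - 1)}.
  move=> y z; rewrite !mem_enum => Ey Ez.
  apply: commrB; last exact: commr1.
  apply: commr_sym; apply: commrB; last exact: commr1.
  have [c wyz cp] := wC Ez Ey; have [c0 def_c c01] := unity_lift cp.
  have eqO : wO z * wO y = c0 *: (wO y * wO z).
    by apply: map_inj; rewrite map_mxZ !rmorphM /= !wOE // wyz def_c.
  by have := congr1 (map_mx red) eqO; rewrite map_mxZ c01 scale1r !rmorphM.
have [v v0 vE] := common_null_vector nilE comE.
have vM (M : 'M[k]_n.+1) y : y \in E -> v *m M *m (map_mx red (wO y) - 1) = 0.
  move=> Ey; have [a ->] := spk M; rewrite mulmx_sumr mulmx_suml big1 // => g Tg.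
  rewrite -scalemxAr -scalemxAl; apply/eqP; rewrite scaler_eq0; apply/orP; right; apply/eqP.
  pose y' := (y ^ g^-1)%g; have Ey' : y' \in E.
    by rewrite memJ_norm // groupV (subsetP nET).
  have [c wJy cp] := wJ Tg Ey'; have [c0 def_c c01] := unity_lift cp.
  have eqO : wO y' * rO g = c0 *: (rO g * wO y).
    apply: map_inj; rewrite map_mxZ !rmorphM /= !wOE // -[map_mx iota (rO g)]/(sigma g).
    by rewrite wJy /y' conjgKV def_c.
  have eqk : sigmak g *m map_mx red (wO y) = map_mx red (wO y') *m sigmak g.
    by have := congr1 (map_mx red) eqO; rewrite map_mxZ c01 scale1r !rmorphM /= => /esym.
  rewrite mulmxBr mulmx1 -mulmxA eqk mulmxA.
  have := vE y'; rewrite mem_enum => /(_ Ey'); rewrite mulmxBr mulmx1 => /eqP.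
  by rewrite subr_eq0 => /eqP->; rewrite subrr.
move=> Ex; apply/eqP; rewrite -subr_eq0; apply/eqP/row_matrixP=> i.
have /rV0Pn[j vj] := v0.
have := vM (delta_mx j i) x Ex.
have -> : v *m delta_mx j i = v 0 j *: delta_mx 0 i.
  apply/rowP=> l; rewrite -[v *m _]mulmx1 mul_delta_mxE !mxE eqxx /=.
  by rewrite [i == l]eq_sym.
rewrite -scalemxAl -rowE row0 => /eqP; rewrite scaler_eq0 (negPf vj) => /eqP.
by [].
Qed.

Local Notation sE := (subg_repr sigma sET).
(** E need not span the full matrix ring, so its enveloping algebra takes the place of that ring:
    nondegeneracy of the commutator makes its centre scalar and its trace form nondegenerate. *)
Let inA (M : 'M[K]_n.+1) : bool := (M \in enveloping_algebra_mx sE)%MS.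

Let inA_s x : x \in E -> inA (sigma x).
Proof. by move=> Ex; apply: (envelop_mx_id sE). Qed.
Let inAM A B : inA A -> inA B -> inA (A * B).
Proof. exact: envelop_mxM. Qed.
Let inAZ c A : inA A -> inA (c *: A).
Proof. by rewrite /inA linearZ; apply: scalemx_sub. Qed.
Let inAD A B : inA A -> inA B -> inA (A + B).
Proof. by rewrite /inA linearD; apply: addmx_sub. Qed.
Let inA0 : inA 0.
Proof. by rewrite /inA linear0 sub0mx. Qed.

Let inA1 : inA 1.
Proof. exact: envelop_mx1. Qed.
Let inA_sum I (r : seq I) (P : pred I) (f : I -> 'M[K]_n.+1) :
  (forall i, P i -> inA (f i)) -> inA (\sum_(i <- r | P i) f i).
Proof. by move=> Af; apply: (big_ind inA). Qed.
Let inA_w x : x \in E -> inA (w x).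
Proof. by move=> Ex; rewrite wE; apply/inAZ/inA_s. Qed.

Let trMC (A B : 'M[K]_n.+1) : \tr (A * B) = \tr (B * A).
Proof. exact: mxtrace_mulC. Qed.

Let trace_off u : u \in E -> u \notin Z -> \tr (sigma u) = 0.
Proof.
move=> Eu nZu; have [x Ex ne_xu] := nondegE Eu nZu; have Tx := TE Ex.
have [c xu _] := comm_scal Ex Eu.
have c1 : c != 1 by apply: contraNneq ne_xu => c1; rewrite xu c1 scale1r.
have : c * \tr (sigma u) = \tr (sigma u).
  rewrite -trZ -[c *: _]mulr1 -(sV Tx) mulrA -scAl -xu trMC.
  by rewrite mulrA sVl // mul1r.
move/eqP; rewrite -[X in _ == X]mul1r -subr_eq0 -mulrBl mulf_eq0 subr_eq0.
by rewrite (negPf c1) => /eqP.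
Qed.

(** For Y = [sigma v] only the u in the coset Zv contribute, each with the degree times [sigma v];
    all other traces vanish by [trace_off]. *)
Let expand Y : inA Y ->
  \sum_(u in E) \tr (Y * sigma u^-1%g) *: sigma u = (n.+1 * #|Z|)%:R *: Y.
Proof.
case/envelop_mxP=> b ->.
transitivity (\sum_(v in E) b v *: \sum_(u in E) \tr (sigma v * sigma u^-1%g) *: sigma u).
  under eq_bigr do rewrite mulr_suml raddf_sum scaler_suml.
  rewrite exchange_big; apply: eq_bigr => v Ev; rewrite scaler_sumr.
  by apply: eq_bigr => u Eu; rewrite -scAl /= trZ scalerA.
rewrite scaler_sumr; apply: eq_bigr => v Ev; rewrite scalerA mulrC -scalerA.
congr (_ *: _); have Tv := TE Ev.
rewrite (reindex_inj (inj_comp (mulIg v) invg_inj)) /=.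
rewrite (eq_bigl (mem E)) => [|u]; last by rewrite groupMr // groupV.
rewrite (bigID (mem Z)) /= [X in _ + X]big1 ?addr0 => [|u /andP[Eu nZu]]; last first.
  rewrite -sM ?groupV ?groupM ?groupV ?TE // invMg invgK mulKVg trace_off //.
  by rewrite scale0r.
rewrite (eq_bigr (fun=> n.+1%:R *: sigma v)) => [|u /andP[Eu Zu]].
  rewrite (eq_bigl (mem Z)) => [|u]; last by apply: andb_idl; apply: EZ.
  by rewrite sumr_const -scaler_nat scalerA mulrC -natrM.
have Tu := TE Eu; rewrite -sM ?groupV ?groupM ?groupV // invMg invgK mulKVg.
rewrite sM ?groupV //; have [c def_c c0] := scal Zu.
rewrite def_c mxtrace_scalar.
have -> : c *+ n.+1 = n.+1%:R * c by rewrite mulr_natl.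
rewrite -scalerA scAl; congr (_ *: _).
have -> : c *: sigma u^-1%g = 1 by rewrite -mul_scalar_mx -def_c; apply: sV.
by rewrite mul1r.
Qed.

Let nondeg Y : inA Y -> Y != 0 -> exists2 u, u \in E & \tr (Y * sigma u) != 0.
Proof.
move=> AY Y0; apply: NNPP => noE; case/eqP: Y0.
have nZ0 : (n.+1 * #|Z|)%:R != 0 :> K by rewrite (natK_neq0 Omod) // muln_gt0 cardG_gt0.
apply: (scalerI nZ0); rewrite scaler0 -expand // big1 // => u Eu.
suff -> : \tr (Y * sigma u^-1%g) = 0 by rewrite scale0r.
apply/eqP/negPn/negP=> tr0; case: noE; exists (u^-1)%g; by rewrite ?groupV.
Qed.

Let scalarA Y : inA Y -> (forall x, x \in E -> sigma x * Y = Y * sigma x) ->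
  exists a, Y = a%:M.
Proof.
move=> AY cY; pose a := \tr Y / n.+1%:R; exists a; apply/eqP; rewrite -subr_eq0.
apply/negPn/negP=> Ya0.
have n0 : n.+1%:R != 0 :> K by rewrite (natK_neq0 Omod).
have trYa : \tr (Y - a%:M) = 0.
  by rewrite raddfB /= mxtrace_scalar -[a *+ _]mulr_natr divfK // subrr.
have AYa : inA (Y - a%:M).
  by rewrite -scalemx1 -scaleNr; apply/inAD => //; apply/inAZ/inA1.
have [u Eu] := nondeg AYa Ya0; have Tu := TE Eu.
case/eqP; have [Zu|nZu] := boolP (u \in Z).
  by have [c -> _] := scal Zu; rewrite [_ * _]mul_mx_scalar trZ trYa mulr0.
have [x Ex ne_xu] := nondegE Eu nZu; have Tx := TE Ex.
have [c xu _] := comm_scal Ex Eu.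
have c1 : c != 1 by apply: contraNneq ne_xu => c1; rewrite xu c1 scale1r.
have cYa : sigma x * (Y - a%:M) = (Y - a%:M) * sigma x.
  by rewrite mulrBr mulrBl cY //; congr (_ - _); apply: scalar_mxC.
have : c * \tr ((Y - a%:M) * sigma u) = \tr ((Y - a%:M) * sigma u).
  have h : sigma x * ((Y - a%:M) * sigma u) = c *: ((Y - a%:M) * sigma u * sigma x).
    by rewrite [LHS]mulrA cYa -[LHS]mulrA xu -[LHS]scAr mulrA.
  have eqt : \tr (sigma x * ((Y - a%:M) * sigma u) * sigma x^-1%g)
      = \tr ((Y - a%:M) * sigma u).
    by rewrite [LHS]trMC mulrA sVl // mul1r.
  by rewrite -[in RHS]eqt h -scAl trZ -[_ * sigma x * _]mulrA sV // mulr1.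
move/eqP; rewrite -[X in _ == X]mul1r -subr_eq0 -mulrBl mulf_eq0 subr_eq0.
by rewrite (negPf c1) => /eqP.
Qed.

Let iter_w x m M : iter m (fun N => w x * N * w x) M = w x ^+ m * M * w x ^+ m.
Proof.
elim: m => [|m IHm]; first by rewrite !expr0 mul1r mulr1.
by rewrite iterS IHm !mulrA -exprS -[LHS]mulrA -exprSr.
Qed.

(* In the Heisenberg representation, tau is the operator inducing inversion on E / Z. *)
Let parity (tau : 'M[K]_n.+1) : Prop :=
  forall x, x \in E -> exists c, w x * tau * w x = c *: tau.

(** The maps M -> [w x] M [w x] commute and have order dividing p, so a common eigenvector is found
    by treating one x at a time inside the algebra of E. The root of unity for the Fourier transform
    is the commutator scalar of a noncommuting pair in E. *)
Let parity_exists : (exists2 x, x \in E & x \notin Z) ->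
  exists tau : 'M[K]_n.+1, [/\ tau != 0, inA tau & parity tau].
Proof.
case=> x0 Ex0 nZx0; have [x1 Ex1 ne_x] := nondegE Ex0 nZx0.
have [om eq_om omp] := comm_scal Ex1 Ex0.
have om1 : om != 1 by apply: contraNneq ne_x => om1; rewrite eq_om om1 scale1r.
suff par (s : seq gT) : {subset s <= E} -> exists tau : 'M[K]_n.+1, [/\ tau != 0, inA tau &
    forall x, x \in s -> exists c, w x * tau * w x = c *: tau].
  have [|tau [t0 tA parT]] := par (enum E); first by move=> x; rewrite mem_enum.
  by exists tau; split=> // x Ex; apply: parT; rewrite mem_enum.
elim: s => [_|x s IHs sE]; first by exists 1; split; rewrite ?oner_neq0.
have Ex : x \in E by apply: sE; rewrite mem_head.
have [|tau [t0 tA parT]] := IHs; first by move=> y sy; apply: sE; rewrite inE sy orbT.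
pose f : {linear 'M[K]_n.+1 -> 'M[K]_n.+1} := mulmxr (w x) \o mulmx (w x).
have fE m M : iter m f M = w x ^+ m * M * w x ^+ m by rewrite -iter_w.
have p0 : p%:R != 0 :> K by rewrite (natK_neq0 Omod).
have [|c [a [u0 fu]]] := order_p_eigenvector p_pr p0 omp om1 (f := f) t0.
  by rewrite fE wp // mul1r mulr1.
set u := \sum_(i < p) _ in u0 fu; exists u; split=> //.
  apply: inA_sum => i _; apply: inAZ; rewrite fE.
  have Awx : inA (w x ^+ i).
    by elim: (i : nat) => [|m IHm]; rewrite ?expr0 // exprS inAM ?inA_w.
  by rewrite !inAM.
move=> y; rewrite inE => /predU1P[->|sy]; first by exists c.
have [d eq_d] := parT y sy; have Ey : y \in E by apply: sE; rewrite inE sy orbT.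
have [e eq_e ep] := wC Ex Ey.
have comf M : f (w y * M * w y) = w y * f M * w y := quasi_comm_sandwich M eq_e.
exists d; rewrite /u mulr_sumr mulr_suml scaler_sumr; apply: eq_bigr => i _.
rewrite -scAr -scAl scalerA mulrC -scalerA; congr (_ *: _).
elim: (i : nat) => [|m IHm]; first exact: eq_d.
by rewrite !iterS -comf IHm linearZ.
Qed.

Let parity_pow tau x c m : w x * tau * w x = c *: tau ->
  w x ^+ m * tau * w x ^+ m = c ^+ m *: tau.
Proof.
move=> eq_c; rewrite -iter_w; elim: m => [|m IHm]; first by rewrite scale1r.
by rewrite iterS IHm -scAr -scAl eq_c scalerA -exprSr.
Qed.

Let parity_p tau x c : x \in E -> tau != 0 -> w x * tau * w x = c *: tau -> c ^+ p = 1.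
Proof.
move=> Ex t0 /(parity_pow p); rewrite wp // mul1r mulr1 => /esym eq_t.
exact: scaleI eq_t t0.
Qed.

(* Since p is odd, every w v is up to a p-th root of unity the square of some w y. *)
Let parity_trace tau v : parity tau -> tau != 0 -> v \in E ->
  exists2 d, \tr (tau * w v) = d * \tr tau & d ^+ p = 1.
Proof.
(* y is a square root of v modulo Z: y^2 = v^(p+1) = v^p v. *)
move=> parT t0 Ev; pose y := (v ^+ p.+1./2)%g.
have Ey : y \in E by rewrite groupX.
have yy : (y * y = v ^+ p * v)%g.
  by rewrite -expgD addnn -[in RHS]expgSr; congr (v ^+ _)%g; rewrite halfK /= p_odd subn0.
have [z def_z z0] := scal (powE Ev).
have eq_w : w y * w y = ((eps y)^-1 * (eps y)^-1 * z * eps v) *: w v.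
  rewrite {1 2}wE -scAl -scAr -sM ?TE // yy sM ?groupX ?TE // def_z (sw Ev).
  by rewrite [_%:M * _]mul_scalar_mx !scalerA.
set d1 := (_ * eps v) in eq_w; have d1p : d1 ^+ p = 1.
  apply: (@scale1_expr _ _ (w y * w y) (w v) d1 p) => //; last exact: wp.
  by rewrite exprMn_comm // wp // mulr1.
have d10 : d1 != 0.
  by apply/eqP=> d0; move/eqP: d1p; rewrite d0 expr0n (gtn_eqF p_gt0) eq_sym oner_eq0.
have [c eq_c] := parT y Ey; have cp := parity_p Ey t0 eq_c.
exists (d1^-1 * c); last by rewrite exprMn exprVn d1p cp invr1 mulr1.
have -> : w v = d1^-1 *: (w y * w y) by rewrite eq_w scalerA mulVf // scale1r.
rewrite -scAr trZ -mulrA; congr (_ * _).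
by rewrite mulrA [LHS]trMC mulrA eq_c trZ.
Qed.

Let parity_trace_neq0 tau : parity tau -> inA tau -> tau != 0 -> \tr tau != 0.
Proof.
move=> parT tA t0; apply/eqP=> tr0; have [u Eu] := nondeg tA t0.
have [d eq_d _] := parity_trace parT t0 Eu.
by rewrite sw // -scAr trZ eq_d tr0 !mulr0 eqxx.
Qed.

(** In passing a parity operator, [w x] turns into its inverse up to a scalar; passing two of them
    restores it. *)
Let parity_unique tau tau' : parity tau -> parity tau' -> tau != 0 -> tau' != 0 ->
  inA tau -> inA tau' ->
  forall x, x \in E -> exists2 c, w x * (tau * tau') = c *: (tau * tau' * w x) & c != 0.
Proof.
move=> parT parT' t0 t0' tA tA' x Ex.
have [c eq_c] := parT x Ex; have [d eq_d] := parT' x Ex.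
have nz0 (e : K) : e ^+ p = 1 -> e != 0.
  move=> ep; apply/eqP=> e0; move/eqP: ep.
  by rewrite e0 expr0n (gtn_eqF p_gt0) eq_sym oner_eq0.
have d0 := nz0 d (parity_p Ex t0' eq_d); have c0 := nz0 c (parity_p Ex t0 eq_c).
have wt : w x * tau = c *: (tau * wV x).
  by rewrite scAl -eq_c -[RHS]mulrA wVr // mulr1.
have wVt : wV x * tau' = d^-1 *: (tau' * w x).
  have : tau' * w x = d *: (wV x * tau').
    by rewrite scAr -eq_d !mulrA wVl // mul1r.
  by move->; rewrite scalerA mulVf // scale1r.
exists (c * d^-1); last by rewrite mulf_neq0 ?invr_eq0.
by rewrite mulrA wt -scAl -mulrA wVt -scAr scalerA mulrA.
Qed.

(** The same scalar c arises when [w x] passes either factor from opposite sides, so tau^2 commutes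
    with E exactly. It is nonzero because tau, having nonzero trace, is not nilpotent. *)
Let parity_sq tau : parity tau -> inA tau -> tau != 0 ->
  exists2 kappa, tau * tau = kappa%:M & kappa != 0.
Proof.
move=> parT tA t0; have [kappa def_kappa] : exists a, tau * tau = a%:M.
  apply: scalarA => [|x Ex]; first exact: inAM.
  have [c eq_c] := parT x Ex.
  have c0 : c != 0.
    apply/eqP=> c0; have /eqP := parity_p Ex t0 eq_c.
    by rewrite c0 expr0n (gtn_eqF p_gt0) eq_sym oner_eq0.
  have wt : w x * tau = c *: (tau * wV x).
    by rewrite scAl -eq_c -[RHS]mulrA wVr // mulr1.
  have tw : tau * w x = c *: (wV x * tau).
    by rewrite scAr -eq_c !mulrA wVl // mul1r.
  rewrite sw // -scAl -scAr; congr (_ *: _).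
  by rewrite mulrA wt -scAl -[RHS]mulrA tw -scAr mulrA.
exists kappa => //; apply: contraTneq (parity_trace_neq0 parT tA t0) => k0.
have -> : \tr tau = 0.
  by apply: (@nilpotent_trace _ _ _ 2); rewrite expr2 def_kappa k0 raddf0.
by rewrite eqxx.
Qed.

(** The conjugate tau' of tau by g is again a parity operator, so tau tau' commutes with E up to
    scalars and is a multiple of some [w v]. Comparing the equal traces of tau and tau' shows that b
    is a p-th root of unity. *)
Let parity_conj tau g : parity tau -> inA tau -> tau != 0 -> g \in T ->
  exists v b, [/\ v \in E, b ^+ p = 1 & sigma g * tau = b *: (tau * w v * sigma g)].
Proof.
move=> parT tA t0 Tg; pose tau' := sigma g * tau * sigma g^-1%g.
have tE : tau = sigma g^-1%g * tau' * sigma g.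
  by rewrite /tau' !mulrA sVl // mul1r -mulrA sVl // mulr1.
have t0' : tau' != 0.
  by apply: contraNneq t0 => t'0; rewrite tE t'0 mulr0 mul0r.
have conjA M : inA M -> inA (sigma g * M * sigma g^-1%g).
  case/envelop_mxP=> a ->; rewrite mulr_sumr mulr_suml; apply: inA_sum => x Ex.
  rewrite -scAr -scAl; apply: inAZ; have Tx := TE Ex; rewrite -!sM ?groupM ?groupV //.
  apply: inA_s; have := memJ_norm x (subsetP nET _ (groupVr Tg)).
  by rewrite conjgE invgK mulgA => ->.
have tA' : inA tau' by apply: conjA.
have parT' : parity tau'.
  move=> x Ex; have Exg : (x ^ g)%g \in E by rewrite memJ_norm // (subsetP nET).
  have [c eq_c cp] := wJ Tg Ex; have [d eq_d] := parT _ Exg.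
  have c0 : c != 0.
    apply/eqP=> c0; move/eqP: cp.
    by rewrite c0 expr0n (gtn_eqF p_gt0) eq_sym oner_eq0.
  have eq_c' : sigma g^-1%g * w x = c *: (w (x ^ g)%g * sigma g^-1%g).
    have : sigma g^-1%g * (w x * sigma g) * sigma g^-1%g
       = c *: (sigma g^-1%g * (sigma g * w (x ^ g)%g) * sigma g^-1%g).
      by rewrite eq_c -scAr -scAl.
    rewrite !mulrA -[_ * sigma g * _]mulrA sV // mulr1 => ->.
    by rewrite sVl // mul1r.
  exists (c * c * d).
  transitivity ((w x * sigma g) * tau * (sigma g^-1%g * w x)).
    by rewrite /tau' !mulrA.
  rewrite eq_c eq_c' -scAr -!scAl.
  have -> : sigma g * w (x ^ g)%g * tau * (w (x ^ g)%g * sigma g^-1%g)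
      = sigma g * (w (x ^ g)%g * tau * w (x ^ g)%g) * sigma g^-1%g by rewrite !mulrA.
  by rewrite eq_d -scAr -scAl !scalerA.
pose Y := tau * tau'; have YA : inA Y by apply: inAM.
have [kappa def_k k0] := parity_sq parT tA t0.
have Y0 : Y != 0.
  apply/eqP=> Y0; have /eqP : tau * Y = 0 by rewrite Y0 mulr0.
  by rewrite /Y mulrA def_k [_ * _]mul_scalar_mx scaler_eq0 (negPf k0) (negPf t0').
have [u Eu trYu] := nondeg YA Y0.
have [a def_a] : exists a, Y * sigma u = a%:M.
  apply: scalarA => [|x Ex]; first by rewrite inAM // inA_s.
  have [c eq_c c0] := parity_unique parT parT' t0 t0' tA tA' Ex.
  have [d eq_d dp] := comm_scal Ex Eu.
  have eq_Yu : sigma x * (Y * sigma u) = (c * d) *: (Y * sigma u * sigma x).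
    have eq_sY : sigma x * Y = c *: (Y * sigma x).
      by rewrite sw // -scAl eq_c -scAr !scalerA mulrC.
    by rewrite [LHS]mulrA eq_sY -scAl -[Y * _ * _]mulrA eq_d -scAr scalerA mulrA.
  (* Conjugation by x multiplies [Y * sigma u] by c d but preserves its trace, which is nonzero. *)
  suff cd1 : c * d = 1 by rewrite eq_Yu cd1 scale1r.
  have Tx := TE Ex; apply: (mulIf trYu); rewrite mul1r -trZ.
  have -> : (c * d) *: (Y * sigma u) = sigma x * (Y * sigma u) * sigma x^-1%g.
    by rewrite eq_Yu -scAl -[_ * sigma x * _]mulrA sV // mulr1.
  by rewrite [LHS]trMC mulrA sVl // mul1r.
have Tu := TE Eu; have Eu' : (u^-1)%g \in E by rewrite groupV.
have eqY : Y = (a * eps u^-1%g) *: w u^-1%g.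
  rewrite -scalerA -sw // -mul_scalar_mx -def_a -[_ *m _]/(Y * sigma u * _).
  by rewrite -mulrA sV // mulr1.
pose b := kappa^-1 * (a * eps u^-1%g).
have eq_t' : tau' = b *: (tau * w u^-1%g).
  have : tau * Y = kappa *: tau'.
    by rewrite /Y mulrA def_k [_ * _]mul_scalar_mx.
  rewrite eqY -scAr => eq_kt; rewrite /b -scalerA eq_kt scalerA mulVf // scale1r.
  by [].
exists u^-1%g, b; split=> //; last first.
  by rewrite scAl -eq_t' /tau' -[RHS]mulrA sVl // mulr1.
have [d eq_d dp] := parity_trace parT t0 Eu'.
have trt : \tr tau' = \tr tau by rewrite [LHS]trMC mulrA sVl // mul1r.
have bd1 : b * d = 1.
  apply: (mulIf (parity_trace_neq0 parT tA t0)).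
  by rewrite mul1r -mulrA -eq_d -trZ -eq_t'.
have /eqP : (b * d) ^+ p = 1 by rewrite bd1 expr1n.
by rewrite exprMn dp mulr1 => /eqP.
Qed.

Let two_neq0 : 2%:R != 0 :> k.
Proof.
rewrite -(dvdn_pcharf (ms_pchar Omod)) dvdn_prime2 //.
by apply: contraTneq p_odd => ->.
Qed.

(* Modulo the maximal ideal E acts by scalars, so a parity operator tau becomes
   central, hence scalar; as tau^2 is a scalar, tau then commutes with E. *)
Lemma heisenberg_scalar x : x \in E -> x \in Z.
Proof.
move=> Ex; apply/negPn/negP=> nZx.
have [tau [t0 tA parT]] := parity_exists (ex_intro2 _ _ x Ex nZx).
have [c0 c0_neq0 [tau0 def_t0 redt0]] := matrix_normalize Omod t0.
pose t := map_mx iota tau0.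
have tE : t = c0 *: tau by [].
have tn0 : t != 0 by rewrite tE scaler_eq0 negb_or c0_neq0.
have parT' : parity t.
  move=> y Ey; have [c eq_c] := parT y Ey; exists c.
  by rewrite tE -scAr -scAl eq_c !scalerA mulrC.
have tA' : inA t by rewrite tE; apply: inAZ.
have [kappa def_k k0] := parity_sq parT' tA' tn0.
have [a def_a] : exists a, map_mx red tau0 = a%:M.
  apply: (rspan_cent_scalar spk) => g Tg.
  have [v [b [Ev bp eq_gt]]] := parity_conj parT' tA' tn0 Tg.
  have [b0 def_b b01] := unity_lift bp.
  have eqO : rO g * tau0 = b0 *: (tau0 * wO v * rO g).
    by apply: map_inj; rewrite map_mxZ !rmorphM /= wOE // def_b -eq_gt.
  have := congr1 (map_mx red) eqO.
  by rewrite map_mxZ !rmorphM /= b01 scale1r heis_reduction // mulr1 => /esym.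
have a0 : a != 0 by apply: contraNneq redt0 => a0; rewrite def_a a0 raddf0.
(* D anticommutes with t because t^2 is a scalar. Scaled to have nonzero reduction, it would satisfy
   2 a D = 0 over k. *)
pose D := t * w x - w x * t.
have tD : t * D + D * t = 0.
  rewrite /D mulrBr mulrBl !mulrA addrA subrK -!mulrA [t * t]def_k mulrA def_k.
  by rewrite -[_ * _ - _]/(_ *m _ - _ *m _) scalar_mxC subrr.
have D0 : D = 0.
  apply/eqP/negPn/negP=> Dn0.
  have [c1 c1n0 [D1 def_D1 redD1]] := matrix_normalize Omod Dn0.
  have : tau0 * D1 + D1 * tau0 = 0.
    apply: map_inj; rewrite rmorphD !rmorphM /= def_D1 -/t -scAr -scAl -scalerDr tD.
    by rewrite scaler0 rmorph0.
  move/(congr1 (map_mx red)); rewrite rmorphD !rmorphM rmorph0 /= def_a.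
  have -> : a%:M * map_mx red D1 = a *: map_mx red D1 by apply: mul_scalar_mx.
  have -> : map_mx red D1 * a%:M = a *: map_mx red D1 by apply: mul_mx_scalar.
  rewrite -mulr2n -scaler_nat => /eqP.
  by rewrite !scaler_eq0 (negPf two_neq0) (negPf a0) (negPf redD1).
have [c eq_c] := parT' x Ex.
have eq_tw : t * w x = w x * t by apply/eqP; rewrite -subr_eq0 -/D D0.
have w2 : w x * w x = c%:M.
  have tK : kappa^-1 *: t * t = 1.
    by rewrite -scAl def_k scale_scalar_mx mulVf.
  rewrite -[w x * w x]mul1r -tK -mulrA.
  have -> : t * (w x * w x) = c *: t by rewrite mulrA eq_tw eq_c.
  by rewrite -scAr tK scalemx1.
case/negP: nZx; rewrite scalZ // sw //.
(* As p + 1 is even, [w x] = ([w x])^(p+1) is a power of its scalar square. *)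
have -> : w x = (c ^+ p.+1./2)%:M.
  rewrite -[w x]mul1r -(wp Ex) -exprSr -[p.+1 in LHS]odd_double_half /= p_odd add0n.
  by rewrite -muln2 mulnC exprM expr2 w2 -rmorphXn.
by rewrite scale_scalar_mx scalar_mx_is_scalar.
Qed.

End Heisenberg.
End ModSystem.

(** * Monomial characters of p-power degree *)

Lemma mul_delta_delta (R : comNzRingType) m n (M : 'M[R]_(m, n)) k l
    (a : 'I_k) (b : 'I_m) (c : 'I_n) (d : 'I_l) :
  delta_mx a b *m M *m delta_mx c d = M b c *: delta_mx a d.
Proof.
apply/matrixP=> u v; rewrite -[_ *m delta_mx c d]mulmx1 mul_delta_mxE.
have -> : (delta_mx a b *m M) u c = (1%:M *m delta_mx a b *m M) u c by rewrite mul1mx.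
rewrite mul_delta_mxE !mxE mulrAC -natrM mulnb mulrC.
by rewrite [d == v]eq_sym.
Qed.

Section HomogeneousLift.

Variables (F : fieldType) (gT : finGroupType) (N : {group gT}) (m n : nat).
Variables (tau : mx_representation F N m) (sigma : mx_representation F N n).
Hypotheses (char0 : [pchar F] =i pred0) (spN : rspan tau) (m_gt0 : (0 < m)%N)
  (n_gt0 : (0 < n)%N) (lift1 : rlift tau sigma 1%:M = 1%:M).

Local Notation lift := (rlift tau sigma).

Lemma rlift_sigma x : x \in N -> lift (tau x) = sigma x.
Proof. by move=> Nx; rewrite rlift_rep // lift1 mulmx1. Qed.

Lemma rlift_scalar c : lift c%:M = c%:M.
Proof. by rewrite -scalemx1 rliftZ lift1 scalemx1. Qed.

(** The full matrix ring is simple: a nonzero entry of M yields every diagonal matrix unit, and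
    these add up to 1, whose lift is not 0. *)
Lemma rlift_inj0 M : lift M = 0 -> M = 0.
Proof.
move=> M0; apply/matrixP=> i j; rewrite mxE; apply/eqP/negPn/negP=> Mij.
have delta0 u : lift (delta_mx u u) = 0.
  have -> : delta_mx u u = (M i j)^-1 *: (delta_mx u i *m M *m delta_mx j u).
    by rewrite mul_delta_delta scalerA mulVf // scale1r.
  by rewrite rliftZ !(rliftM char0 spN m_gt0) M0 mulmx0 mul0mx scaler0.
have : lift 1%:M = 0.
  by rewrite mx1_sum_delta rlift_sum big1 // => u _; apply: delta0.
rewrite lift1 -[0](raddf0 (@scalar_mx F n)) => /(scalar_mx_inj n_gt0)/eqP.
by rewrite oner_eq0.
Qed.

Lemma rlift_inj : injective lift.
Proof.
move=> A B eqAB; apply/eqP; rewrite -subr_eq0; apply/eqP; apply: rlift_inj0.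
by rewrite rliftD -scaleN1r rliftZ eqAB scaleN1r subrr.
Qed.

Lemma lift_scalar_sigma x : x \in N -> is_scalar_mx (sigma x) = is_scalar_mx (tau x).
Proof.
move=> Nx; apply/is_scalar_mxP/is_scalar_mxP=> -[c def_c]; exists c.
  by apply: rlift_inj; rewrite rlift_sigma // rlift_scalar.
by rewrite -rlift_sigma // def_c rlift_scalar.
Qed.

Lemma comm_lift_scalar :
  {in N &, forall x y, sigma x *m sigma y = sigma y *m sigma x} ->
  forall x, x \in N -> is_scalar_mx (sigma x).
Proof.
move=> comN x Nx; rewrite lift_scalar_sigma //; apply/is_scalar_mxP.
apply: (rspan_cent_scalar spN) => y Ny; apply: rlift_inj.
by rewrite !(rliftM char0 spN m_gt0) !rlift_sigma // comN.
Qed.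

(** The lifts of the m diagonal matrix units are idempotents with sum 1 and equal traces, hence
    equal ranks. *)
Lemma lift_degree : exists r, n = (m * r)%N.
Proof.
pose i0 := Ordinal m_gt0; exists (\rank (lift (delta_mx i0 i0))).
have trE i : \tr (lift (delta_mx i i)) = \tr (lift (delta_mx i0 i0)).
  rewrite -[delta_mx i i](mul_delta_mx i0) (rliftM char0 spN m_gt0) [LHS]mxtrace_mulC.
  by rewrite -(rliftM char0 spN m_gt0 sigma) mul_delta_mx.
have : n%:R = (m * \rank (lift (delta_mx i0 i0)))%:R :> F.
  rewrite -mxtrace1 -lift1 mx1_sum_delta rlift_sum raddf_sum /=.
  rewrite (eq_bigr _ (fun i _ => trE i)) sumr_const card_ord natrM mulr_natl.
  by rewrite mxtrace_idempotent // -(rliftM char0 spN m_gt0) mul_delta_mx.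
exact: pchar0_natr_inj.
Qed.

End HomogeneousLift.

Section ModSystem.

Variables (p : nat) (O : idomainType) (K k : fieldType).
Variables (iota : {rmorphism O -> K}) (red : {rmorphism O -> k}).
Hypotheses (p_pr : prime p) (Omod : modular_system p iota red).

Let iotaI := ms_frac_inj Omod.
Let char0 := ms_pchar0 Omod.

(** The form in which p-solvability of G enters; it is available for every subgroup T of G. *)
Definition normal_extensions (gT : finGroupType) (T : {group gT}) : Prop :=
  forall C : {group gT}, (C <| T)%g -> C \proper T ->
  exists D : {group gT}, [/\ (D <| T)%g, C \proper D
    & (p.-group (D / C) || p^'.-group (D / C))%g].

(* |E : Z| / m is an integral multiple of 1 by Schur's lemma on an O-form. *)
Lemma rspan_degree_p' (gT : finGroupType) (E Z : {group gT}) m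
    (tau : mx_representation K E m) :
  rspan tau -> (0 < m)%N -> Z \subset E ->
  (forall z, z \in Z -> is_scalar_mx (tau z)) -> p^'.-nat #|E : Z|%g ->
  ~~ (p %| m)%N.
Proof.
move=> sp m0 sZE scalZ p'EZ.
have [rO [_ [B uB rOE]]] := affords_lattice Omod (repr_char_affords tau).
pose i0 := Ordinal m0; pose rK := map_repr iota rO.
have spK : rspan rK.
  apply: (@rspan_conj _ _ _ _ rK tau (invmx B)) => //; first by rewrite unitmx_inv.
  by move=> x Ex; rewrite rOE // invmxK !mulmxA mulVmx // mul1mx mulmxKV.
(* Z acts by scalars, so f is constant on the cosets of Z. The sum of f over these cosets lies in O,
   and m times it is |E : Z|, a unit. *)
pose f x := (rO x *m delta_mx i0 i0 *m rO x^-1%g) i0 i0.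
have fZ x z : x \in E -> z \in Z -> f (x * z)%g = f x.
  move=> Ex Zz; have Ez := subsetP sZE z Zz; rewrite /f invMg !repr_mxM ?groupV //.
  have cz M : rO z *m M *m rO z^-1%g = M.
    apply: (map_iota_inj Omod); rewrite !map_mxM.
    have [c def_c] := is_scalar_mxP (scalZ z Zz).
    have rz : map_mx iota (rO z) = c%:M.
      by rewrite -[LHS]/(rK z) rOE // def_c mul_mx_scalar -scalemxAl mulmxV // scalemx1.
    have := repr_mxK rK Ez (map_mx iota M); rewrite /= /map_repr_mx rz => eqM.
    by rewrite -[in RHS]eqM mul_scalar_mx mul_mx_scalar.
  by rewrite -!mulmxA (mulmxA _ (rO z^-1%g)) (mulmxA (rO z)) (mulmxA (rO z)) cz !mulmxA.
have sumf : iota (\sum_(x in E) f x) = #|E|%:R / m%:R.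
  have := congr1 (fun M : 'M_m => M i0 i0) (rspan_Schur char0 spK m0 (delta_mx i0 i0)).
  rewrite summxE mxtrace_delta mxE !eqxx mulr1 mulr1n => <-.
  rewrite raddf_sum; apply: eq_bigr => x Ex.
  have -> : rK x *m delta_mx i0 i0 *m rK x^-1%g = map_mx iota (rO x *m delta_mx i0 i0 *m rO x^-1%g).
    by rewrite !map_mxM map_delta_mx.
  by rewrite mxE.
have eqO : (#|E : Z|%g%:R : O) = m%:R * \sum_(C in lcosets Z E) f (repr C).
  apply: iotaI; apply: (mulIf (natK_neq0 Omod (cardG_gt0 Z))).
  rewrite rmorph_nat -natrM mulnC Lagrange // rmorphM rmorph_nat -mulrA.
  have <- : iota (\sum_(x in E) f x)
      = iota (\sum_(C in lcosets Z E) f (repr C)) * #|Z|%:R.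
    by rewrite (sum_lcosets sZE fZ) raddfMn /= mulr_natr.
  by rewrite sumf mulrC divfK // (natK_neq0 Omod).
have : (#|E : Z|%g%:R : O) \is a GRing.unit.
  by apply: (natO_unit Omod); rewrite -p'natE.
rewrite eqO unitrM => /andP[+ _].
by rewrite (unit_red Omod) rmorph_nat -(dvdn_pcharf (ms_pchar Omod)).
Qed.

End ModSystem.

Lemma rspan_all_scalar (F : fieldType) (gT : finGroupType) (T : {group gT}) n
    (r : mx_representation F T n) :
  rspan r -> (forall x, x \in T -> is_scalar_mx (r x)) -> (n <= 1)%N.
Proof.
case: n r => [|[|n]] r sp scalT //.
have [a def_d] := sp (delta_mx 0 1).
have : is_scalar_mx (delta_mx 0 1 : 'M[F]_n.+2).
  rewrite def_d; apply: (big_ind (fun M => is_scalar_mx M)).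
  - by apply/is_scalar_mxP; exists 0; rewrite raddf0.
  - move=> A B /is_scalar_mxP[c ->] /is_scalar_mxP[d ->].
    by apply/is_scalar_mxP; exists (c + d); rewrite raddfD.
  - move=> x Tx; have /is_scalar_mxP[c ->] := scalT x Tx.
    by rewrite scale_scalar_mx scalar_mx_is_scalar.
case/is_scalar_mxP=> c /matrixP/(_ 0 1); rewrite !mxE !eqxx /= => /eqP.
by rewrite mulr0n oner_eq0.
Qed.

Lemma split_eigenvalue (F : fieldType) (gT : finGroupType) (T : {group gT}) n
    (r : mx_representation F T n) x :
  splitting_for_subgroups F T -> (0 < n)%N -> x \in T ->
  exists c, exists2 v : 'rV[F]_n, v != 0 & v *m r x = c *: v.
Proof.
move=> splitT n0 Tx; have sXT : <[x]>%g \subset T by rewrite cycle_subG.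
pose rX := subg_repr r sXT.
have [U simU] : exists U : 'M[F]_n, mxsimple rX U.
  apply: NNPP => noU.
  have := mxsimple_exists (mxmodule1 rX).
  rewrite -mxrank_eq0 mxrank1 -lt0n n0 => /(_ isT) exU.
  by suff: false by []; apply: exU => -[U simU _]; case: noU; exists U.
have rkU := mxsimple_abelian_linear (splitT _ sXT) (cycle_abelian x) simU.
pose v := nz_row U; have v0 : v != 0 := nz_row_mxsimple simU.
have sUv : (U <= v)%MS.
  have /mxrank_leqif_sup/leqifP := nz_row_sub U.
  by case: ifP => // _; rewrite rkU rank_rV v0.
have vU : (v *m r x <= v)%MS.
  apply: submx_trans sUv; have /mxmoduleP/(_ x (cycle_id x)) := mxsimple_module simU.
  by apply: submx_trans; rewrite submxMr ?nz_row_sub.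
by have /sub_rVP[c eq_c] := vU; exists c, v.
Qed.

Section ModSystem.

Variables (p : nat) (O : idomainType) (K k : fieldType).
Variables (iota : {rmorphism O -> K}) (red : {rmorphism O -> k}).
Hypotheses (p_pr : prime p) (Omod : modular_system p iota red).

Let char0 := ms_pchar0 Omod.

Section OneCharacter.

Variables (gT : finGroupType) (T : {group gT}) (n : nat) (psi : {ffun gT -> K}).
Variable rO : mx_representation O T n.+1.
Hypotheses (p_odd : odd p) (rO_psi : affords (map_repr iota rO) psi)
  (spk : rspan (map_repr red rO)) (splitT : splitting_for_subgroups K T)
  (extT : normal_extensions p T) (n_p : p.-nat n.+1).

Local Notation sigma := (map_repr iota rO).

Let spK : rspan sigma.
Proof. exact: (rspan_liftK Omod (rspan_lift Omod spk)). Qed.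

Lemma odd_imprimitive : (0 < n)%N -> imprimitive T psi.
Proof.
move=> n_gt0; apply: NNPP => prim.
have homog (N : {group gT}) (nNT : (N <| T)%g) := clifford_dichotomy char0 spK (ltn0Sn n) rO_psi nNT (splitT (normal_sub nNT)).
pose Z := rcenter_group sigma.
have nZT : (Z <| T)%g := rcenter_normal sigma.
have memZ x : x \in T -> (x \in Z) = is_scalar_mx (sigma x) by move=> Tx; rewrite inE Tx.
have sZT := normal_sub nZT.
(* If N acts by commuting operators, then so does the irreducible representation of which its action
   is a multiple; that one is scalar by Schur. *)
have comm_sub (N : {group gT}) : (N <| T)%g ->
    {in N &, forall x y, sigma x *m sigma y = sigma y *m sigma x} -> N \subset Z.
  move=> nNT comN; have [//|[m [tau [spN m0 lift1]]]] := homog N nNT.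
  apply/subsetP=> x Nx; rewrite memZ ?(subsetP (normal_sub nNT)) //.
  exact: (comm_lift_scalar char0 spN m0 (ltn0Sn n) lift1 comN).
have ltZT : Z \proper T.
  rewrite properE sZT; apply/negP=> sTZ.
  have scalT x : x \in T -> is_scalar_mx (sigma x).
    by move=> Tx; rewrite -memZ // (subsetP sTZ).
  by have := rspan_all_scalar spK scalT; rewrite ltnS leqn0 (gtn_eqF n_gt0).
(* A p'-section D/Z is impossible: the degree of the constituent on D would be prime to p and divide
   a power of p, so D would act by scalars. *)
have [D [nDT ltZD /orP[pD|p'D]]] := extT nZT ltZT; last first.
  have [//|[m [tau [spN m0 lift1]]]] := homog D nDT.
  have sZD := proper_sub ltZD.
  have p'm : ~~ (p %| m)%N.
    apply: (rspan_degree_p' p_pr Omod spN m0 sZD) => [z Zz|].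
      rewrite -(lift_scalar_sigma char0 spN m0 (ltn0Sn n) lift1) ?(subsetP sZD) //.
      by rewrite -memZ ?(subsetP sZT).
    by rewrite -card_quotient // (subset_trans (normal_sub nDT)) ?normal_norm.
  have m1 : m = 1%N.
    have [r eq_n] := lift_degree char0 spN m0 lift1.
    have : p.-nat m by apply: pnat_dvd n_p; rewrite eq_n dvdn_mulr.
    case/p_natP=> e def_m; move: p'm; rewrite def_m; case: e {def_m} => // e.
    by rewrite expnS dvdn_mulr.
  case/negP: (proper_subn ltZD); apply/subsetP=> x Dx.
  rewrite memZ ?(subsetP (normal_sub nDT)) //.
  rewrite (lift_scalar_sigma char0 spN m0 (ltn0Sn n) lift1) //.
  move: tau spN lift1; rewrite m1 => tau _ _; apply/is_scalar_mxP.
  by exists (tau x 0 0); apply: mx11_scalar.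
have D1 : (D / Z)%G :!=: 1%g.
  by rewrite -subG1 quotient_sub1 ?proper_subn // (subset_trans (normal_sub nDT)) ?normal_norm.
have nDTq : (T / Z)%g \subset 'N(D / Z)%g by rewrite normal_norm ?quotient_normal.
(* A minimal normal subgroup of T/Z inside the p-group D/Z is elementary abelian; E will be its
   preimage. *)
have [M minM sMD] := minnormal_exists D1 nDTq.
have [/andP[M1 nMT] _] := mingroupP minM.
have pM : (p.-group M)%g := pgroupS sMD pD.
have [_ _ abelM] := minnormal_solvable minM (subxx M) (pgroup_sol pM).
rewrite (is_abelem_pgroup pM) in abelM.
have [abM expM] := abelemP p_pr abelM.
have sMT : M \subset (T / Z)%g by rewrite (subset_trans sMD) ?quotientS ?normal_sub.
pose E := (coset Z @*^-1 M)%G.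
have nET : (E <| T)%g.
  by rewrite -(quotientGK nZT) cosetpre_normal /normal sMT nMT.
have sET := normal_sub nET.
have sZE : Z \subset E := normal_sub (normal_cosetpre M).
have nZ x : x \in E -> x \in 'N(Z)%g.
  by move=> Ex; rewrite (subsetP (normal_norm nZT)) ?(subsetP sET).
have cosM x : x \in E -> coset Z x \in M.
  by move=> Ex; rewrite -(cosetpreK M) mem_quotient.
have commE x y : x \in E -> y \in E -> [~ x, y]%g \in Z.
  move=> Ex Ey; apply: coset_idr; first by rewrite groupR ?nZ.
  rewrite morphR ?nZ //; apply/eqP/commgP.
  exact: (centsP abM) (cosM x Ex) _ (cosM y Ey).
have powE x : x \in E -> (x ^+ p)%g \in Z.
  move=> Ex; apply: coset_idr; first by rewrite groupX ?nZ.
  by rewrite morphX ?nZ // expM ?cosM.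
have nondegE u : u \in E -> u \notin Z ->
    exists2 x, x \in E & sigma x * sigma u != sigma u * sigma x.
  move=> Eu nZu; apply: NNPP => noE; case/negP: nZu.
  (* S is the kernel of the commutator form. It is normal in T and acts by commuting operators, so
     it lies in Z. *)
  pose S := [set z in E | [forall y in E, sigma z * sigma y == sigma y * sigma z]].
  have memS z : reflect (z \in E /\ forall y, y \in E -> sigma z * sigma y = sigma y * sigma z)
      (z \in S).
    rewrite /S in_set; apply: (iffP andP) => [[Ez /forall_inP cz] | [Ez cz]]; split=> //.
      by move=> y Ey; apply/eqP; apply: cz.
    by apply/forall_inP=> y Ey; apply/eqP; apply: cz.
  have sM x y : x \in T -> y \in T -> sigma (x * y)%g = sigma x * sigma y by apply: repr_mxM.
  have TE x : x \in E -> x \in T by apply: (subsetP sET).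
  have gS : group_set S.
    apply/group_setP; split=> [|x y /memS[Ex cx] /memS[Ey cy]]; apply/memS; split.
    - exact: group1.
    - by move=> y _; have -> : sigma 1%g = 1 by [exact: repr_mx1]; rewrite mul1r mulr1.
    - exact: groupM.
    - move=> z Ez; have [Tx Ty] := (TE x Ex, TE y Ey).
      by rewrite sM // -mulrA cy // mulrA cx // mulrA.
  have nST : (Group gS <| T)%g.
    apply/andP; split; first by apply/subsetP=> x /memS[/TE].
    apply/subsetP=> g Tg; rewrite inE; apply/subsetP=> _ /imsetP[x /memS[Ex cx] ->].
    have EJ h y : h \in T -> y \in E -> (y ^ h)%g \in E.
      by move=> Th Ey; rewrite memJ_norm // (subsetP (normal_norm nET)).
    apply/memS; split=> [|y Ey]; first exact: EJ.
    have [Tx Ty] := (TE x Ex, TE y Ey).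
    have Ey' := EJ _ _ (groupVr Tg) Ey; have Ty' := TE _ Ey'.
    have sJ z : z \in T -> sigma (z ^ g)%g = sigma g^-1%g * sigma z * sigma g.
      by move=> Tz; rewrite conjgE mulgA !sM ?groupM ?groupV.
    rewrite -(conjgKV g y) -!sM ?groupJ ?groupV // -!conjMg !sJ ?groupM ?groupJ ?groupV //.
    by congr (_ * _ * _); rewrite (sM _ _ Tx Ty') (sM _ _ Ty' Tx) cx.
  have sSZ : Group gS \subset Z.
    by apply: (comm_sub (Group gS)) nST _ => x y /memS[_ cx] /memS[Ey _]; apply: cx.
  apply: (subsetP sSZ); apply/memS; split=> // y Ey.
  by apply/eqP/negPn/negP=> ne; case: noE; exists y; rewrite // eq_sym.
have eigE x : x \in E ->
    exists2 c : K, c ^+ #|T| = 1 & sigma x ^+ p = (c ^+ p)%:M.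
  move=> Ex; have Tx := subsetP sET x Ex.
  (* Any eigenvalue c of x serves: it is a |T|-th root of unity, and c^p is an eigenvalue of the
     scalar operator of x^p. *)
  have [c [v v0 eq_c]] := split_eigenvalue sigma splitT (ltn0Sn n) Tx.
  have vX m : v *m sigma x ^+ m = c ^+ m *: v.
    elim: m => [|m IHm]; first by rewrite !expr0 scale1r mulmx1.
    by rewrite exprS mulmxA eq_c -scalemxAl IHm scalerA exprS.
  have vI (a b : K) : a *: v = b *: v -> a = b.
    move/eqP; rewrite -subr_eq0 -scalerBl scaler_eq0 (negPf v0) orbF subr_eq0.
    by move/eqP.
  exists c.
    apply: vI; rewrite -vX -repr_mxX // scale1r.
    by rewrite expg_cardG // [sigma 1%g]repr_mx1 mulmx1.
  have := powE x Ex; rewrite memZ ?groupX // => /is_scalar_mxP[d def_d].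
  have def_d' : sigma x ^+ p = d%:M by rewrite -repr_mxX.
  rewrite def_d'; congr _%:M; apply: vI.
  by rewrite -vX def_d' mul_mx_scalar.
have sEZ : E \subset Z.
  apply/subsetP=> x Ex.
  apply: (heisenberg_scalar p_pr Omod p_odd spk sET (normal_norm nET) sZE) Ex => //.
  by move=> y Ey; rewrite memZ ?(subsetP sET).
case/eqP: M1; apply/trivgP; rewrite -(cosetpreK M) quotient_sub1 //.
by apply/subsetP=> x /nZ.
Qed.

End OneCharacter.
End ModSystem.

(** * Normal p- and p'-sections of subgroups of a p-solvable group *)

Section PSolvable.

Variables (p : nat) (gT : finGroupType).
Implicit Types A B C G T : {group gT}.

Lemma pcore_normal_neq1 (rT : finGroupType) pi (X Y : {group rT}) :
  (X <| Y)%g -> 'O_pi(X)%g != 1%g -> 'O_pi(Y)%g != 1%g.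
Proof.
move=> nXY; apply: contraNneq => Y1; rewrite -subG1 -Y1.
apply: pcore_max (pcore_pgroup _ _) _.
exact: gFnormal_trans nXY.
Qed.

(** Climb the series. At the first term B whose intersection with T is not inside C, the image of
    the intersection in T/C is a p-group or a p'-group. From then on a nontrivial core persists,
    because the core of a normal subgroup lies in the core of the group. Cores are needed as the
    terms of the series are only subnormal. *)
Lemma normal_extensions_p_solvable G T :
  p_solvable p G -> T \subset G -> normal_extensions p T.
Proof.
move=> [s path_s last_s] sTG C nCT ltCT.
pose P A := ((T :&: A) / C)%g = 1%g \/
  exists2 pi : nat_pred, (pi = p \/ pi = p^')
     & 'O_pi((T :&: A) / C)%g != 1%g.
have nCTA A : (T :&: A)%g \subset 'N(C)%g.
  by rewrite subIset // (normal_norm nCT).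
have stepP A B : (A <| B)%g && (p.-group (B / A) || p^'.-group (B / A))%g -> P A -> P B.
  case/andP=> nAB piBA PA.
  have [sAB nABn] := andP nAB.
  have nTAB : (T :&: A <| T :&: B)%g.
    have := normalGI (subsetIr T B) nAB; rewrite -setIA.
    by have /setIidPr -> := sAB.
  case: PA => [A1 | [pi pip piA]]; last first.
    right; exists pi => //; apply: pcore_normal_neq1 piA; exact: quotient_normal.
  have [|B1] := eqVneq ((T :&: B) / C)%g 1%g; first by left.
  have sTAC : (T :&: A)%g \subset C by rewrite -quotient_sub1 // A1.
  have dvdBC : (#|((T :&: B) / C)%g| %| #|((T :&: B) / A)%g|)%N.
    rewrite !card_quotient //; last by rewrite subIset // nABn orbT.
    rewrite -indexgI -[X in (_ %| X)%N]indexgI; apply: indexgS.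
    rewrite subsetI subsetIl /=; apply: subset_trans sTAC.
    by rewrite -setIA setIS // subsetIr.
  have piC (pi : nat_pred) : (pi.-group (B / A) -> pi.-group ((T :&: B) / C))%g.
    move=> piB; rewrite /pgroup; apply: (pnat_dvd dvdBC).
    by apply: pgroupS piB; rewrite quotientS ?subsetIr.
  right; case/orP: piBA => /piC piTB; [exists (p : nat_pred) | exists p^']; auto.
    by rewrite pcore_pgroup_id.
  by rewrite pcore_pgroup_id.
have PG : P G.
  have P1 : P 1%G.
    left; apply/trivgP; rewrite (quotient_sub1 (nCTA 1%G)).
    by rewrite (subset_trans (subsetIr _ _)) ?sub1G.
  suff: P (last 1%G s) by rewrite last_s.
  elim: s 1%G P1 path_s {last_s} => //= B s IHs A PA /andP[AB path_s].
  exact: IHs (stepP A B AB PA) path_s.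
have eqT : (T :&: G)%g = T by apply/setIidPl.
have {PG}[T1 | [pi pip piT]] : (T / C)%g = 1%g \/ exists2 pi : nat_pred,
    (pi = p \/ pi = p^') & 'O_pi(T / C)%g != 1%g by move: PG; rewrite /P eqT.
  by case/andP: ltCT => _ /negP[]; rewrite -quotient_sub1 ?T1 // (normal_norm nCT).
exists (coset C @*^-1 'O_pi(T / C))%G; split.
- by rewrite -(quotientGK nCT) cosetpre_normal pcore_normal.
- rewrite properE (normal_sub (normal_cosetpre _)) /=; apply: contra piT.
  rewrite -quotient_sub1 ?cosetpreK ?subG1 //.
  by apply: subset_trans (subsetIl _ _) _; apply: subxx.
- rewrite /= cosetpreK; apply/orP.
  by case: pip (pcore_pgroup pi (T / C)%g) => ->; [left | right].
Qed.

End PSolvable.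

Lemma char_Ind_trans (F : fieldType) (gT : finGroupType) (H L T : {group gT})
    (theta : {ffun gT -> F}) :
  [pchar F] =i pred0 -> H \subset L -> L \subset T ->
  (forall x, x \notin H -> theta x = 0) ->
  char_Ind L T (char_Ind H L theta) = char_Ind H T theta.
Proof.
move=> char0 sHL sLT out; apply/ffunP=> x; rewrite !ffunE; case: ifP => // Tx.
have L0 : #|L|%:R != 0 :> F by rewrite (pcharf0P F).1 // -lt0n.
have indE y : char_Ind H L theta y = #|H|%:R^-1 * \sum_(z in L) theta (y ^ z)%g.
  rewrite ffunE; case: ifPn => // nLy; rewrite big1 ?mulr0 // => z Lz.
  apply: out; apply: contra nLy => Hyz; have := subsetP sHL _ Hyz.
  by rewrite memJ_norm // (subsetP (normG L)).
under eq_bigr do rewrite indE.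
rewrite -mulr_sumr exchange_big /= mulrCA; congr (_ * _).
rewrite (eq_bigr (fun=> \sum_(y in T) theta (x ^ y)%g)) => [|z Lz].
  by rewrite sumr_const -[X in _ * X]mulr_natl mulKf.
have Tz := subsetP sLT z Lz.
rewrite [RHS](reindex_inj (mulIg z)) /=; apply: eq_big => y; first by rewrite groupMr.
by rewrite conjgM.
Qed.

Lemma char_Ind_id (F : fieldType) (gT : finGroupType) (T : {group gT}) n
    (r : mx_representation F T n) psi :
  [pchar F] =i pred0 -> affords r psi -> char_Ind T T psi = psi.
Proof.
move=> char0 r_psi; apply/ffunP=> x; rewrite ffunE; have [_ out] := r_psi.
case: ifPn => Tx; last by rewrite out.
rewrite (eq_bigr (fun=> psi x)) => [|y Ty]; last exact: affordsJ r_psi Ty.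
by rewrite sumr_const -[X in _ * X]mulr_natl mulKf // (pcharf0P F).1 // -lt0n.
Qed.

Lemma affords1 (F : fieldType) (gT : finGroupType) (H : {group gT}) n
    (r : mx_representation F H n) theta : affords r theta -> theta 1%g = n%:R.
Proof. by case=> trr _; rewrite -trr // repr_mx1 mxtrace1. Qed.

Section ModSystem.

Variables (p : nat) (O : idomainType) (K k : fieldType).
Variables (iota : {rmorphism O -> K}) (red : {rmorphism O -> k}).
Hypotheses (p_pr : prime p) (Omod : modular_system p iota red).

Let char0 := ms_pchar0 Omod.

Lemma affords_degree (gT : finGroupType) (T : {group gT}) n n'
    (r : mx_representation K T n) (r' : mx_representation K T n') psi :
  affords r psi -> affords r' psi -> n = n'.
Proof.
move=> r_psi r'_psi; apply: (natK_inj Omod).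
by rewrite -(affords1 r_psi) (affords1 r'_psi).
Qed.

(** Induction on |T|: an inducing character of a proper subgroup inherits modular irreducibility,
    and its degree divides that of psi. *)
Lemma odd_monomial (gT : finGroupType) (G T : {group gT}) n
    (r : mx_representation K T n) psi :
  odd p -> p_solvable p G -> splitting_for_subgroups K G -> T \subset G ->
  affords r psi -> modular_irr iota red T psi -> p.-nat n ->
  exists (T1 : {group gT}) (r1 : mx_representation K T1 1),
    T1 \subset T /\ psi = char_Ind T1 T (repr_char r1).
Proof.
move=> p_odd psolG splitG; have [l leTl] := ubnP #|T|.
elim: l => // l IHl in T n r psi leTl *; move=> sTG r_psi modT n_p.
have [rO [rO_psi _]] := affords_lattice Omod r_psi.
have spk := modT _ _ rO_psi.
case: n n_p r r_psi rO rO_psi spk => [//|n] n_p r r_psi rO rO_psi spk.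
have [n0|n_gt0] := posnP n.
  move: r r_psi; rewrite n0 => r r_psi; exists T, r; split=> //.
  by rewrite -(affords_eq r_psi) (char_Ind_id char0 r_psi).
have splitT : splitting_for_subgroups K T.
  by move=> H sHT; apply: splitG; apply: subset_trans sTG.
have [T1 [m [r1 [ltT1 def_psi]]]] := odd_imprimitive p_pr Omod p_odd rO_psi spk splitT
  (normal_extensions_p_solvable psolG sTG) n_p n_gt0.
have sT1 := proper_sub ltT1; have r1_psi := repr_char_affords r1.
have m_p : p.-nat m.
  apply: pnat_dvd n_p.
  have ind_psi := ind_affords sT1 char0 r1_psi; rewrite -def_psi in ind_psi.
  by rewrite (affords_degree r_psi ind_psi) card_prod card_ord dvdn_mull.
have [||||T2 [r2 [sT2 def_psi1]]] := IHl T1 m r1 (repr_char r1) _ _ _ _ m_p.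
- exact: leq_trans (proper_card ltT1) _.
- exact: subset_trans sT1 sTG.
- exact: r1_psi.
- by apply: (modular_irr_Ind Omod sT1); rewrite -def_psi.
exists T2, r2; split; first exact: subset_trans sT1.
rewrite def_psi def_psi1 char_Ind_trans //.
by move=> x nT2x; rewrite ffunE (negPf nT2x).
Qed.

End ModSystem.

(** * Special characters *)

(** Modulo the kernel D becomes a normal p-subgroup, and such a subgroup acts trivially on an
    irreducible module in characteristic p. *)
Lemma pgroup_rker (F : fieldType) p (gT : finGroupType) (G D : {group gT}) n
    (rG : mx_representation F G n) :
  p \in [pchar F] -> mx_irreducible rG -> (D <| G)%g ->
  (forall x, x \in D -> (p^'.-elt x)%g -> rG x = 1%:M) -> D \subset rker rG.
Proof.
move=> pcharF irrG nDG p'D; set L := rker_group rG.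
have [sDG nD] := andP nDG.
have nLG : G \subset 'N(L)%g by apply: rker_norm.
have nLD := subset_trans sDG nLG.
have pDL : (p.-group (D / L))%g.
  apply/pgroupP=> q q_pr qDL; apply/negPn/negP=> nqp.
  have [y DLy oy] := Cauchy q_pr qDL.
  have [x Nx Dx def_y] := morphimP DLy.
  have p'y : (p^'.-elt y)%g by rewrite /p_elt oy pnatE.
  have y1 : y = 1%g.
    rewrite -(constt_p_elt p'y) def_y -morph_constt //.
    apply: coset_id; apply/rkerP.
    have Dx' : (x.`_p^')%g \in D by rewrite groupX.
    by split; [apply: (subsetP sDG) | apply: p'D (p_elt_constt _ _)].
  by move: q_pr; rewrite -oy y1 order1.
have pcore1 : 'O_p(G / L)%g \subset [set 1%g].
  apply: subset_trans (kquo_mx_faithful rG).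
  exact/(pcore_sub_rker_mx_irr_pchar pcharF)/quo_mx_irr.
rewrite -quotient_sub1 //; apply: subset_trans pcore1.
exact: pcore_max pDL (quotient_normal _ nDG).
Qed.

Lemma expr_coprime_eq1 (F : fieldType) (z : F) a b :
  (0 < a)%N -> coprime a b -> z ^+ a = 1 -> z ^+ b = 1 -> z = 1.
Proof.
move=> a0 /eqP co za zb; have [c _ /dvdnP[d]] := Bezoutl b a0.
rewrite co => eqd; have := congr1 (fun i => z ^+ i) eqd.
by rewrite /= exprD expr1 mulnC exprM zb expr1n mulr1 mulnC exprM za expr1n.
Qed.

Lemma sum_linear (F : fieldType) (gT : finGroupType) (C : {group gT}) (f : gT -> F) :
  {in C &, forall x y, f (x * y)%g = f x * f y} ->
  \sum_(x in C) f x = #|C|%:R * [forall x in C, f x == 1]%:R.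
Proof.
move=> fM; have [/forall_inP f1 | /forall_inPn[y Cy fy]] := boolP [forall x in C, f x == 1].
  rewrite mulr1 (eq_bigr (fun=> 1)) => [|x Cx]; last exact/eqP/f1.
  by rewrite sumr_const.
rewrite mulr0; apply: contraNeq fy => s0.
apply/eqP/(mulIf s0); rewrite mul1r mulr_sumr [RHS](reindex_inj (mulgI y)) /=.
by apply: eq_big => x; [rewrite groupMl | move=> Cx; rewrite fM].
Qed.

Section ModSystem.

Variables (p : nat) (O : idomainType) (K k : fieldType).
Variables (iota : {rmorphism O -> K}) (red : {rmorphism O -> k}).
Hypotheses (p_pr : prime p) (Omod : modular_system p iota red).

Let iotaI := ms_frac_inj Omod.
Let char0 := ms_pchar0 Omod.

Lemma ind_p_section (gT : finGroupType) (T G C D : {group gT}) m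
    (lO : mx_representation O T m) (sTG : T \subset G) :
  (0 < m)%N -> rspan (map_repr red (ind_repr lO sTG)) ->
  (C <| G)%g -> C \subset T -> (D <| G)%g -> C \subset D -> (p.-group (D / C))%g ->
  (forall x, x \in C -> (p^'.-elt x)%g -> lO x = 1%:M) -> D \subset T.
Proof.
move=> m_gt0 spk nCG sCT nDG sCD pDC p'C; set rk := map_repr red _ in spk.
have n_gt0 : (0 < #|ind_index T G m|)%N.
  by apply/card_gt0P; exists (coset1 T G, Ordinal m_gt0).
have irr_rk := mx_abs_irrW (rspan_abs_irr n_gt0 spk).
have sDG := normal_sub nDG.
have p'D x : x \in D -> (p^'.-elt x)%g -> rk x = 1%:M.
  move=> Dx p'x; have Gx := subsetP sDG x Dx.
  (* D/C is a p-group, so a p'-element of D lies in C, as do its conjugates, which give its action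
     on the blocks. *)
  have Cx : x \in C.
    have nCx : x \in 'N(C)%g by apply: subsetP (normal_norm nCG) _ Gx.
    apply/coset_idr => //; apply/eqP; rewrite -order_eq1.
    apply/eqP; apply: pnat_1; first exact: mem_p_elt pDC (mem_quotient _ Dx).
    exact: morph_p_elt.
  rewrite /rk map_ind_repr -[RHS](repr_mx1 (ind_repr (map_repr red lO) sTG)).
  apply: eq_fmx => -[A i] [B j] /=; rewrite /ext0_repr mulg1.
  have Cc : (x ^ (crep A)^-1)%g \in C.
    by rewrite memJ_norm // groupV (subsetP (normal_norm nCG)) ?(crepG sTG).
  have -> : (crep A * x * (crep B)^-1 = x ^ (crep A)^-1 * (crep A * (crep B)^-1))%g.
    by rewrite conjgE invgK -!mulgA mulKg.
  have Tc := subsetP sCT _ Cc; rewrite groupMl //; case: ifP => // TAB.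
  have rc1 : map_repr red lO (x ^ (crep A)^-1)%g = 1%:M.
    by rewrite /= /map_repr_mx (p'C _ Cc) ?p_eltJ // map_mx1.
  by rewrite (repr_mxM (map_repr red lO) Tc TAB) rc1 mul1mx.
have sDL := pgroup_rker (ms_pchar Omod) irr_rk nDG p'D.
apply/subsetP=> x Dx; have [Gx rx1] := rkerP (subsetP sDL x Dx).
apply: contraT => nTx.
(* The block of x at the trivial coset equals that of the identity, but is 0 when x is outside T. *)
have := ind_block_repr (map_repr red lO) sTG x; rewrite -map_ind_repr -/rk rx1.
rewrite -(repr_mx1 (ind_repr (map_repr red lO) sTG)) ind_block_repr.
rewrite /ext0_repr (negPf nTx) group1 repr_mx1 => /matrixP/(_ (Ordinal m_gt0) (Ordinal m_gt0)).
by rewrite !mxE eqxx => /eqP; rewrite oner_eq0.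
Qed.

(** On the normal subgroup C the induced character is a sum of conjugates of [r], and the inner
    product counts those that agree with [r] on C, among them the one at the trivial coset. This
    makes the determinant condition on a special character applicable to [r] itself. *)
Lemma linear_constituent (gT : finGroupType) (T G C : {group gT})
    (r : mx_representation K T 1) (sCT : C \subset T) :
  T \subset G -> (C <| G)%g ->
  is_constituent C (repr_char (subg_repr r sCT))
    (char_Res C (char_Ind T G (repr_char r))).
Proof.
move=> sTG nCG; split.
  exists 1%N, (subg_repr r sCT) => //.
  exact/mx_abs_irrW/linear_mx_abs_irr.
pose f (x : gT) := r x 0 0.
have trf x : \tr (r x) = f x by rewrite /mxtrace big_ord1.
have fM : {in T &, forall x y, f (x * y)%g = f x * f y}.
  by move=> x y Tx Ty; rewrite /f repr_mxM // mxE big_ord1.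
have f1 : f 1%g = 1 by rewrite /f repr_mx1 mxE.
have CJ x (A : rcoset_index T G) : x \in C -> (crep A * x * (crep A)^-1)%g \in C.
  move=> Cx; have := memJ_norm x (subsetP (normal_norm nCG) _ (groupVr (crepG sTG A))).
  by rewrite conjgE invgK mulgA Cx.
pose g (A : rcoset_index T G) x := f (crep A * x * (crep A)^-1)%g * f (x^-1)%g.
have gM A : {in C &, forall x y, g A (x * y)%g = g A x * g A y}.
  move=> x y Cx Cy; have [Tx Ty] := (subsetP sCT x Cx, subsetP sCT y Cy).
  rewrite /g; have -> : (crep A * (x * y) * (crep A)^-1 =
      (crep A * x * (crep A)^-1) * (crep A * y * (crep A)^-1))%g.
    by rewrite -!mulgA mulKg.
  have [Tu Tv] := (subsetP sCT _ (CJ x A Cx), subsetP sCT _ (CJ y A Cy)).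
  rewrite invMg (fM _ _ Tu Tv) (fM _ _ (groupVr Ty) (groupVr Tx)).
  by rewrite [RHS]mulrACA [f x^-1%g * _]mulrC.
have C0 : #|C|%:R != 0 :> K by rewrite (pcharf0P K).1 // -lt0n.
rewrite /is_constituent (_ : char_dot _ _ _ = \sum_A #|C|%:R^-1 * \sum_(x in C) g A x); last first.
  rewrite -mulr_sumr exchange_big; congr (_ * _); apply: eq_bigr => x Cx.
  have Gx := subsetP (normal_sub nCG) x Cx.
  rewrite [char_Res _ _ _]ffunE Cx (char_Ind_rcoset char0 sTG (repr_char_affords r) Gx).
  rewrite mulr_suml; apply: eq_bigr => A _.
  by rewrite !ffunE groupV Cx (subsetP sCT _ (CJ _ A Cx)) /= !trf.
under eq_bigr => A _ do rewrite (sum_linear (gM A)) mulKf //.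
rewrite -natr_sum (pcharf0P K).1 // -lt0n (bigD1 (coset1 T G)) //=.
rewrite addn_gt0 (_ : [forall x in C, _]) //; apply/forall_inP=> x Cx.
have Tx := subsetP sCT x Cx.
by rewrite /g crep1 mul1g invg1 mulg1 -fM ?groupV // mulgV f1.
Qed.

Lemma special_linear (gT : finGroupType) (G T : {group gT}) beta :
  odd p -> p_solvable p G -> splitting_for_subgroups K G -> T \subset G ->
  Defs.special p T beta -> modular_irr iota red T beta -> beta 1%g = 1.
Proof.
move=> p_odd psolG splitG sTG [[n [r irr_r def_beta]] [n0 n0_p beta1] spec] modT.
have r_beta : affords r beta by rewrite def_beta; apply: repr_char_affords.
have def_n0 : n = n0 by apply: (natK_inj Omod); rewrite -beta1 (affords1 r_beta).
rewrite -{}def_n0 in n0_p beta1.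
have [S [l [sST def_ind]]] :=
  odd_monomial p_pr Omod p_odd psolG splitG sTG r_beta modT n0_p.
have ind_beta := ind_affords sST char0 (repr_char_affords l).
rewrite -def_ind in ind_beta.
have def_n : n = #|T : S|%g.
  by rewrite (affords_degree Omod r_beta ind_beta) card_prod card_ord muln1 card_rcoset_index.
suff sTS : T \subset S by rewrite beta1 def_n (eqP (_ : #|T : S|%g == 1%N)) ?indexg_eq1.
apply: contraT => nsTS.
pose C := gcore_group S T.
have sCS : C \subset S by apply: gcore_sub.
have nCT : (C <| T)%g by apply: gcore_normal.
have ltCT : C \proper T.
  by rewrite properE (normal_sub nCT); apply: contra nsTS => /subset_trans->.
have [D [nDT ltCD]] := normal_extensions_p_solvable psolG sTG nCT ltCT.
have [sCD nsDC] := andP ltCD; have sDT := normal_sub nDT.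
have nsDS : ~~ (D \subset S).
  by apply: contra nsDC => sDS; apply: gcore_max (normal_norm nDT).
case/orP=> [pDC | p'DC]; last first.
  have nCD : D \subset 'N(C)%g by apply: subset_trans (normal_norm nCT).
  case/negP: nsDS; rewrite -indexg_eq1.
  (* The index here is |D : D n S|. It divides |D : C|, and it equals |DS : S|, a divisor of the
     degree |T : S| of beta. *)
  have p'DS : p^'.-nat #|D : S|%g.
    by apply: pnat_dvd (indexgS D sCS) _; rewrite -card_quotient.
  suff pDS : p.-nat #|D : S|%g by apply/eqP; apply: pnat_1 pDS p'DS.
  apply: pnat_dvd n0_p; rewrite def_n.
  have sDST : (D <*> S)%g \subset T by rewrite join_subG sDT.
  rewrite -(Lagrange_index sDST (joing_subr _ _)) dvdn_mull //.
  have nDS : S \subset 'N(D)%g by apply: subset_trans (normal_norm nDT).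
  suff -> : #|(D <*> S)%g : S|%g = #|D : S|%g by [].
  have/eqP := mul_cardG D S; rewrite -norm_joinEr // -(Lagrange (joing_subr D S)).
  rewrite -[X in (X * #|S|)%N](LagrangeI D S) -mulnA [eqbRHS]mulnC.
  by rewrite eqn_pmul2l // [eqbLHS]mulnC eqn_pmul2l // => /eqP->.
case/negP: nsDS.
have [lO [lO_l _]] := affords_lattice Omod (repr_char_affords l).
have spk : rspan (map_repr red (ind_repr lO sST)).
  apply: (modT); have [trI out] := ind_affords sST char0 lO_l.
  by rewrite -def_ind in trI out; split=> // x Tx; rewrite map_ind_repr trI.
apply: (ind_p_section (ltn0Sn 0) spk nCT sCS nDT sCD pDC) => x Cx p'x.
have Sx := subsetP sCS x Cx.
(* The restriction of [l] to C is its own determinant, so by specialness its order is a power of p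
   and it is trivial on p'-elements. *)
have := spec C (normal_subnormal nCT) _ (subg_repr l sCS).
rewrite def_ind => /(_ (mx_abs_irrW (linear_mx_abs_irr _ erefl))).
move=> /(_ (linear_constituent _ sCS sST nCT)).
rewrite /det_order; case: ex_minnP => m /andP[m_gt0 /forall_inP det1] _ m_p.
pose z := l x 0 0.
have lX i : l (x ^+ i)%g 0 0 = z ^+ i.
  elim: i => [|i IHi]; first by rewrite expg0 repr_mx1 mxE.
  by rewrite expgS repr_mxM ?groupX // mxE big_ord1 IHi exprS.
have z1 : z = 1.
  apply: (expr_coprime_eq1 m_gt0 (b := #[x]%g)).
  - exact: pnat_coprime m_p p'x.
  - by have := det1 x Cx; rewrite det_mx11 => /eqP.
  by rewrite -lX expg_order repr_mx1 mxE.
rewrite [lO x]mx11_scalar; congr _%:M; apply: iotaI; rewrite rmorph1 -z1.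
have [trl _] := lO_l; have := trl x Sx.
by rewrite ffunE Sx /mxtrace !big_ord1 mxE.
Qed.

End ModSystem.

(** * Nuclei and anchors *)

Lemma in_Irr_affords (F : fieldType) (gT : finGroupType) (H : {group gT}) theta :
  in_Irr H theta -> exists n (r : mx_representation F H n), (0 < n)%N /\ affords r theta.
Proof.
case=> n [r /mx_irrP[n0 _] ->]; exists n, r; split=> //.
exact: repr_char_affords.
Qed.

Lemma nucleus_Ind (F : fieldType) (p : nat) (gT : finGroupType) (G W : {group gT})
    (chi gamma : {ffun gT -> F}) :
  [pchar F] =i pred0 -> nucleus p G chi W gamma ->
  [/\ W \subset G, in_Irr W gamma & chi = char_Ind W G gamma].
Proof.
move=> char0; elim=> {G chi W gamma} [G chi [irr_chi _] | G chi N theta T psi W gamma].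
  split=> //; have [n [r [_ r_chi]]] := in_Irr_affords irr_chi.
  by rewrite (char_Ind_id char0 r_chi).
move=> _ _ _ [defT _ _ def_chi] _ [sWT irr_gamma def_psi].
have sTG : T \subset G by rewrite defT; apply/subsetP=> x /setIdP[].
split=> //; first exact: subset_trans sTG.
have [n [r [_ [_ out]]]] := in_Irr_affords irr_gamma.
by rewrite -def_chi def_psi char_Ind_trans.
Qed.

(** The trace condition is a bare proposition, so the descent on |Q| uses excluded middle. *)
Lemma anchor_exists (O : idomainType) (K : fieldType) (iota : {rmorphism O -> K})
    (gT : finGroupType) (G Q : {group gT}) (chi : {ffun gT -> K}) :
  trace_condition iota G chi Q ->
  exists P : {group gT}, is_anchor iota G chi P /\ P \subset Q.
Proof.
have [m] := ubnP #|Q|; elim: m Q => // m IHm Q; rewrite ltnS => leQm trQ.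
have [[R [ltRQ trR]] | noR] :=
    classic (exists R : {group gT}, R \proper Q /\ trace_condition iota G chi R).
  have [P [ancP sPR]] := IHm R (leq_trans (proper_card ltRQ) leQm) trR.
  by exists P; split=> //; apply: subset_trans (proper_sub ltRQ).
exists Q; split=> //; split=> // R sRQ trR; apply/eqP/negPn/negP=> neqRQ.
by case: noR; exists R; rewrite properEneq neqRQ.
Qed.

Theorem theorem1p5 (p : nat) (O : idomainType) (K k : fieldType)
    (iota : {rmorphism O -> K}) (red : {rmorphism O -> k})
    (gT : finGroupType) (G : {group gT}) (chi : {ffun gT -> K})
    (Q : {group gT}) (delta : {ffun gT -> K})
    (p_pr : prime p)
    (Omod : modular_system p iota red)
    (splitK : splitting_for_subgroups K G)
    (splitk : splitting_for_subgroups k G)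
    (psolG : p_solvable p G)
    (irr_chi : in_Irr G chi)
    (ibr_chi : restriction_in_IBr p iota red G chi)
    (vtxQ : navarro_vertex p G chi Q delta) :
  (exists P : {group gT}, is_anchor iota G chi P /\ P \subset Q) /\
  (odd p \/ delta = char_triv K Q -> is_anchor iota G chi Q).
Proof.
have char0 := ms_pchar0 Omod.
have [W [gamma [alpha [beta [nucW fac sylQ def_delta]]]]] := vtxQ.
have [spec_alpha spec_beta def_gamma] := fac.
have [sWG _ def_chi] := nucleus_Ind char0 nucW.
have [irr_alpha [a' a'_p' alpha1] _] := spec_alpha.
have [irr_beta _ _] := spec_beta.
have [a [rA [a_gt0 rA_alpha]]] := in_Irr_affords irr_alpha.
have [b [rB [b_gt0 rB_beta]]] := in_Irr_affords irr_beta.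
have [aO [aO_alpha _]] := affords_lattice Omod rA_alpha.
have [bO [bO_beta _]] := affords_lattice Omod rB_beta.
(* The tensor product lattice has rank a b, so its rank is alpha(1) once beta is linear. *)
have gO_gamma : affords (map_repr iota (tens_repr aO bO)) gamma.
  rewrite def_gamma; split=> x Wx; rewrite ffunE.
    rewrite map_tens_repr tens_mx_tr; have [-> // _] := aO_alpha.
    by have [-> // _] := bO_beta.
  by have [_ ->] := aO_alpha; rewrite ?mul0r.
have modG : modular_irr iota red G (char_Ind W G gamma).
  by rewrite -def_chi; apply: restriction_modular_irr ibr_chi.
have m_gt0 : (0 < #|{: 'I_a * 'I_b}|)%N by rewrite card_prod !card_ord muln_gt0 a_gt0.
have trQ := sylow_trace_condition p_pr Omod sWG gO_gamma m_gt0 modG sylQ.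
rewrite -def_chi in trQ; split; first exact: anchor_exists trQ.
move=> odd_or_triv; split=> // R sRQ trR.
have beta1 : beta 1%g = 1.
  case: odd_or_triv => [p_odd | triv_delta]; last first.
    have := congr1 (fun f : {ffun gT -> K} => f 1%g) def_delta.
    by rewrite triv_delta !ffunE group1 => <-.
  apply: (special_linear p_pr Omod p_odd psolG splitK sWG spec_beta).
  apply: (modular_irr_mul a_gt0 aO_alpha).
  by rewrite -def_gamma; apply: (modular_irr_Ind Omod sWG).
have b1 : b = 1%N by apply: (natK_inj Omod); rewrite -(affords1 rB_beta) beta1.
have def_a : a = a' by apply: (natK_inj Omod); rewrite -(affords1 rA_alpha) alpha1.
rewrite def_chi in trR.
apply: (sylow_trace_minimal p_pr Omod sWG gO_gamma m_gt0 modG sylQ) sRQ trR.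
by rewrite card_prod !card_ord b1 muln1 def_a -p'natE.
Qed.
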